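(* Let $\Omega\subset\mathbb{R}^n$, $n\ge3$, be a smooth bounded domain and let $\lambda\ge0$. Let $u\in H^1_0(\Omega)\setminus\{0\}$ and let $\tilde u=\frac{u}{\|u\|_{2^*}}$. Then $u$ is a (weak) solution of $$-\Delta u-\lambda u=|u|^{2^*-2}u\ \text{ in }\Omega,\qquad u=0\ \text{ on }\partial\Omega$$ if and only if there exists $k\ge1$ such that $\mu_k^\lambda(|\tilde u|)=\|u\|_{2^*}^{2^*-2}$ and $\tilde u\in E_k^\lambda(|\tilde u|)$.
   Context: A domain is a connected open set; $2^*=\frac{2n}{n-2}$; $\|\cdot\|_{2^*}$ is the $L^{2^*}(\Omega)$ norm. For a weight $w\in L^{2^*}(\Omega)\setminus\{0\}$, $w\ge0$ a.e., and a linear subspace $V\subset H^1_0(\Omega)$, $\dim_wV=k$ means that $V=\mathrm{Span}(v_1,\dots,v_k)$ for some $v_1,\dots,v_k\in H^1_0(\Omega)$ such that $(w^{\frac{2}{n-2}}v_1,\dots,w^{\frac{2}{n-2}}v_k)$ is linearly independent in $L^2(\Omega)$. For $k\ge1$, $$\mu_k^\lambda(w)=\inf_{\dim_wV=k}\ \max_{v\in V\setminus\{0\}}\frac{\int_\Omega(|\nabla v|^2-\lambda v^2)dx}{\int_\Omega w^{2^*-2}v^2dx}\in[-\infty,+\infty),$$ the infimum being over linear subspaces $V\subset H^1_0(\Omega)$ with $\dim_wV=k$. When $\mu_k^\lambda(w)$ is finite, $E_k^\lambda(w)$ is the space of $\varphi\in H^1_0(\Omega)$ solving weakly $-\Delta\varphi-\lambda\varphi=\mu_k^\lambda(w)w^{2^*-2}\varphi$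 in $\Omega$. *)

(* Defs.v *)
From HB Require Import structures.
From mathcomp Require Import all_boot all_order all_algebra.
From mathcomp Require Import all_classical all_reals all_analysis.

Set Implicit Arguments.
Unset Strict Implicit.
Unset Printing Implicit Defensive.

Import Order.TTheory GRing.Theory Num.Theory.
Import numFieldNormedType.Exports.

Local Open Scope classical_set_scope.
Local Open Scope ring_scope.

(* The measurable sets of R^n are those of the product sigma-algebra
   (generated by the coordinates, as the library does for n.-tuple), which on
   R^n is the Borel sigma-algebra. *)
Definition measure_rV_display : measure_display.
Proof. exact. Qed.

Section measurable_rV.
Variables (R : realType) (n : nat).

Let coord (i : 'I_n) (x : 'rV[R]_n) : R := x ord0 i.

Let rV_set0 : g_sigma_preimage coord set0.
Proof. exact: sigma_algebra0. Qed.

Let rV_setC A : g_sigma_preimage coord A -> g_sigma_preimage coord (~` A).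
Proof. exact: sigma_algebraC. Qed.

Let rV_bigcup (F : (set 'rV[R]_n)^nat) :
  (forall i, g_sigma_preimage coord (F i)) ->
  g_sigma_preimage coord (\bigcup_i (F i)).
Proof. exact: sigma_algebra_bigcup. Qed.

HB.instance Definition _ := @isMeasurable.Build measure_rV_display
  'rV[R]_n (g_sigma_preimage coord) rV_set0 rV_setC rV_bigcup.

Lemma measurable_coord (i : 'I_n) :
  measurable_fun [set: 'rV[R]_n] (fun x : 'rV[R]_n => x ord0 i).
Proof.
move=> _ Y mY; rewrite setTI; apply: sub_sigma_algebra => /=.
rewrite -bigcup_seq/=; exists i => /=; first by rewrite mem_index_enum.
by exists Y => //; rewrite setTI.
Qed.

Lemma measurable_fun_rVP d (T : measurableType d) (f : T -> 'rV[R]_n) :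
  (forall i, measurable_fun [set: T] (fun t => f t ord0 i)) ->
  measurable_fun [set: T] f.
Proof.
move=> mf _ A mA; rewrite setTI.
suff sub : @measurable _ 'rV[R]_n `<=` [set B | measurable (f @^-1` B)].
  exact: sub.
apply: smallest_sub.
  split=> [|B mB|F mF] /=.
  - by rewrite preimage_set0; exact: measurable0.
  - by rewrite setTD preimage_setC; exact: measurableC.
  - by rewrite preimage_bigcup; exact: bigcupT_measurable.
move=> B; rewrite -bigcup_seq/= => -[i _ [Y mY <-]] /=.
by rewrite setTI -comp_preimage -[X in measurable X]setTI; exact: (mf i).
Qed.

End measurable_rV.

Definition consrV (R : realType) (n : nat) (p : R * 'rV[R]_n) : 'rV[R]_n.+1 :=
  row_mx p.1%:M p.2.

Lemma measurable_consrV (R : realType) (n : nat) :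
  measurable_fun [set: R * 'rV[R]_n] (@consrV R n).
Proof.
apply: measurable_fun_rVP => i.
case: (@split_ordP 1 n i) => j -> /=.
- rewrite (_ : (fun _ => _) = fst); first exact: measurable_fst.
  by apply/funext => p; rewrite /consrV (@row_mxEl _ 1 1 n) mxE [j]ord1 mulr1n.
- rewrite (_ : (fun _ => _) = (fun x : 'rV[R]_n => x ord0 j) \o snd).
    exact: (measurableT_comp (measurable_coord j) measurable_snd).
  by apply/funext => p; rewrite /consrV (@row_mxEr _ 1 1 n).
Qed.

Section cons_measure.
Context (R : realType) (n : nat) (m : {measure set 'rV[R]_n -> \bar R}).

Definition cons_measure : set 'rV[R]_n.+1 -> \bar R :=
  pushforward (@lebesgue_measure R \x^ m)%E (@consrV R n).

Let cons_measure0 : cons_measure set0 = 0%E.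
Proof. by rewrite /cons_measure /pushforward preimage_set0 measure0. Qed.

Let cons_measure_ge0 A : (0 <= cons_measure A)%E.
Proof. by rewrite /cons_measure /pushforward; exact: measure_ge0. Qed.

Let cons_measure_sigma_additive : semi_sigma_additive cons_measure.
Proof.
move=> F mF tF mUF; have mf := @measurable_consrV R n.
rewrite /cons_measure /pushforward preimage_bigcup.
apply: measure_semi_sigma_additive.
- by move=> i; rewrite -[X in measurable X]setTI; exact: mf.
- apply/trivIsetP => /= i j _ _ ij; rewrite -preimage_setI.
  by move/trivIsetP : tF => /(_ _ _ _ _ ij) ->//; rewrite preimage_set0.
- by rewrite -preimage_bigcup -[X in measurable X]setTI; exact: mf.
Qed.

HB.instance Definition _ := isMeasure.Build _ _ _ cons_measure
  cons_measure0 cons_measure_ge0 cons_measure_sigma_additive.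

End cons_measure.

(* Lebesgue measure on R^n: the n-fold product of the Lebesgue measure on R
   (a point mass when n = 0). *)
Fixpoint lebesgue_rV (R : realType) (n : nat) :
    {measure set 'rV[R]_n -> \bar R} :=
  match n with
  | 0 => dirac (0 : 'rV[R]_0)
  | m.+1 => cons_measure (lebesgue_rV R m)
  end.

Section smooth_functions.
Variables (R : realType) (n : nat).
Implicit Types (f : 'rV[R]_n -> R) (Omega : set 'rV[R]_n).

Definition partial (i : 'I_n) f (x : 'rV[R]_n) : R := 'D_(delta_mx 0 i) f x.

Fixpoint Ck (k : nat) f : Prop :=
  match k with
  | 0 => continuous f
  | j.+1 => [/\ continuous f,
      forall i x, derivable f x (delta_mx 0 i) &
      forall i, Ck j (partial i f)]
  end.

Definition smooth f : Prop := forall k, Ck k f.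

Definition test_function Omega f : Prop :=
  [/\ smooth f,
      compact (closure [set x | f x != 0]) &
      closure [set x | f x != 0] `<=` Omega].

End smooth_functions.

(* Near each of its boundary points, Omega is the strict epigraph of a smooth
   function gamma of n - 1 of the coordinates, the remaining coordinate j being
   oriented by the sign (-1) ^+ b. *)
Definition smooth_boundary (R : realType) (n : nat) (Omega : set 'rV[R]_n) :=
  forall p, (closure Omega `\` Omega^°) p ->
  exists (r : R) (j : 'I_n) (b : bool) (gamma : 'rV[R]_n.-1 -> R),
    [/\ 0 < r, smooth gamma &
        forall x, ball p r x ->
          (Omega x <-> gamma (col' j x) < (-1) ^+ b * x 0 j)].

Definition smooth_bounded_domain (R : realType) (n : nat)
    (Omega : set 'rV[R]_n) : Prop :=
  [/\ open Omega, connected Omega, bounded_set Omega & smooth_boundary Omega].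

(* Elements of Lebesgue and Sobolev spaces on Omega are represented by
   functions on R^n, of which only the values on Omega matter; two such
   functions stand for the same element when they agree a.e. in Omega. *)
Section sobolev.
Variables (R : realType) (n : nat) (Omega : set 'rV[R]_n).
Implicit Types (u v w f g h : 'rV[R]_n -> R).

Local Notation leb := (lebesgue_rV R n).

Definition Lp (p : R) f : Prop := f \_ Omega \in Lfun leb p%:E.

Definition Lp_norm (p : R) f : \bar R := 'N[leb]_(p%:E)[EFin \o (f \_ Omega)].

Definition is_weak_partial (i : 'I_n) u g : Prop :=
  Lp 2 g /\
  forall phi, test_function Omega phi ->
    \int[leb]_(x in Omega) (u x * partial i phi x) =
    - \int[leb]_(x in Omega) (g x * phi x).

(* A choice of representative; the weak derivative is unique a.e. in Omega. *)
Definition weak_partial (i : 'I_n) u : 'rV[R]_n -> R :=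
  xget (cst 0) [set g | is_weak_partial i u g].

Definition H1 u : Prop :=
  Lp 2 u /\ forall i, exists g, is_weak_partial i u g.

Definition H1_norm u : \bar R :=
  ((Lp_norm 2 u ^+ 2 + \sum_(i < n) Lp_norm 2 (weak_partial i u) ^+ 2)
     `^ 2^-1)%E.

(* H^1_0(Omega): the closure of the test functions in H^1(Omega). *)
Definition H10 u : Prop :=
  H1 u /\
  forall e : R, 0 < e -> exists phi, test_function Omega phi /\
    (H1_norm (fun x => u x - phi x)%R < e%:E)%E.

Definition grad_dot u v (x : 'rV[R]_n) : R :=
  \sum_(i < n) weak_partial i u x * weak_partial i v x.

(* u is a weak solution of - Delta u - lambda u = h in Omega, u = 0 on the
   boundary of Omega. *)
Definition weak_solution (lambda : R) h u : Prop :=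
  H10 u /\
  forall v, H10 v ->
    \int[leb]_(x in Omega) (grad_dot u v x - lambda * (u x * v x)) =
    \int[leb]_(x in Omega) (h x * v x).

Definition crit_exp : R := (2 * n%:R) / (n%:R - 2).

Definition crit_norm u : R := fine (Lp_norm crit_exp u).

Definition fun_span (k : nat) (v : 'I_k -> 'rV[R]_n -> R) :
    set ('rV[R]_n -> R) :=
  [set f | exists c : 'I_k -> R, f = (fun x => \sum_(i < k) c i * v i x)].

Definition lin_indep_ae (k : nat) (v : 'I_k -> 'rV[R]_n -> R) : Prop :=
  forall c : 'I_k -> R,
    (fun x => \sum_(i < k) c i * v i x) = cst 0 %[ae leb in Omega] ->
    forall i, c i = 0.

Definition wdim w (V : set ('rV[R]_n -> R)) (k : nat) : Prop :=
  exists v : 'I_k -> 'rV[R]_n -> R,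
    [/\ forall i, H10 (v i), V = fun_span v &
        lin_indep_ae (fun i x => w x `^ (2 / (n%:R - 2)) * v i x)].

Definition rayleigh (lambda : R) w v : R :=
  (\int[leb]_(x in Omega) (grad_dot v v x - lambda * v x ^+ 2)) /
  (\int[leb]_(x in Omega) (w x `^ (crit_exp - 2) * v x ^+ 2)).

Definition nonzero_ae u : Prop := ~ (u = cst 0 %[ae leb in Omega]).

Definition is_max (A : set R) (m : R) : Prop := A m /\ ubound A m.

(* mu_k^lambda(w). The maximum over V \ {0} exists whenever wdim w V k with
   1 <= k and w in L^(crit_exp), since the quotient is then that of two
   quadratic forms on a finite-dimensional space, the second one positive
   definite. *)
Definition weighted_eig (k : nat) (lambda : R) w : \bar R :=
  ereal_inf [set m%:E | m in [set m | exists V, wdim w V k /\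
    is_max (rayleigh lambda w @` (V `&` nonzero_ae)) m]].

Definition weighted_eigenspace (k : nat) (lambda : R) w :
    set ('rV[R]_n -> R) :=
  [set phi | weighted_eig k lambda w \is a fin_num /\
     weak_solution lambda
       (fun x => fine (weighted_eig k lambda w) *
                 w x `^ (crit_exp - 2) * phi x) phi].

End sobolev.

(* Main.v *)
(* Write q(v) for the integral of |grad v|^2 - lambda v^2 - |u|^(p-2) v^2, where p
   is the critical exponent, N for the L^p norm of u and M = N^(p-2), so that
   M w^(p-2) = |u|^(p-2) for w = |u| / N.  Both equations then differ by the
   factor N, which settles the implication from the eigenfunction to the
   solution.

   Conversely let K be the largest dimension of a space that is independent
   modulo Z = {v : w v = 0 a.e.} and on which q is negative definite; the claim
   is mu_(K+1) = M.  K is finite because q >= 0 on the functions of H^1_0 whose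
   mean vanishes on finitely many small cubes: by Sobolev and Hoelder the weight
   is the sum of a bounded function and of a form-small one, and the Poincare
   inequality on the cubes absorbs the bounded part.  A Rayleigh maximum below M
   on a (K+1)-dimensional space would make q negative there, so mu_(K+1) >= M.
   For the other inequality one needs a (K+1)-dimensional space containing u on
   which q <= 0.  If V is a maximal negative space and u is independent of V
   modulo Z, take V + R u, since u is q-orthogonal to H^1_0.  Otherwise u = y
   modulo Z for some y in V; choose f outside V + Z, made q-orthogonal to V, and
   replace every x in V by x + eps (q(x,y)/q(y,y)) f before adding R u.  The
   Cauchy-Schwarz inequality for q on V keeps q <= 0 when eps is small, and
   independence modulo Z is restored because y itself is moved out of V + Z.
   No unique continuation is needed. *)

From HB Require Import structures.
Require Import Defs.
From mathcomp Require Import all_boot all_order all_algebra.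
From mathcomp Require Import all_classical all_reals all_analysis.
From mathcomp Require Import measurable_realfun ring lra.

Import Order.TTheory GRing.Theory Num.Theory.
Import numFieldNormedType.Exports.

Set Implicit Arguments.
Unset Strict Implicit.
Unset Printing Implicit Defensive.

Local Open Scope classical_set_scope.
Local Open Scope ring_scope.

(** * Row vectors and boxes *)

(** The weight may vanish on a set of positive measure, so mu_k sees functions only modulo Z, while
    the energy does not: on Z the form q is the bare energy, which may be negative when lambda is
    large. Negativity of q therefore does not give independence modulo Z, and both have to be
    carried along. This is also how u can fall into V + Z although q(u, .) = 0 and q < 0 on V: then
    z = u - y lies in Z and q(z, z) = q(y, y) < 0. Adding R u to V would then gain no dimension
    modulo Z. Moving V along f in proportion to the q-component on y does gain one, at a cost in q
    that is quadratic in eps because f is q-orthogonal to V. No eigenfunction has to be constructed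
    for mu_(K+1): u itself attains the maximum M, since q(u, u) = 0. Compactness would serve only to
    make K finite, and the Poincare inequality on a fine grid takes the place of the Rellich theorem
    there. The Sobolev and Poincare inequalities are both proved by splitting off the first
    coordinate, which is how the Lebesgue measure is built. *)

Section row_vectors.
Context (R : realType).
Implicit Types n : nat.

Lemma consrV0 n (t : R) (y : 'rV[R]_n) : consrV (t, y) ord0 ord0 = t.
Proof.
rewrite /consrV; have -> : ord0 = @lshift 1 n ord0 by apply/val_inj.
by rewrite (@row_mxEl _ 1 1 n) mxE eqxx mulr1n.
Qed.

Lemma consrVS n (t : R) (y : 'rV[R]_n) i :
  consrV (t, y) ord0 (lift ord0 i) = y ord0 i.
Proof.
rewrite /consrV; have -> : lift ord0 i = @rshift 1 n i by apply/val_inj.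
by rewrite (@row_mxEr _ 1 1 n).
Qed.

Definition headrV n (x : 'rV[R]_n.+1) : R := x ord0 ord0.
Definition behead_rV n (x : 'rV[R]_n.+1) : 'rV[R]_n :=
  \row_i x ord0 (lift ord0 i).

Lemma consrVK n (x : 'rV[R]_n.+1) : consrV (headrV x, behead_rV x) = x.
Proof.
apply/rowP => i; case: (unliftP ord0 i) => [j ->|->].
  by rewrite consrVS mxE.
by rewrite consrV0.
Qed.

Definition set_coord n (i : 'I_n) (t : R) (x : 'rV[R]_n) : 'rV[R]_n :=
  \row_j (if j == i then t else x ord0 j).

Lemma set_coord_id n (i : 'I_n) (x : 'rV[R]_n) : set_coord i (x ord0 i) x = x.
Proof. by apply/rowP => j; rewrite mxE; case: eqP => // ->. Qed.

Lemma set_coord_line n (i : 'I_n) (s : R) (x : 'rV[R]_n) :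
  set_coord i s x = x + (s - x ord0 i) *: delta_mx 0 i.
Proof.
apply/rowP => j; rewrite !mxE eqxx /=.
by case: eqP => [->|_] /=; rewrite ?mulr1 ?mulr0 ?addr0// addrC subrK.
Qed.

Lemma set_coord0 n (t s : R) (y : 'rV[R]_n) :
  set_coord ord0 s (consrV (t, y)) = consrV (s, y).
Proof.
apply/rowP => i; rewrite mxE; case: (unliftP ord0 i) => [j ->|->].
  by rewrite !consrVS.
by rewrite eqxx consrV0.
Qed.

Lemma set_coordS n (i : 'I_n) (t s : R) (y : 'rV[R]_n) :
  set_coord (lift ord0 i) s (consrV (t, y)) = consrV (t, set_coord i s y).
Proof.
apply/rowP => k; rewrite mxE; case: (unliftP ord0 k) => [j ->|->].
  by rewrite !consrVS mxE (inj_eq lift_inj).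
by rewrite !consrV0.
Qed.

Lemma consrV_lineS n (i : 'I_n) (t s : R) (y : 'rV[R]_n) :
  consrV (t, y + s *: delta_mx 0 i) =
  consrV (t, y) + s *: delta_mx 0 (lift ord0 i).
Proof.
apply/rowP => k; rewrite [RHS]mxE; case: (unliftP ord0 k) => [j ->|->].
  by rewrite !consrVS !mxE /= (inj_eq lift_inj).
by rewrite !consrV0 !mxE /= mulr0 addr0.
Qed.

Lemma consrV_line0 n (t s : R) (y : 'rV[R]_n) :
  consrV (t + s, y) = consrV (t, y) + s *: delta_mx 0 ord0.
Proof.
apply/rowP => k; rewrite [RHS]mxE; case: (unliftP ord0 k) => [j ->|->].
  by rewrite !consrVS !mxE /= mulr0 addr0.
by rewrite !consrV0 !mxE /= mulr1.
Qed.

Lemma continuous_rVP n (T : topologicalType) (f : T -> 'rV[R]_n) :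
  (forall i, continuous (fun t => f t ord0 i)) -> continuous f.
Proof.
move=> cf t; apply/cvgrPdist_lt => e e0.
have : \forall s \near t, forall i, `|f t ord0 i - f s ord0 i| < e.
  apply: filter_forall => i.
  by have /cvgrPdist_lt := cf i t; apply.
apply: filterS => s fs.
rewrite [X in X < _]mx_normrE; apply/bigmax_ltP; split => // -[a b] _.
by rewrite /= (ord1 a) !mxE.
Qed.

Lemma continuous_consrVr n (t : R) : continuous (fun y : 'rV[R]_n => consrV (t, y)).
Proof.
apply: continuous_rVP => i; case: (unliftP ord0 i) => [j ->|->].
  under eq_fun do rewrite consrVS; exact: coord_continuous.
by under eq_fun do rewrite consrV0; exact: cst_continuous.
Qed.

Lemma continuous_line n (x v : 'rV[R]_n) : continuous (fun s : R => x + s *: v).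
Proof.
move=> s; apply: cvgD; first exact: cvg_cst.
by apply: cvgZr_tmp; exact: cvg_id.
Qed.

Lemma measurable_consrVr n (t : R) :
  measurable_fun [set: 'rV[R]_n] (fun y => consrV (t, y)).
Proof.
apply: (measurableT_comp (@measurable_consrV R n)).
exact: measurable_fun_pair.
Qed.

Lemma measurable_consrVl n (y : 'rV[R]_n) :
  measurable_fun [set: R] (fun t => consrV (t, y)).
Proof.
apply: (measurableT_comp (@measurable_consrV R n)).
exact: measurable_fun_pair.
Qed.

Definition closed_box n (a b : 'I_n -> R) : set 'rV[R]_n :=
  [set x | forall i, a i <= x ord0 i <= b i].

Definition open_box n (a b : 'I_n -> R) : set 'rV[R]_n :=
  [set x | forall i, a i < x ord0 i < b i].

Lemma measurable_open_box n (a b : 'I_n -> R) : measurable (open_box a b).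
Proof.
have -> : open_box a b = \big[setI/setT]_(i < n)
    ((fun x : 'rV[R]_n => x ord0 i) @^-1` `]a i, b i[).
  apply/seteqP; split => x; rewrite -bigcap_seq /open_box /=.
    by move=> H i _ /=; rewrite in_itv /=.
  by move=> H i; have := H i; rewrite /= in_itv /= mem_index_enum; exact.
apply: bigsetI_measurable => i _; rewrite -[X in measurable X]setTI.
exact: measurable_coord.
Qed.

(** Boxes centred at rational points with half-side [1/(k+1)] form a countable base, indexed by a
    countable type so that null sets can be united over it. *)
Definition rat_lo n (p : 'rV[rat]_n * nat) (i : 'I_n) : R :=
  ratr (p.1 ord0 i) - p.2.+1%:R^-1.
Definition rat_hi n (p : 'rV[rat]_n * nat) (i : 'I_n) : R :=
  ratr (p.1 ord0 i) + p.2.+1%:R^-1.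

(** The closed box is kept inside [U] because bump functions of the open box are supported in the
    closed one. Both [x] and the points of the box are within [1/(k+1) < e/2] of the rational
    centre. *)
Lemma open_rat_box n (U : set 'rV[R]_n) x : open U -> U x ->
  exists p, open_box (rat_lo p) (rat_hi p) x /\ closed_box (rat_lo p) (rat_hi p) `<=` U.
Proof.
move=> oU Ux.
have : nbhs x U by exact: open_nbhs_nbhs.
move/nbhs_ballP => [e /= e0 eU].
have [k ke] : exists k : nat, k.+1%:R^-1 < e / 2.
  have [k ke] := ltr_add_invr (y := 0) (x := e / 2) (divr_gt0 e0 (ltr0n _ 2)).
  by exists k; rewrite add0r in ke.
have k0 : (0 : R) < k.+1%:R^-1 by rewrite invr_gt0.
set k' := (k.+1%:R^-1 : R) in ke k0 *.
have /choice [q qx] : forall i, exists q : rat, `|ratr q - x ord0 i| < k'.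
  move=> i; have [|q] := @rat_in_itvoo R (x ord0 i - k') (x ord0 i).
    by rewrite ltrBlDr ltrDl.
  rewrite in_itv /= => /andP[q1 q2]; exists q.
  by rewrite ltr_norml; apply/andP; split; lra.
exists (\row_i q i, k); rewrite /rat_lo /rat_hi; split => [i|y yq].
  have := qx i; rewrite /= mxE -/k' ltr_norml => /andP[q1 q2].
  by apply/andP; split; lra.
apply: eU; split => // a i; rewrite (ord1 a) /ball /=.
have := yq i; have := qx i; rewrite /= mxE -/k' => A C.
have {}C : `|ratr (q i) - y ord0 i| <= k'.
  by case/andP : C => C1 C2; rewrite ler_norml; apply/andP; split; lra.
rewrite (_ : _ - _ = (ratr (q i) - y ord0 i) - (ratr (q i) - x ord0 i)); last by ring.
apply: le_lt_trans (ler_normB _ _) _.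
by rewrite (splitr e); apply: ltrD; [exact: le_lt_trans ke|exact: lt_trans ke].
Qed.

Lemma open_bigcup_rat_box n (U : set 'rV[R]_n) : open U ->
  U = \bigcup_(p in [set p | closed_box (rat_lo p) (rat_hi p) `<=` U])
    open_box (rat_lo p) (rat_hi p).
Proof.
move=> oU; apply/seteqP; split => [x /(open_rat_box oU)[p [px pU]]|x [p pU px]].
  by exists p.
by apply: pU => i; have /andP[/ltW -> /ltW ->] := px i.
Qed.

Lemma countable_bigcup_measurable d (T : measurableType d) (I : countType)
    (D : set I) (F : I -> set T) :
  (forall i, measurable (F i)) -> measurable (\bigcup_(i in D) F i).
Proof.
move=> mF; rewrite bigcup_mkcond.
by apply: countable_bigcupT_measurable => // i; case: ifP.
Qed.

Lemma open_measurable_rV n (U : set 'rV[R]_n) : open U -> measurable U.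
Proof.
move=> oU; rewrite (open_bigcup_rat_box oU).
by apply: countable_bigcup_measurable => p; exact: measurable_open_box.
Qed.

Lemma open_box_setI n (a b c d : 'I_n -> R) :
  open_box a b `&` open_box c d =
  open_box (fun i => Num.max (a i) (c i)) (fun i => Num.min (b i) (d i)).
Proof.
apply/seteqP; split => [x [ab cd] i|x H].
  by rewrite gt_max lt_min; have /andP[-> ->] := ab i; have /andP[-> ->] := cd i.
by split=> i; have := H i; rewrite gt_max lt_min => /andP[/andP[? ?] /andP[? ?]];
  apply/andP.
Qed.

(** Open boxes are stable under intersection, so this makes Dynkin induction over them available for
    all measurable sets. *)
Lemma measurable_rV_open_boxes n : @measurable _ 'rV[R]_n =
  <<s [set open_box ab.1 ab.2 | ab in [set: ('I_n -> R) * ('I_n -> R)]] >>.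
Proof.
set G := [set _ | _ in _]; apply/seteqP; split; last first.
  apply: smallest_sub; first exact: sigma_algebra_measurable.
  by move=> _ [ab _ <-]; exact: measurable_open_box.
suff mid : measurable_fun setT (id : g_sigma_algebraType G -> 'rV[R]_n).
  by move=> A mA; have := mid measurableT A mA; rewrite setTI.
apply: measurable_fun_rVP => i _.
apply: (measurability _ (RGenOInfty.measurableE R)) => //.
move=> _ [_ [r ->] <-]; rewrite setTI.
have oU : open ((fun x : 'rV[R]_n => x ord0 i) @^-1` `]r, +oo[).
  by apply: open_comp => // x _; exact: coord_continuous.
rewrite [X in measurable X](open_bigcup_rat_box oU).
apply: (@countable_bigcup_measurable _ (g_sigma_algebraType G)) => p.
by apply: sub_sigma_algebra; exists (rat_lo p, rat_hi p).
Qed.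

Lemma continuous_measurable_rV n (f : 'rV[R]_n -> R) :
  continuous f -> measurable_fun setT f.
Proof.
move=> cf; apply: (measurability _ (RGenOInfty.measurableE R)) => //.
move=> _ [_ [r ->] <-]; rewrite setTI; apply: open_measurable_rV.
by apply: open_comp => //; exact: open_gt.
Qed.

End row_vectors.

(** * Lebesgue measure on R^n *)

Section lebesgue_row_vectors.
Context (R : realType).
Implicit Types n : nat.

(** Half-open, so that the cubes of a grid are disjoint and cover. *)
Definition box n (a b : 'I_n -> R) : set 'rV[R]_n :=
  [set x | forall i, a i <= x ord0 i < b i].

Lemma measurable_box n (a b : 'I_n -> R) : measurable (box a b).
Proof.
rewrite (_ : box a b = \big[setI/setT]_(i < n)
    ((fun x : 'rV[R]_n => x ord0 i) @^-1` `[a i, b i[)); last first.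
  apply/seteqP; split => x; rewrite -bigcap_seq /box /=.
    by move=> H i _ /=; rewrite in_itv /=.
  by move=> H i; have := H i; rewrite /= in_itv /= mem_index_enum; exact.
apply: bigsetI_measurable => i _; rewrite -[X in measurable X]setTI.
exact: measurable_coord.
Qed.

Lemma box_consrV n (a b : 'I_n.+1 -> R) t y : box a b (consrV (t, y)) <->
  a ord0 <= t < b ord0 /\
  box (fun i => a (lift ord0 i)) (fun i => b (lift ord0 i)) y.
Proof.
split=> [H|[H0 H] i].
  split; first by have := H ord0; rewrite consrV0.
  by move=> i; have := H (lift ord0 i); rewrite consrVS.
case: (unliftP ord0 i) => [j ->|->]; first by rewrite consrVS; exact: H.
by rewrite consrV0.
Qed.

Lemma lebesgue_box n (a b : 'I_n -> R) : (forall i, a i <= b i) ->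
  lebesgue_rV R n (box a b) = (\prod_i (b i - a i))%:E.
Proof.
elim: n a b => [|n IH] a b ab.
  by rewrite /= diracE mem_set ?big_ord0// => -[].
rewrite /= /cons_measure /pushforward.
rewrite (_ : _ @^-1` _ = `[a ord0, b ord0[%classic `*`
  box (fun i => a (lift ord0 i)) (fun i => b (lift ord0 i))); last first.
  by apply/seteqP; split => -[t y] /=; rewrite in_itv /=; move/box_consrV.
rewrite product_measure2E//; last exact: measurable_box.
rewrite IH; last by move=> i; exact: ab.
rewrite [X in (X * _)%E](lebesgue_measure_itv `[a ord0, b ord0[) /= big_ord_recl EFinM lte_fin.
have [//|ba] := ltP (a ord0) (b ord0).
have -> : b ord0 = a ord0 by apply/le_anti; rewrite ba ab.
by rewrite subrr.
Qed.

Lemma sigma_finite_lebesgue_rV n : sigma_finite setT (lebesgue_rV R n).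
Proof.
exists (fun k => box (fun=> - k%:R) (fun=> k%:R)).
  apply/esym/seteqP; split => // x _.
  pose m := `|x|; have [k mk] : exists k : nat, m < k%:R.
    exists (Num.truncn m).+1; exact: truncnS_gt.
  exists k => // i; suff : `|x ord0 i| < k%:R by rewrite ltr_norml => /andP[/ltW -> ->].
  apply: le_lt_trans mk; rewrite /m [leRHS]mx_normrE.
  by apply: le_trans (le_bigmax _ _ (ord0, i)).
move=> k; split; first exact: measurable_box.
by rewrite [X in X _]/= lebesgue_box ?ltry// => i; rewrite -subr_ge0 opprK addr_ge0.
Qed.

(** The same measure under a name of its own, to which a sigma-finite structure can be attached;
    Fubini and Tonelli are applied to this copy. *)
Definition lebesgue_rV_fun n : set 'rV[R]_n -> \bar R := lebesgue_rV R n.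

HB.instance Definition _ n := Measure.copy (@lebesgue_rV_fun n) (lebesgue_rV R n).

HB.instance Definition _ n := Measure_isSigmaFinite.Build _ _ _
  (@lebesgue_rV_fun n) (@sigma_finite_lebesgue_rV n).

Local Notation leb n := (lebesgue_rV R n).
Local Notation mu := (@lebesgue_measure R).
Local Open Scope ereal_scope.

Lemma measurable_comp_consrV n d (T : measurableType d)
    (f : 'rV[R]_n.+1 -> T) :
  measurable_fun setT f -> measurable_fun setT (f \o @consrV R n).
Proof. by move=> mf; exact: measurableT_comp mf (@measurable_consrV R n). Qed.

Lemma tonelli_consrV n (f : 'rV[R]_n.+1 -> \bar R) :
  measurable_fun setT f -> (forall x, 0 <= f x) ->
  \int[leb n.+1]_x f x = \int[mu]_t \int[leb n]_y f (consrV (t, y)).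
Proof.
move=> mf f0; pose M : {sigma_finite_measure set 'rV[R]_n -> \bar R} := @lebesgue_rV_fun n.
transitivity (\int[mu \x^ leb n]_p f (consrV p)).
  rewrite [LHS](_ : _ =
    \int[pushforward (mu \x^ leb n) (@consrV R n)]_x f x)//.
  by rewrite ge0_integral_pushforward//; exact: measurable_consrV.
(* [cons_measure] uses the product [\x^], Tonelli is about [\x]; the two agree on rectangles, hence
   everywhere by uniqueness. *)
transitivity (\int[mu \x M]_p f (consrV p)).
  apply: eq_measure_integral => A mA _; apply/esym.
  by apply: product_measure_unique => // B C mB mC; exact: product_measure2E.
exact: (@fubini_tonelli1 _ _ _ _ R mu M (f \o @consrV R n)
  (measurable_comp_consrV mf) (fun p => f0 _)).
Qed.

Lemma tonelli_consrV_swap n (f : 'rV[R]_n.+1 -> \bar R) :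
  measurable_fun setT f -> (forall x, 0 <= f x) ->
  \int[leb n.+1]_x f x = \int[leb n]_y \int[mu]_t f (consrV (t, y)).
Proof.
move=> mf f0; rewrite tonelli_consrV//; pose M : {sigma_finite_measure set 'rV[R]_n -> \bar R} := @lebesgue_rV_fun n.
apply: (@fubini_tonelli _ _ _ _ R mu M (f \o @consrV R n)) => //;
  [exact: measurable_comp_consrV|by move=> p; exact: f0].
Qed.

Lemma measurable_int_consrVr n (f : 'rV[R]_n.+1 -> \bar R) :
  measurable_fun setT f -> (forall x, 0 <= f x) ->
  measurable_fun setT (fun t => \int[leb n]_y f (consrV (t, y))).
Proof.
move=> mf f0; pose M : {sigma_finite_measure set 'rV[R]_n -> \bar R} := @lebesgue_rV_fun n.
apply: (@measurable_fun_fubini_tonelli_F _ _ _ _ R M (f \o @consrV R n)) => //;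
  [exact: measurable_comp_consrV|by move=> p; exact: f0].
Qed.

Lemma measurable_int_consrVl n (f : 'rV[R]_n.+1 -> \bar R) :
  measurable_fun setT f -> (forall x, 0 <= f x) ->
  measurable_fun setT (fun y => \int[mu]_t f (consrV (t, y))).
Proof.
move=> mf f0.
apply: (@measurable_fun_fubini_tonelli_G _ _ _ _ R mu (f \o @consrV R n)) => //;
  [exact: measurable_comp_consrV|by move=> p; exact: f0].
Qed.

Lemma integrable_consrV n (f : 'rV[R]_n.+1 -> \bar R) :
  (leb n.+1).-integrable setT f ->
  (mu \x @lebesgue_rV_fun n).-integrable setT (f \o @consrV R n).
Proof.
move=> /integrableP[mf fi]; pose M : {sigma_finite_measure set 'rV[R]_n -> \bar R} := @lebesgue_rV_fun n.
apply/(@integrable12ltyP _ _ _ _ R mu M); first exact: measurable_comp_consrV.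
move: fi; rewrite tonelli_consrV//; exact: measurableT_comp.
Qed.

Lemma fubini_consrV n (f : 'rV[R]_n.+1 -> \bar R) :
  (leb n.+1).-integrable setT f ->
  \int[leb n.+1]_x f x = \int[mu]_t \int[leb n]_y f (consrV (t, y)).
Proof.
move=> fi; pose M : {sigma_finite_measure set 'rV[R]_n -> \bar R} := @lebesgue_rV_fun n.
have fic := integrable_consrV fi.
rewrite (@integral12_prod_meas1 _ _ _ _ R mu M _ fic).
rewrite -(@integral12_prod_meas1 _ _ _ _ R mu M _ fic).
rewrite (@integral12_prod_meas2 _ _ _ _ R mu M _ fic).
rewrite [LHS](_ : _ =
    \int[pushforward (mu \x^ leb n) (@consrV R n)]_x f x)//.
rewrite integral_pushforward//.
- exact: measurable_consrV.
- by move/integrableP : fi => [].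
have /integrableP[mfc fic'] := fic.
apply/integrableP; split => //.
rewrite (_ : \int[_]_x _ = \int[mu \x M]_x `|(f \o @consrV R n) x|)//.
apply: eq_measure_integral => A mA _; apply/esym.
by apply: product_measure_unique => // B C mB mC; exact: product_measure2E.
Qed.

Lemma fubini_consrV_swap n (f : 'rV[R]_n.+1 -> \bar R) :
  (leb n.+1).-integrable setT f ->
  \int[leb n.+1]_x f x = \int[leb n]_y \int[mu]_t f (consrV (t, y)).
Proof.
move=> fi; rewrite fubini_consrV//.
exact: (@Fubini _ _ _ _ R mu (@lebesgue_rV_fun n) _ (integrable_consrV fi)).
Qed.

End lebesgue_row_vectors.

(** * Bump functions *)

Section directional_derivatives.
Context (R : realType) (V : normedModType R).
Implicit Types (f : V -> R) (x v : V).

(** Both difference quotients are the same function of the increment. This reduces partial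
    derivatives to the one-variable chain rule and the fundamental theorem of calculus. *)
Lemma is_derive_line f x v (s d : R) :
  is_derive s (1 : R) (fun r : R => f (x + r *: v)) d <->
  is_derive (x + s *: v) v f d.
Proof.
have E : (fun h : R => h^-1 *: (((fun r : R => f (x + r *: v)) \o shift s)
      (h *: (1 : R)) - f (x + s *: v))) =
    (fun h : R => h^-1 *: ((f \o shift (x + s *: v)) (h *: v)
      - f (x + s *: v))).
  apply/funext => h /=; congr (_ *: (f _ - _)).
  by rewrite -[X in X *: v]/(h * 1 + s) mulr1 scalerDl addrCA addrA.
by split => -[D Dd]; split; rewrite ?/derivable ?/derive; move: D Dd;
  rewrite /derivable /derive E.
Qed.

Lemma is_derive_continuous (h : R -> R) (s d : R) :
  is_derive s (1 : R) h d -> {for s, continuous h}.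
Proof.
by move=> [D _]; apply: differentiable_continuous; exact/derivable1_diffP.
Qed.

Lemma is_derive_comp (g h : R -> R) (s dh dg : R) :
  is_derive s (1 : R) h dh -> is_derive (h s) (1 : R) g dg ->
  is_derive s (1 : R) (g \o h) (dg * dh).
Proof.
move=> [hD hd] [gD gd].
have D : derivable (g \o h) s 1.
  apply/derivable1_diffP; apply: differentiable_comp.
    by move/derivable1_diffP : hD.
  by move/derivable1_diffP : gD.
split; first exact: D.
by rewrite -derive1E (derive1_comp hD gD) !derive1E hd gd.
Qed.

End directional_derivatives.

Section flat_functions.
Context (R : realType).
Implicit Types p : {poly R}.

(* flat p t = p(1/t) exp(-1/t) for t > 0, extended by 0; this family of
   functions is closed under differentiation. *)
Definition flat p (t : R) : R :=
  if 0 < t then p.[t^-1] * expR (- t^-1) else 0.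

(** The quadratic bound is what makes [flat p] differentiable at 0 with derivative 0. *)
Lemma flat_bound p :
  exists2 C : R, 0 <= C & forall t, t <= 1 -> `|flat p t| <= C * t ^+ 2.
Proof.
pose A := \sum_(i < size p) `|p`_i|.
have A0 : 0 <= A by apply: sumr_ge0.
(* For [s = 1/t >= 1], [p] is at most [A s^(size p)] and [expR s] at least [s^(m+1)/(m+1)!]; since
   [m + 1 = size p + 2], two powers of [t] are left. *)
pose m := (size p).+1.
exists (A * m.+1`!%:R); first by rewrite mulr_ge0.
move=> t t1; rewrite /flat; case: ifPn => [t0|_]; last first.
  by rewrite normr0 mulr_ge0 ?sqr_ge0// mulr_ge0.
set s := t^-1; have s1 : 1 <= s by rewrite /s invf_ge1.
have s0 : 0 < s by rewrite invr_gt0.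
have pA : `|p.[s]| <= A * s ^+ (size p).
  rewrite horner_coef mulr_suml; apply: le_trans (ler_norm_sum _ _ _) _.
  apply: ler_sum => i _; rewrite normrM ler_wpM2l// normrX (gtr0_norm s0).
  by apply: ler_weXn2l => //; exact: ltnW.
have eB : expR (- s) <= m.+1`!%:R / s ^+ m.+1.
  rewrite expRN -[leRHS]invrK invf_div lef_pV2 ?posrE ?expR_gt0//; last first.
    by rewrite divr_gt0 ?exprn_gt0// ltr0n fact_gt0.
  by apply: le_trans (expR_ge1Dxn m (ltW s0)); rewrite lerDr.
rewrite normrM (gtr0_norm (expR_gt0 _)).
apply: le_trans (ler_pM _ _ pA eB) _; rewrite ?expR_ge0//.
have -> : t = s^-1 by rewrite invrK.
clearbody s; rewrite exprVn -!mulrA ler_wpM2l// mulrCA ler_wpM2l//.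
rewrite /m -(addn2 (size p)) exprD invfM mulrA mulfV ?mul1r//.
by rewrite expf_neq0// gt_eqF.
Qed.

(** With [s = 1/t] one has [ds/dt = - s^2], so [p(s) exp(-s)] has derivative
    [s^2 (p - p')(s) exp(-s)]. *)
Lemma is_derive_flat p (t : R) :
  is_derive t (1 : R) (flat p) (flat ('X^2 * (p - p^`())) t).
Proof.
have [t0|t0|->] := ltgtP t 0.
- have -> : flat ('X^2 * (p - p^`())) t = 0 by rewrite /flat ltNge ltW.
  apply: (@near_eq_is_derive _ _ _ (cst (0 : R))).
  near=> s; rewrite /flat ltNge (_ : s <= 0)//.
  by apply/ltW; near: s; exact: lt_nbhsl.
- have D1 : is_derive t (1 : R) (fun t : R => t^-1) (- t ^- 2).
    have t_neq0 : id t != 0 by rewrite /= gt_eqF.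
    have := is_deriveV t_neq0 (@is_derive_id R R t 1).
    by rewrite -[_ *: 1]/(_ * 1) mulr1.
  have D2 : is_derive t (1 : R) (fun t : R => - t^-1) (t ^- 2).
    by have := is_deriveN D1; rewrite opprK.
  have Dp := is_derive_comp D1 (is_derive_poly p (t^-1)).
  have De := is_derive_comp D2 (is_derive_expR (- t^-1)).
  apply: (@near_eq_is_derive _ _ _ ((horner p \o (fun t : R => t^-1)) *
     (expR \o (fun t : R => - t^-1)))).
    near=> s; rewrite /flat (_ : 0 < s)//.
    by near: s; exact: lt_nbhsr.
  apply: is_derive_eq; rewrite /flat t0 !hornerE /=.
  rewrite -![_ *: _]/(_ * _) exprVn; ring.
- have -> : flat ('X^2 * (p - p^`())) 0 = 0 by rewrite /flat ltxx.
  have [C C0 HC] := flat_bound p.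
  have cv : (fun h : R => h^-1 *: ((flat p \o shift 0) (h *: (1 : R)) - flat p 0))
      @ 0^' --> (0 : R).
    apply/cvgrPdist_le => e e0.
    near=> h; rewrite sub0r normrN /= addr0 /flat ltxx subr0 -/(flat p _).
    rewrite -[_ *: _]/(_ * _) -[h *: _]/(h * 1) mulr1 normrM normfV.
    have h0 : h != 0 by near: h; exact: nbhs_dnbhs_neq.
    rewrite ler_pdivrMl ?normr_gt0//.
    have h1 : h <= 1.
      apply: le_trans (ler_norm _) _; near: h; apply: dnbhs0_le; exact: ltr01.
    apply: le_trans (HC _ h1) _; rewrite -real_normK ?num_real// expr2.
    rewrite mulrCA ler_wpM2l//.
    have he : `|h| <= e / (C + 1).
      by near: h; apply: dnbhs0_le; rewrite divr_gt0// ltr_wpDl.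
    have : `|h| * (C + 1) <= e by rewrite -ler_pdivlMr// ltr_wpDl.
    have := normr_ge0 h; nra.
  split; first by apply/cvg_ex; exists 0.
  exact: cvg_lim cv.
Unshelve. all: by end_near. Qed.

Lemma flat1_ge0 (t : R) : 0 <= flat 1 t.
Proof. by rewrite /flat; case: ifP => // _; rewrite hornerE mul1r expR_ge0. Qed.

Lemma flat1_le1 (t : R) : flat 1 t <= 1.
Proof.
rewrite /flat; case: ifPn => // t0; rewrite hornerE mul1r -expR0 ler_expR.
by rewrite oppr_le0 invr_ge0 ltW.
Qed.

Lemma flat1_eq0 (t : R) : t <= 0 -> flat 1 t = 0.
Proof. by rewrite /flat ltNge => ->. Qed.

Lemma flat1_cvg (t : R) : 0 < t -> flat 1 (m.+1%:R * t) @[m --> \oo] --> (1 : R).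
Proof.
move=> t0; rewrite (_ : (fun m => _) = (fun m => expR (- (m.+1%:R^-1 * t^-1)))).
  rewrite -[X in _ --> X]expR0; apply: continuous_cvg.
    exact: continuous_expR.
  rewrite -oppr0; apply: cvgN; rewrite -(mul0r t^-1).
  apply: cvgMr_tmp; exact: cvg_harmonic.
apply/funext => m; rewrite /flat mulr_gt0// hornerE mul1r invfM.
by [].
Qed.

End flat_functions.

(** * Calculus of the classes [Ck], and smooth approximations of the indicator of a box *)

Section smooth_calculus.
Context (R : realType) (n : nat).
Implicit Types (f g : 'rV[R]_n -> R) (Omega : set 'rV[R]_n).

Lemma Ck_cst k (c : R) : Ck k (fun _ : 'rV[R]_n => c).
Proof.
elim: k c => [c|k IH c] /=; first exact: cst_continuous.
split; [exact: cst_continuous|move=> i x; exact: derivable_cst|].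
move=> i; rewrite (_ : partial i _ = fun=> 0); first exact: IH.
by apply/funext => x; rewrite /partial derive_cst.
Qed.

Lemma CkW k f : Ck k.+1 f -> Ck k f.
Proof.
elim: k f => [f []//|k IH f] [cf df pf]; split => // i; apply: IH; exact: pf.
Qed.

Lemma partialD i f g x : derivable f x (delta_mx 0 i) ->
  derivable g x (delta_mx 0 i) ->
  partial i (fun x => f x + g x) x = partial i f x + partial i g x.
Proof. exact: deriveD. Qed.

Lemma partialM i f g x : derivable f x (delta_mx 0 i) ->
  derivable g x (delta_mx 0 i) ->
  partial i (fun x => f x * g x) x = f x * partial i g x + g x * partial i f x.
Proof. exact: deriveM. Qed.

Lemma partialZ i (c : R) f x : derivable f x (delta_mx 0 i) ->
  partial i (fun x => c * f x) x = c * partial i f x.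
Proof. exact: deriveZ. Qed.

Lemma CkD k f g : Ck k f -> Ck k g -> Ck k (fun x => f x + g x).
Proof.
elim: k f g => [f g cf cg x|k IH f g [cf df pf] [cg dg pg]].
  exact: cvgD (cf x) (cg x).
split => [x|i x|i]; first exact: cvgD (cf x) (cg x).
  exact: derivableD.
have -> : partial i (fun x => f x + g x) =
    fun x => partial i f x + partial i g x.
  by apply/funext => x; rewrite partialD.
by apply: IH; [exact: pf|exact: pg].
Qed.

Lemma CkM k f g : Ck k f -> Ck k g -> Ck k (fun x => f x * g x).
Proof.
elim: k f g => [f g cf cg x|k IH f g Cf Cg].
  exact: cvgM (cf x) (cg x).
have [cf df pf] := Cf; have [cg dg pg] := Cg.
split => [x|i x|i]; first exact: cvgM (cf x) (cg x).
  exact: derivableM.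
have -> : partial i (fun x => f x * g x) =
    fun x => f x * partial i g x + g x * partial i f x.
  by apply/funext => x; rewrite partialM.
by apply: CkD; apply: IH; [exact: CkW|exact: pg|exact: CkW|exact: pf].
Qed.

Lemma Ck_prod k (I : Type) (r : seq I) (F : I -> 'rV[R]_n -> R) :
  (forall i, Ck k (F i)) -> Ck k (fun x => \prod_(i <- r) F i x).
Proof.
move=> CF; elim: r => [|i r IH].
  by under eq_fun do rewrite big_nil; exact: Ck_cst.
by under eq_fun do rewrite big_cons; exact: CkM.
Qed.

Lemma flatZ (c : R) p t : flat (c *: p) t = c * flat p t.
Proof. by rewrite /flat; case: ifP; rewrite ?mulr0// hornerZ mulrA. Qed.

Lemma is_derive_flat_coord p (a b : R) i j x :
  is_derive x (delta_mx 0 j) (fun x : 'rV[R]_n => flat p (a * x 0 i + b))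
    (flat ((a * (i == j)%:R) *: ('X^2 * (p - p^`()))) (a * x 0 i + b)).
Proof.
rewrite -{1}[x]addr0 -{1}[0](scale0r (delta_mx 0 j)); apply/is_derive_line.
have E : (fun r : R => flat p (a * (x + r *: delta_mx 0 j) 0 i + b)) =
    flat p \o ((a * (i == j)%:R) \*: id + cst (a * x 0 i + b)).
  apply/funext => r /=; congr flat.
  rewrite -[X in _ = X]/(a * (i == j)%:R * r + _) !mxE eqxx /=; ring.
rewrite E flatZ [X in is_derive _ _ _ X]mulrC.
have D : is_derive 0 (1 : R) ((a * (i == j)%:R) \*: id + cst (a * x 0 i + b))
    (a * (i == j)%:R).
  by apply: is_derive_eq; rewrite -[_ *: 1]/(_ * 1) mulr1 addr0.
apply: is_derive_eq; first exact: is_derive_comp D (is_derive_flat p _).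
by congr (flat _ _ * _); rewrite -[LHS]/(a * (i == j)%:R * 0 + _) mulr0 add0r.
Qed.

(** A partial derivative only changes the polynomial, the factor [a * (i == j)] included, so the
    induction on [k] runs with [p] generalized. *)
Lemma Ck_flat_coord k p (a b : R) i :
  Ck k (fun x : 'rV[R]_n => flat p (a * x 0 i + b)).
Proof.
have cont q : continuous (fun x : 'rV[R]_n => flat q (a * x 0 i + b)).
  move=> x; apply: (@continuous_comp _ _ _ (fun x : 'rV[R]_n => x 0 i)
    (fun t : R => flat q (a * t + b))); first exact: coord_continuous.
  have D : is_derive (x 0 i) (1 : R) (a \*: id + cst b) a.
    by apply: is_derive_eq; rewrite -[_ *: 1]/(_ * 1) mulr1 addr0.
  exact: is_derive_continuous (is_derive_comp D (is_derive_flat q _)).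
elim: k p => [p|k IH p] //=; split=> // [j x|j].
  by have [] := is_derive_flat_coord p a b i j x.
rewrite (_ : partial j _ = fun x =>
  flat ((a * (i == j)%:R) *: ('X^2 * (p - p^`()))) (a * x 0 i + b))//.
by apply/funext => x; have [_] := is_derive_flat_coord p a b i j x.
Qed.

Lemma test_function_lin Omega (a b : R) f g :
  test_function Omega f -> test_function Omega g ->
  test_function Omega (fun x => a * f x + b * g x).
Proof.
move=> [sf cf Of] [sg cg Og].
have S : closure [set x | a * f x + b * g x != 0] `<=`
    closure [set x | f x != 0] `|` closure [set x | g x != 0].
  rewrite -closureU; apply: closure_subset => x /=.
  apply: contra_neqP => /not_orP[/negP/negPn/eqP -> /negP/negPn/eqP ->].
  by rewrite !mulr0 addr0.
split.
- by move=> k; apply: CkD; apply: CkM => //; exact: Ck_cst.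
- apply: subclosed_compact S; first exact: closed_closure.
  exact: compactU.
- by apply: subset_trans S _ => x [/Of|/Og].
Qed.

Lemma test_function_bounded_support Omega f : test_function Omega f ->
  exists2 L : R, 0 < L & forall x, f x != 0 -> forall i, - L < x ord0 i < L.
Proof.
move=> [_ cf _]; have [M [_ HM]] := compact_bounded cf.
exists (`|M| + 2) => [|x fx i]; first by rewrite ltr_wpDl.
rewrite -ltr_norml; apply: (@le_lt_trans _ _ (`|M| + 1)); last first.
  by rewrite ltrD2l; lra.
apply: le_trans (HM (`|M| + 1) _ x _).
- by rewrite [leRHS]mx_normrE; apply: le_trans (le_bigmax _ _ (ord0, i)).
- by rewrite (le_lt_trans (ler_norm _))// ltrDl.
- exact: subset_closure.
Qed.

Lemma test_function_eq0 Omega f x : test_function Omega f -> ~ Omega x -> f x = 0.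
Proof.
move=> [_ _ fO] nO; apply/eqP; apply: contra_notT nO => fx.
by apply: fO; exact: subset_closure.
Qed.

Lemma compact_closed_box (a b : 'I_n -> R) : compact (closed_box a b).
Proof.
have -> : closed_box a b =
    [set x | forall i, `[a i, b i]%classic (x ord0 i)].
  by apply/seteqP; split => x H i; have := H i; rewrite /= in_itv.
exact: (@rV_compact R n (fun i => `[a i, b i]%classic)
  (fun i => @segment_compact R _ _)).
Qed.

Lemma open_box_sub (a b : 'I_n -> R) : open_box a b `<=` closed_box a b.
Proof. by move=> x H i; have /andP[/ltW -> /ltW ->] := H i. Qed.

(** Positive exactly on the open box; as the steepness [m] grows it tends to the indicator of that
    box while staying below 1. *)
Definition bump (a b : 'I_n -> R) (m : nat) (x : 'rV[R]_n) : R :=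
  \prod_i (flat 1 (m.+1%:R * (x ord0 i - a i)) *
           flat 1 (m.+1%:R * (b i - x ord0 i))).

Lemma bump_ge0 (a b : 'I_n -> R) m x : 0 <= bump a b m x.
Proof. by apply: prodr_ge0 => i _; rewrite mulr_ge0// flat1_ge0. Qed.

Lemma bump_le1 (a b : 'I_n -> R) m x : bump a b m x <= 1.
Proof.
apply: (@le_trans _ _ (\prod_(i < n) 1)); last by rewrite big1_eq.
apply: ler_prod => i _; rewrite mulr_ge0 ?flat1_ge0//=.
by rewrite mulr_ile1 ?flat1_ge0 ?flat1_le1.
Qed.

Lemma bump_eq0 (a b : 'I_n -> R) m x : ~ open_box a b x -> bump a b m x = 0.
Proof.
move=> nx; apply/eqP/prodf_eq0.
have [i] : exists i, ~ (a i < x ord0 i < b i) by exact/existsNP.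
move=> /negP; rewrite negb_and -!leNgt => xi; exists i => //.
case/orP: xi => xi; rewrite mulf_eq0.
  by rewrite flat1_eq0 ?eqxx// pmulr_rle0// subr_le0.
by rewrite [flat 1 (_ * (b i - _))]flat1_eq0 ?eqxx ?orbT// pmulr_rle0// subr_le0.
Qed.

Lemma bump_gt0 (a b : 'I_n -> R) m x : open_box a b x -> 0 < bump a b m x.
Proof.
move=> H; apply: prodr_gt0 => i _; have /andP[xa xb] := H i.
have flat_gt0 (t : R) : 0 < t -> 0 < flat 1 t.
  by rewrite /flat => ->; rewrite hornerE mul1r expR_gt0.
by rewrite mulr_gt0// flat_gt0// pmulr_rgt0// subr_gt0.
Qed.

Lemma bump_cvg (a b : 'I_n -> R) x : bump a b m x @[m --> \oo] --> (\1_(open_box a b) x : R).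
Proof.
have [xin|xnin] := pselect (open_box a b x); last first.
  rewrite indicE memNset//; under eq_fun do rewrite bump_eq0//.
  exact: cvg_cst.
rewrite indicE mem_set//= (_ : 1%:R = \prod_(i < n) 1 :> R); last by rewrite big1_eq.
apply: cvg_big => [|i _]; first exact: mul_continuous.
have /andP[xa xb] := xin i; rewrite -[X in _ --> X]mulr1.
by apply: cvgM; apply: flat1_cvg; rewrite subr_gt0.
Qed.

Lemma bump_test_function Omega (a b : 'I_n -> R) m : closed_box a b `<=` Omega ->
  test_function Omega (bump a b m).
Proof.
move=> abO; have S : closure [set x | bump a b m x != 0] `<=` closed_box a b.
  have -> : closed_box a b = closure (closed_box a b).
    apply/closure_id.
    by apply: compact_closed; [exact: norm_hausdorff|exact: compact_closed_box].
  apply: closure_subset => x /=; apply: contra_neqP => nx.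
  by apply: bump_eq0 => /open_box_sub.
split.
- move=> k; apply: Ck_prod => i; apply: CkM.
    under eq_fun do rewrite mulrBr; exact: Ck_flat_coord.
  under eq_fun do rewrite mulrBr addrC -mulNr; exact: Ck_flat_coord.
- apply: subclosed_compact S; first exact: closed_closure.
  exact: compact_closed_box.
- exact: subset_trans S abO.
Qed.

End smooth_calculus.

(** * Square-integrable functions and weak derivatives *)

Section square_integrable.
Context (R : realType) (n : nat) (Omega : set 'rV[R]_n).
Hypothesis mO : measurable Omega.
Implicit Types f g h : 'rV[R]_n -> R.

Local Notation leb := (lebesgue_rV R n).
Local Open Scope ereal_scope.

Lemma LpP (p : R) f : (0 < p)%R ->
  Lp Omega p f <-> measurable_fun Omega f /\
                   \int[leb]_(x in Omega) (`|f x| `^ p)%:E < +oo.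
Proof.
move=> p0; rewrite /Lp.
have E : 'N[leb]_p%:E[EFin \o (f \_ Omega)] `^ p =
    \int[leb]_(x in Omega) (`|f x| `^ p)%:E.
  rewrite poweR_Lnorm; last by rewrite gt_eqF.
  rewrite [RHS]integral_mkcond; apply: eq_integral => x _.
  rewrite /= /patch; case: ifP => // _.
  by rewrite normr0 powR0 ?gt_eqF.
have fin : ('N[leb]_p%:E[EFin \o (f \_ Omega)] < +oo) <->
    \int[leb]_(x in Omega) (`|f x| `^ p)%:E < +oo.
  rewrite -E; split => [|]; first exact: poweR_lty.
  have E1 : 'N[leb]_p%:E[EFin \o (f \_ Omega)] =
      ('N[leb]_p%:E[EFin \o (f \_ Omega)] `^ p) `^ p^-1.
    by rewrite -poweRrM mulfV ?gt_eqF// poweRe1//; exact: Lnorm_ge0.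
  by move=> h; rewrite E1; exact: poweR_lty.
split=> [/andP[mf /[!inE] lf]|[mf lf]].
  split; last exact/fin.
  by rewrite inE in mf; apply/(measurable_restrictT _ _).2.
apply/andP; split; rewrite inE /=; first exact/(measurable_restrictT _ _).1.
exact/fin.
Qed.

Lemma Lp2P f : Lp Omega 2 f <-> measurable_fun Omega f /\
                   \int[leb]_(x in Omega) (f x ^+ 2)%:E < +oo.
Proof.
rewrite LpP//; under eq_integral do rewrite powR_mulrn// -normrX ger0_norm ?sqr_ge0//.
by [].
Qed.

Lemma Lp_norm2_sqr f : Lp_norm Omega 2 f ^+ 2 =
  \int[leb]_(x in Omega) (f x ^+ 2)%:E.
Proof.
have -> : Lp_norm Omega 2 f ^+ 2 = Lp_norm Omega 2 f `^ 2.
  have := Lnorm_ge0 leb 2%:E (EFin \o (f \_ Omega)); rewrite -/(Lp_norm _ _ _).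
  case: (Lp_norm Omega 2 f) => [r r0| _|//].
    by rewrite poweR_EFin powR_mulrn.
  by rewrite poweRyr.
rewrite /Lp_norm poweR_Lnorm ?pnatr_eq0//.
rewrite [RHS]integral_mkcond; apply: eq_integral => x _.
rewrite /= /patch; case: ifP => _.
  by rewrite powR_mulrn// -normrX ger0_norm ?sqr_ge0//.
by rewrite normr0 powR0.
Qed.

Lemma Lp2_measurable f : Lp Omega 2 f -> measurable_fun Omega f.
Proof. by case/Lp2P. Qed.

Lemma Lp2_integrable_sqr f : Lp Omega 2 f ->
  leb.-integrable Omega (fun x => (f x ^+ 2)%:E).
Proof.
case/Lp2P => mf fi; apply/integrableP; split.
  by apply/measurable_EFinP; exact: measurable_funX.
by under eq_integral do rewrite /= ger0_norm ?sqr_ge0//.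
Qed.

Lemma Lp2_mul_integrable f g : Lp Omega 2 f -> Lp Omega 2 g ->
  leb.-integrable Omega (fun x => (f x * g x)%:E).
Proof.
move=> f2 g2.
apply: (@le_integrable _ _ _ leb Omega mO _ (fun x => (f x ^+ 2)%:E + (g x ^+ 2)%:E)).
- apply/measurable_EFinP; apply: measurable_funM; exact: Lp2_measurable.
- move=> x _; rewrite -EFinD /= lee_fin.
  rewrite [leRHS]ger0_norm ?addr_ge0 ?sqr_ge0// normrM.
  rewrite -(real_normK (num_real (f x))) -(real_normK (num_real (g x))).
  by have := sqr_ge0 (`|f x| - `|g x|); have := normr_ge0 (f x);
    have := normr_ge0 (g x); nra.
- by apply: integrableD => //; exact: Lp2_integrable_sqr.
Qed.

Lemma Lp2_lin (a b : R) f g : Lp Omega 2 f -> Lp Omega 2 g ->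
  Lp Omega 2 (fun x => a * f x + b * g x)%R.
Proof.
move=> f2 g2; apply/Lp2P.
have mfg : measurable_fun Omega (fun x => a * f x + b * g x)%R.
  by apply: measurable_funD; apply: measurable_funM => //; exact: Lp2_measurable.
split => //.
have /integrableP[_] : leb.-integrable Omega
    (fun x => (2 * a ^+ 2)%:E * (f x ^+ 2)%:E + (2 * b ^+ 2)%:E * (g x ^+ 2)%:E).
  by apply: integrableD => //; apply: integrableZl => //; exact: Lp2_integrable_sqr.
apply: le_lt_trans; apply: ge0_le_integral => //.
- by move=> x _; rewrite lee_fin sqr_ge0.
- by apply/measurable_EFinP; exact: measurable_funX.
- apply/measurableT_comp => //; apply: emeasurable_funD;
    apply: measurable_funeM; apply/measurable_EFinP; apply: measurable_funX;
    exact: Lp2_measurable.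
- move=> x _; rewrite -!EFinM -EFinD lee_fin.
  apply: le_trans (ler_norm _).
  by have := sqr_ge0 (a * f x - b * g x); nra.
Qed.

Lemma Lp2_bounded f (M : R) : leb Omega < +oo -> measurable_fun Omega f ->
  (forall x, Omega x -> `|f x| <= M)%R -> Lp Omega 2 f.
Proof.
move=> Ofin mf fM; apply/Lp2P; split => //.
apply: (@le_lt_trans _ _ ((M ^+ 2)%:E * leb Omega)).
  rewrite -integral_cst//; apply: ge0_le_integral => //.
  - by move=> x _; rewrite lee_fin sqr_ge0.
  - by apply/measurable_EFinP; exact: measurable_funX.
  - move=> x Ox; rewrite lee_fin -(real_normK (num_real (f x))).
    by rewrite ler_sqr ?nnegrE ?fM// (le_trans _ (fM _ Ox)).
by rewrite lte_mul_pinfty// lee_fin sqr_ge0.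
Qed.

Lemma Lp2_integrable f : leb Omega < +oo -> Lp Omega 2 f ->
  leb.-integrable Omega (fun x => (f x)%:E).
Proof.
move=> Ofin f2.
have one2 : Lp Omega 2 (cst 1%R) by apply: (@Lp2_bounded _ 1) => // x _; rewrite normr1.
by under eq_fun do rewrite -[f _]mulr1; exact: Lp2_mul_integrable f2 one2.
Qed.

End square_integrable.

(** * The fundamental lemma of the calculus of variations *)

Section fundamental_lemma.
Context (R : realType) (n : nat) (Omega : set 'rV[R]_n).
Hypothesis oO : open Omega.
Hypothesis Ofin : (lebesgue_rV R n Omega < +oo)%E.
Implicit Types g : 'rV[R]_n -> R.

Local Notation leb := (lebesgue_rV R n).
Local Open Scope ereal_scope.

Let mO : measurable Omega. Proof. exact: open_measurable_rV. Qed.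

(** Dominated convergence along the bumps of the box, each of which is a test function. *)
Lemma integral_open_box_eq0 g (a b : 'I_n -> R) : Lp Omega 2 g ->
  (forall phi, test_function Omega phi ->
    (\int[leb]_(x in Omega) (g x * phi x))%R = 0%R) ->
  closed_box a b `<=` Omega ->
  \int[leb]_(x in open_box a b) (g x)%:E = 0.
Proof.
move=> g2 g0 abO; have mg := Lp2_measurable mO g2.
have gi : leb.-integrable Omega (fun x => (g x)%:E) by exact: Lp2_integrable.
have mbump m : measurable_fun Omega (bump a b m).
  apply: measurable_funTS; apply: continuous_measurable_rV.
  by have [/(_ 0%N)] := @bump_test_function R n Omega a b m abO.
have obO : open_box a b `<=` Omega by exact: subset_trans (@open_box_sub _ _ _ _) abO.
have bumpi m : leb.-integrable Omega (fun x => (g x * bump a b m x)%:E).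
  apply: (le_integrable mO _ _ gi).
    by apply/measurable_EFinP; exact: measurable_funM.
  move=> x _; rewrite /= lee_fin normrM -[leRHS]mulr1 ler_wpM2l//.
  by rewrite (ger0_norm (bump_ge0 _ _ _ _)) bump_le1.
have mob : measurable (open_box a b) by exact: measurable_open_box.
have [|||||_ _] := @dominated_convergence _ _ R leb Omega mO
  (fun m x => (g x * bump a b m x)%:E)
  (fun x => (g x * \1_(open_box a b) x)%:E) (fun x => `|g x|%:E).
- by move=> m; exact: measurable_int (bumpi m).
- by apply/measurable_EFinP; apply: measurable_funM => //; exact: measurable_funTS.
- by apply: aeW => x _; apply: cvg_EFin; [exact: nearW|apply: cvgMl_tmp; exact: bump_cvg].
- exact: integrable_abse gi.
- apply: aeW => x m _; rewrite abse_EFin lee_fin normrM.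
  by rewrite -[leRHS]mulr1 ler_wpM2l// (ger0_norm (bump_ge0 _ _ _ _)) bump_le1.
rewrite [X in X @ _ --> _](_ : _ = cst 0); last first.
  apply/funext => m /=; have := g0 _ (@bump_test_function R n Omega a b m abO).
  rewrite /Rintegral => H; rewrite -[LHS]fineK ?H//.
  exact: integrable_fin_num.
move=> /cvg_lim; rewrite lim_cst// => /(_ (@ereal_hausdorff R)) ->.
rewrite -{1}(setIidr obO) integral_mkcondr; apply: eq_integral => x _.
rewrite /patch indicE; case: ifPn => _; first by rewrite mulr1.
by rewrite mulr0.
Qed.

(** Fix a rational box [Q] with closure in [Omega]. The sets [S] for which [g] has integral 0 over
    [S] intersected with [Q] form a Dynkin system containing the open boxes, hence all measurable
    sets, so [g = 0] a.e. in [Q]. Countably many such [Q] cover [Omega]. *)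
Lemma ae_eq0_of_test g : Lp Omega 2 g ->
  (forall phi, test_function Omega phi ->
    (\int[leb]_(x in Omega) (g x * phi x))%R = 0%R) ->
  g = cst 0%R %[ae leb in Omega].
Proof.
move=> g2 g0; have mg := Lp2_measurable mO g2.
have gi : leb.-integrable Omega (fun x => (g x)%:E) by exact: Lp2_integrable.
have H (p : 'rV[rat]_n * nat) : closed_box (rat_lo R p) (rat_hi R p) `<=` Omega ->
    g = cst 0%R %[ae leb in open_box (rat_lo R p) (rat_hi R p)].
  move=> pO; set Q := open_box _ _.
  have QO : Q `<=` Omega by exact: subset_trans (@open_box_sub _ _ _ _) pO.
  have mQ : measurable Q by exact: measurable_open_box.
  have giQ A : measurable A -> leb.-integrable (A `&` Q) (fun x => (g x)%:E).
    move=> mA; apply: integrableS gi => //; first exact: measurableI.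
    by move=> x [_ /QO].
  have key S : measurable S -> \int[leb]_(x in S `&` Q) (g x)%:E = 0.
    rewrite measurable_rV_open_boxes; move: S.
    apply: dynkin_induction.
    - exact: measurable_rV_open_boxes.
    - move=> _ _ [ab _ <-] [cd _ <-]; rewrite open_box_setI.
      by exists ((fun i => Num.max (ab.1 i) (cd.1 i)), fun i => Num.min (ab.2 i) (cd.2 i)).
    - by rewrite setTI; exact: integral_open_box_eq0.
    - move=> _ [ab _ <-]; rewrite open_box_setI; apply: integral_open_box_eq0 => //.
      apply: subset_trans pO => x Hx i; have := Hx i.
      by rewrite ge_max le_min => /andP[/andP[_ ->] /andP[_ ->]].
    - move=> S mS S0.
      have : \int[leb]_(x in (S `&` Q) `|` (~` S `&` Q)) (g x)%:E = 0.
        by rewrite -setIUl setUv setTI; exact: integral_open_box_eq0.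
      rewrite integral_setU//; first by rewrite [X in X + _]S0 add0e.
      + exact: measurableI.
      + by apply: measurableI => //; exact: measurableC.
      + rewrite -setIUl setUv; exact: measurable_int (giQ _ _).
      + by apply/disj_setPS => x [[? _] []].
    - move=> F mF tF F0; rewrite setI_bigcupl integral_bigcup.
      + by rewrite eseries0.
      + exact: trivIset_setIr.
      + by move=> k; exact: measurableI.
      + rewrite -setI_bigcupl; apply: giQ; exact: bigcupT_measurable.
  have : ae_eq leb Q (fun x => (g x)%:E) (cst 0).
    apply: integral_ae_eq => //.
    - by rewrite -[Q]setTI; exact: giQ.
    - by move=> E EQ mE; rewrite integral0 -(setIidl EQ); exact: key.
  by apply: filterS => x /[apply] -[].
(* [unpickle] enumerates the boxes, so that a.e. statements are intersected over the naturals; a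
   code of no box imposes nothing. *)
have : \forall x \ae leb, forall k : nat,
    if unpickle k is Some p then
      closed_box (rat_lo R p) (rat_hi R p) `<=` Omega ->
      open_box (rat_lo R p) (rat_hi R p) x -> g x = 0%R else True.
  apply: ae_foralln => k; case: (unpickle k) => [p|]; last exact: aeW.
  have [pO|npO] := pselect (closed_box (rat_lo R p) (rat_hi R p) `<=` Omega).
    by apply: filterS (H p pO) => x + _.
  exact: aeW.
apply: filterS => x Hx Ox.
have [p [px pO]] := open_rat_box oO Ox.
by have := Hx (pickle p); rewrite pickleK; exact.
Qed.

End fundamental_lemma.

(** * Integration along coordinate lines *)

Section lines.
Context (R : realType).
Implicit Types n : nat.

(** Regularity in one direction only, because this is what restricting to a slice preserves. *)
Definition C1dir n (i : 'I_n) (f : 'rV[R]_n -> R) : Prop :=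
  [/\ continuous f, forall x, derivable f x (delta_mx 0 i) &
      continuous (partial i f)].

Lemma smooth_C1dir n (i : 'I_n) (f : 'rV[R]_n -> R) : smooth f -> C1dir i f.
Proof.
move=> sf; have [cf df pf] := sf 1%N; by split; [exact: cf|exact: df|exact: pf].
Qed.

Lemma is_derive_partial n (i : 'I_n) (f : 'rV[R]_n -> R) (x : 'rV[R]_n) (s : R) :
  C1dir i f ->
  is_derive s (1 : R) (fun r : R => f (x + r *: delta_mx 0 i))
    (partial i f (x + s *: delta_mx 0 i)).
Proof. by move=> [_ df _]; apply/is_derive_line; split. Qed.

Lemma continuous_along n (i : 'I_n) (f : 'rV[R]_n -> R) (x : 'rV[R]_n) :
  continuous f -> continuous (fun r : R => f (x + r *: delta_mx 0 i)).
Proof.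
move=> cf r; apply: (@continuous_comp _ _ _ (fun r : R => x + r *: delta_mx 0 i) f).
  exact: continuous_line.
exact: cf.
Qed.

Lemma C1dir_consrVr n (i : 'I_n) (t : R) (f : 'rV[R]_n.+1 -> R) :
  C1dir (lift ord0 i) f ->
  C1dir i (fun y => f (consrV (t, y))) /\
  forall y, partial i (fun y => f (consrV (t, y))) y =
            partial (lift ord0 i) f (consrV (t, y)).
Proof.
move=> C; have [cf df pf] := C.
have D y : is_derive y (delta_mx 0 i) (fun y => f (consrV (t, y)))
    (partial (lift ord0 i) f (consrV (t, y))).
  rewrite -{1}[y]addr0 -{1}[0](scale0r (delta_mx 0 i)); apply/is_derive_line.
  have := is_derive_partial (consrV (t, y)) 0 C; rewrite scale0r addr0.
  by under eq_fun do rewrite -consrV_lineS.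
have E y : partial i (fun y => f (consrV (t, y))) y =
            partial (lift ord0 i) f (consrV (t, y)) by have [] := D y.
have cont g : continuous g -> continuous (fun y : 'rV[R]_n => g (consrV (t, y)) : R).
  move=> cg y; apply: (@continuous_comp _ _ _ (fun y : 'rV[R]_n => consrV (t, y)) g).
    exact: continuous_consrVr.
  exact: cg.
split => //; split; first exact: cont.
  by move=> y; have [] := D y.
by rewrite (funext E); exact: cont.
Qed.

Lemma FTC_segment (g g' : R -> R) (a b : R) : a <= b ->
  (forall s, is_derive s (1 : R) g (g' s)) -> continuous g' ->
  (\int[lebesgue_measure]_(s in `[a, b]) (g' s)%:E = (g b - g a)%:E)%E.
Proof.
rewrite le_eqVlt => /predU1P[->|ab] Dg cg'.
  by rewrite set_itv1 integral_set1 subrr.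
have cg s : {for s, continuous g} by exact: is_derive_continuous (Dg s).
rewrite (@continuous_FTC2 _ g' g)//.
- by apply: continuous_subspaceT.
- split => [s _||]; first by have [] := Dg s.
  + exact/cvg_at_right_filter/cg.
  + exact/cvg_at_left_filter/cg.
- by move=> s _; rewrite derive1E; have [] := Dg s.
Qed.

Definition supported n (L : R) (f : 'rV[R]_n -> R) : Prop :=
  forall x, f x != 0 -> forall i, - L < x ord0 i < L.

Lemma supported_consrVr n L (t : R) (f : 'rV[R]_n.+1 -> R) :
  supported L f -> supported L (fun y => f (consrV (t, y))).
Proof. by move=> sf y fy i; have := sf _ fy (lift ord0 i); rewrite consrVS. Qed.

Lemma supported_continuous_bounded n L (f : 'rV[R]_n -> R) :
  continuous f -> supported L f -> exists2 M, 0 < M & forall x, `|f x| <= M.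
Proof.
move=> cf sf.
have : compact (f @` closed_box (fun=> - L) (fun=> L)).
  apply: continuous_compact; first exact: continuous_subspaceT.
  exact: compact_closed_box.
move=> /compact_bounded[M [_ HM]]; exists (`|M| + 1) => [|x]; first by rewrite ltr_wpDl.
have [->|fx] := eqVneq (f x) 0; first by rewrite normr0 addr_ge0.
apply: HM; first by rewrite (le_lt_trans (ler_norm _))// ltrDl.
by exists x => // i; have /andP[/ltW -> /ltW ->] := sf _ fx i.
Qed.

Lemma lebesgue_box_lty n (a b : 'I_n -> R) : (lebesgue_rV R n (box a b) < +oo)%E.
Proof.
pose c i := Num.max (a i) (b i).
apply: (@le_lt_trans _ _ (lebesgue_rV R n (box a c))).
  apply: le_measure; rewrite ?inE; [exact: measurable_box|exact: measurable_box|].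
  by move=> x H i; have /andP[-> xb] := H i; rewrite /= lt_max xb orbT.
by rewrite lebesgue_box ?ltry// => i; rewrite le_max lexx.
Qed.

Lemma supported_box n L (f : 'rV[R]_n -> R) : supported L f ->
  f = f \_ (box (fun=> - L) (fun=> L)).
Proof.
move=> sf; apply/funext => x; rewrite /patch; case: ifPn => //.
apply: contraNeq => fx; rewrite inE => i.
by have /andP[/ltW -> ->] := sf _ fx i.
Qed.

Lemma supported_integrable n L (f : 'rV[R]_n -> R) :
  continuous f -> supported L f ->
  (lebesgue_rV R n).-integrable setT (EFin \o f).
Proof.
move=> cf sf; have [M M0 fM] := supported_continuous_bounded cf sf.
rewrite (supported_box sf) -restrict_EFin.
apply: (integrable_mkcond (EFin \o f) (measurable_box _ _)).1.
apply: measurable_bounded_integrable.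
- exact: measurable_box.
- exact: lebesgue_box_lty.
- by apply: measurable_funTS; exact: continuous_measurable_rV.
- exists M; split; first exact: num_real.
  by move=> K MK x _ /=; apply: le_trans (fM x) (ltW MK).
Qed.

(** The bound grows by 1 so that [f] vanishes on a whole neighbourhood of each point outside the
    larger box. *)
Lemma supported_partial n L (i : 'I_n) (f : 'rV[R]_n -> R) :
  supported L f -> supported (L + 1) (partial i f).
Proof.
move=> sf x; apply: contra_neqP => /existsNP[j xj].
have xj' : L < `|x ord0 j|.
  rewrite ltNge; apply/negP => xL; apply: xj.
  have := le_lt_trans xL (_ : L < L + 1); rewrite ltrDl ltr01 => /(_ isT).
  by rewrite ltr_norml.
have near0 : \forall y \near x, 0 = f y.
  have Lj : open [set y : 'rV[R]_n | L < `|y ord0 j|].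
    apply: (@open_comp _ _ (fun y : 'rV[R]_n => `|y ord0 j|) [set t | L < t]).
      move=> y _; apply: (@continuous_comp _ _ _ (fun y : 'rV[R]_n => y ord0 j) Num.norm).
        exact: coord_continuous.
      exact: norm_continuous.
    exact: open_gt.
  have : nbhs x [set y : 'rV[R]_n | L < `|y ord0 j|] by exact: open_nbhs_nbhs.
  apply: filterS => y /= Ly; apply/eqP; apply: contraTT Ly; rewrite eq_sym -leNgt => fy.
  by apply: ltW; rewrite ltr_norml; exact: sf.
rewrite /partial -(near_eq_derive (delta_mx 0 i) near0).
exact: derive_cst.
Qed.

(** Fubini splits off the first coordinate. A derivative in another direction is handled on each
    slice by induction; for the first direction the fundamental theorem of calculus applies on each
    line. *)
Lemma int_partial_eq0 n (i : 'I_n) L (f : 'rV[R]_n -> R) : C1dir i f -> supported L f ->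
  (\int[lebesgue_rV R n]_x (partial i f x)%:E = 0)%E.
Proof.
elim: n i L f => [[]//|n IH] i L f C sf; have [cf df pf] := C.
have pfi := supported_integrable pf (@supported_partial _ _ i _ sf).
case: (unliftP ord0 i) => [j ij|i0]; subst i.
  rewrite fubini_consrV// integral0_eq// => t _.
  have [Cj Ej] := C1dir_consrVr t C.
  rewrite -[RHS](IH j L _ Cj (@supported_consrVr _ _ t _ sf)).
  by apply: eq_integral => y _; rewrite Ej.
rewrite fubini_consrV_swap// integral0_eq// => y _.
have E t : consrV (t, y) = consrV (0, y) + t *: delta_mx 0 ord0.
  by rewrite -consrV_line0 add0r.
(* Beyond the bound [L + 1] for the derivative; the sign of [L] is unknown, hence the absolute
   value. *)
pose K := `|L| + 2.
have K0 : - K <= K by rewrite -subr_ge0 opprK !addr_ge0.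
have LK : L + 1 < K by rewrite /K; have := ler_norm L; lra.
have out t : ~ (- K <= t <= K) -> partial ord0 f (consrV (t, y)) = 0.
  move=> tK; apply/eqP; apply: contra_notT tK => ft.
  have := supported_partial sf ft ord0; rewrite consrV0 => /andP[t1 t2].
  by apply/andP; split; lra.
have fK t : K <= `|t| -> f (consrV (t, y)) = 0.
  move=> tK; apply/eqP; apply: contraTT tK => /sf /(_ ord0).
  by rewrite consrV0 -ltr_norml -ltNge => /lt_trans -> //; lra.
transitivity (\int[lebesgue_measure]_(t in `[(- K)%R, K]) (partial ord0 f (consrV (t, y)))%:E)%E.
  rewrite [RHS]integral_mkcond; apply: eq_integral => t _.
  rewrite /patch; case: ifPn => //; rewrite notin_setE /= in_itv /= => tK.
  by rewrite out//; exact/negP.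
under eq_integral do rewrite E.
rewrite (FTC_segment K0 (fun s => is_derive_partial (consrV (0, y)) s C)).
  by rewrite -!E !fK ?subrr// ?normrN ger0_norm// /K addr_ge0.
exact: continuous_along.
Qed.

End lines.

(** * Weak partial derivatives: integration by parts, uniqueness, linearity *)

Section weak_partials.
Context (R : realType) (n : nat) (Omega : set 'rV[R]_n).
Hypothesis oO : open Omega.
Hypothesis Ofin : (lebesgue_rV R n Omega < +oo)%E.
Implicit Types f g u v phi psi : 'rV[R]_n -> R.

Local Notation leb := (lebesgue_rV R n).

Let mO : measurable Omega. Proof. exact: open_measurable_rV. Qed.

Lemma test_function_continuous phi : test_function Omega phi -> continuous phi.
Proof. by move=> [/(_ 0%N)]. Qed.

Lemma test_function_measurable phi D : test_function Omega phi -> measurable_fun D phi.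
Proof.
move=> /test_function_continuous cphi; apply: measurable_funTS.
exact: continuous_measurable_rV.
Qed.

Lemma test_function_bounded phi : test_function Omega phi ->
  exists2 M, 0 < M & forall x, `|phi x| <= M.
Proof.
move=> t; have [L _ sL] := test_function_bounded_support t.
exact: supported_continuous_bounded (test_function_continuous t) sL.
Qed.

Lemma test_function_partial i phi :
  test_function Omega phi -> test_function Omega (partial i phi).
Proof.
move=> [sphi cphi phiO].
have S : [set x | partial i phi x != 0] `<=` closure [set x | phi x != 0].
  move=> x; apply: contraPP => nx /=.
  have : \forall y \near x, 0 = phi y.
    have : nbhs x (~` closure [set x | phi x != 0]).
      by apply: open_nbhs_nbhs; split => //; exact/closed_openC/closed_closure.
    apply: filterS => y; apply: contra_notP => /eqP; rewrite eq_sym => ny.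
    exact: subset_closure.
  move=> near0; rewrite /partial -(near_eq_derive (delta_mx 0 i) near0).
  by rewrite derive_cst eqxx.
have {}S : closure [set x | partial i phi x != 0] `<=` closure [set x | phi x != 0].
  rewrite [X in _ `<=` X](closure_id _).1; last exact: closed_closure.
  exact: closure_subset.
split.
- by move=> k; have [_ _] := sphi k.+1; exact.
- by apply: subclosed_compact S => //; exact: closed_closure.
- exact: subset_trans S phiO.
Qed.

Lemma test_function_Lp2 phi : test_function Omega phi -> Lp Omega 2 phi.
Proof.
move=> t; have [M _ pM] := test_function_bounded t.
by apply: (Lp2_bounded mO (M := M)) => //; exact: test_function_measurable.
Qed.

(** Integration by parts: the product of two test functions has a partial derivative of integral
    0. *)
Lemma test_function_is_weak_partial i phi : test_function Omega phi ->
  is_weak_partial Omega i phi (partial i phi).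
Proof.
move=> t; have tp := test_function_partial i t.
split=> [|psi tpsi]; first exact: test_function_Lp2.
have tq := test_function_partial i tpsi.
have I1 := Lp2_mul_integrable mO (test_function_Lp2 t) (test_function_Lp2 tq).
have I2 := Lp2_mul_integrable mO (test_function_Lp2 tp) (test_function_Lp2 tpsi).
apply/eqP; rewrite -subr_eq0 opprK -RintegralD//; apply/eqP.
have Cphi : C1dir i phi by case: t => /smooth_C1dir.
have Cpsi : C1dir i psi by case: tpsi => /smooth_C1dir.
have [L _ sL] := test_function_bounded_support t.
have Cm : C1dir i (fun x => phi x * psi x).
  case: (t) => s1 _ _; case: (tpsi) => s2 _ _.
  by apply: smooth_C1dir => k; exact: CkM.
have sm : supported L (fun x => phi x * psi x).
  by move=> x; rewrite mulf_eq0 negb_or => /andP[/sL].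
rewrite Rintegral_mkcond /Rintegral -[RHS]/(fine 0%E) -(int_partial_eq0 Cm sm).
congr fine.
apply: eq_integral => x _; congr EFin; rewrite partialM; last 2 first.
- by case: Cphi.
- by case: Cpsi.
rewrite /patch; case: ifPn => xO; first by rewrite [psi x * _]mulrC.
rewrite notin_setE in xO.
by rewrite (test_function_eq0 t xO) (test_function_eq0 tpsi xO) !mul0r addr0.
Qed.

Lemma is_weak_partial_lin i (a b : R) u v f g :
  Lp Omega 2 u -> Lp Omega 2 v ->
  is_weak_partial Omega i u f -> is_weak_partial Omega i v g ->
  is_weak_partial Omega i (fun x => a * u x + b * v x)
                          (fun x => a * f x + b * g x).
Proof.
move=> u2 v2 [f2 uf] [g2 vg]; split; first exact: Lp2_lin.
move=> phi t; have tp := test_function_partial i t.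
have I w : Lp Omega 2 w -> leb.-integrable Omega (EFin \o (fun x => w x * phi x)).
  by move=> w2; apply: Lp2_mul_integrable => //; exact: test_function_Lp2.
have J w : Lp Omega 2 w -> leb.-integrable Omega (EFin \o (fun x => w x * partial i phi x)).
  by move=> w2; apply: Lp2_mul_integrable => //; exact: test_function_Lp2.
have lin (w1 w2 w3 : 'rV[R]_n -> R) :
    leb.-integrable Omega (EFin \o (fun x => w1 x * w3 x)) ->
    leb.-integrable Omega (EFin \o (fun x => w2 x * w3 x)) ->
    \int[leb]_(x in Omega) ((a * w1 x + b * w2 x) * w3 x) =
    a * \int[leb]_(x in Omega) (w1 x * w3 x) + b * \int[leb]_(x in Omega) (w2 x * w3 x).
  move=> i1 i2; rewrite -!RintegralZl// -RintegralD//.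
  - by apply: eq_Rintegral => x _; rewrite mulrDl -!mulrA.
  - exact: (integrableZl mO _ i1).
  - exact: (integrableZl mO _ i2).
rewrite !lin ?uf ?vg//; [ring|exact: I|exact: I|exact: J|exact: J].
Qed.

Lemma is_weak_partial_unique i u f g :
  is_weak_partial Omega i u f -> is_weak_partial Omega i u g ->
  f = g %[ae leb in Omega].
Proof.
move=> [f2 uf] [g2 ug].
have d2 := Lp2_lin mO 1 (-1) f2 g2.
have : (fun x => 1 * f x + -1 * g x) = cst 0 %[ae leb in Omega].
  apply: ae_eq0_of_test => // phi t.
  have p2 := test_function_Lp2 t.
  have := uf _ t; rewrite ug// => /eqP; rewrite eqr_opp => /eqP fg.
  have If := Lp2_mul_integrable mO f2 p2; have Ig := Lp2_mul_integrable mO g2 p2.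
  rewrite [LHS](_ : _ = \int[leb]_(x in Omega) (f x * phi x - g x * phi x)).
    by rewrite RintegralB// fg subrr.
  by apply: eq_Rintegral => x _; ring.
by apply: filterS => x /[apply]/=; rewrite mul1r mulN1r => /subr0_eq.
Qed.

Lemma weak_partialP i u : H1 Omega u ->
  is_weak_partial Omega i u (weak_partial Omega i u).
Proof. by move=> [_ /(_ i)]; exact: xgetPex. Qed.

(** [weak_partial] picks a representative, so linearity is only an a.e. statement, obtained from
    uniqueness. *)
Lemma weak_partial_lin i (a b : R) u v : H1 Omega u -> H1 Omega v ->
  weak_partial Omega i (fun x => a * u x + b * v x) =
  (fun x => a * weak_partial Omega i u x + b * weak_partial Omega i v x)
  %[ae leb in Omega].
Proof.
move=> hu hv; apply: (@is_weak_partial_unique i (fun x => a * u x + b * v x)).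
  apply: xgetPex; exists (fun x => a * weak_partial Omega i u x + b * weak_partial Omega i v x).
  by apply: is_weak_partial_lin; [case: hu|case: hv|exact: weak_partialP..].
by apply: is_weak_partial_lin; [case: hu|case: hv|exact: weak_partialP..].
Qed.

Lemma weak_partial_test i phi : test_function Omega phi ->
  weak_partial Omega i phi = partial i phi %[ae leb in Omega].
Proof.
move=> t; apply: (@is_weak_partial_unique i phi); last exact: test_function_is_weak_partial.
by apply: xgetPex; exists (partial i phi); exact: test_function_is_weak_partial.
Qed.

Lemma H1_lin (a b : R) u v : H1 Omega u -> H1 Omega v ->
  H1 Omega (fun x => a * u x + b * v x).
Proof.
move=> hu hv; split; first by apply: Lp2_lin => //; [case: hu|case: hv].
move=> i; exists (fun x => a * weak_partial Omega i u x + b * weak_partial Omega i v x).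
by apply: is_weak_partial_lin; [case: hu|case: hv|exact: weak_partialP..].
Qed.

Lemma test_function_H1 phi : test_function Omega phi -> H1 Omega phi.
Proof.
move=> t; split; first exact: test_function_Lp2.
by move=> i; exists (partial i phi); exact: test_function_is_weak_partial.
Qed.

End weak_partials.

(** * The Sobolev inequality for test functions *)

Section weighted_hoelder.
Context d (T : measurableType d) (R : realType) (mu : {measure set T -> \bar R}).

Lemma measurable_powR_comp (D : set T) (f : T -> R) (a : R) :
  measurable_fun D f -> measurable_fun D (fun x => f x `^ a).
Proof. by move=> mf; exact: measurableT_comp (@measurable_powR R a) mf. Qed.

(** Concavity of the logarithm, in the form [ln y <= y - 1] at [y = x i / S], where [S] is the
    weighted mean. *)
Lemma weighted_AMGM (I : finType) (th x : I -> R) :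
  (forall i, 0 < th i) -> \sum_i th i = 1 -> (forall i, 0 <= x i) ->
  \prod_i (x i `^ th i) <= \sum_i th i * x i.
Proof.
move=> th0 th1 x0.
have S0 : 0 <= \sum_i th i * x i by apply: sumr_ge0 => i _; rewrite mulr_ge0// ltW.
have [/existsP[i /eqP xi]|/existsPn xn] := boolP [exists i, x i == 0].
  by rewrite (bigD1 i)//= xi powR0 ?mul0r// gt_eqF.
have {}xn i : 0 < x i by rewrite lt_neqAle eq_sym xn x0.
set S := \sum_i _; have {}S0 : 0 < S.
  have [i _] : exists2 i : I, true & true.
    case: (pickP (@predT I)) => [i _|e]; first by exists i.
    by move: th1; rewrite big_pred0// => /eqP; rewrite eq_sym oner_eq0.
  rewrite /S (bigD1 i)//= ltr_pwDl ?mulr_gt0// sumr_ge0// => j _.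
  by rewrite mulr_ge0// ltW.
have -> : \prod_i (x i `^ th i) = expR (\sum_i th i * ln (x i)).
  rewrite expR_sum; apply: eq_bigr => i _.
  by rewrite /powR gt_eqF.
rewrite -[leRHS]lnK ?posrE// ler_expR -subr_le0.
have -> : \sum_i th i * ln (x i) - ln S = \sum_i th i * ln (x i / S).
  under [RHS]eq_bigr do rewrite ln_div ?posrE// mulrBr.
  by rewrite big_split/= sumrN -mulr_suml th1 mul1r.
apply: (@le_trans _ _ (\sum_i th i * (x i / S - 1))).
  apply: ler_sum => i _; rewrite ler_wpM2l ?(ltW (th0 _))//.
  have := @le_ln1Dx R (x i / S - 1); rewrite [1 + _]addrC subrK; apply.
  by have := divr_gt0 (xn i) S0; lra.
under eq_bigr do rewrite mulrBr mulr1 mulrA.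
by rewrite big_split/= sumrN th1 -mulr_suml -/S mulfV ?subrr// gt_eqF.
Qed.

(** Normalize each [h i] by its bound [A i], apply the weighted mean inequality pointwise and
    integrate: the right-hand sides sum to 1. *)
Lemma hoelder_prod (I : finType) (th : I -> R) (D : set T) (h : I -> T -> R)
    (A : I -> R) : measurable D ->
  (forall i, 0 < th i) -> \sum_i th i = 1 ->
  (forall i, measurable_fun D (h i)) -> (forall i x, D x -> 0 <= h i x) ->
  (forall i, \int[mu]_(x in D) (h i x)%:E <= (A i)%:E)%E ->
  (\int[mu]_(x in D) (\prod_i (h i x `^ th i))%:E <= (\prod_i (A i `^ th i))%:E)%E.
Proof.
move=> mD th0 th1 mh h0 hA.
have A0 i : 0 <= A i.
  by rewrite -lee_fin; apply: le_trans (hA i); apply: integral_ge0 => x Dx; rewrite lee_fin h0.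
have mP : measurable_fun D (fun x => \prod_i (h i x `^ th i)).
  apply: measurable_prod => i _.
  exact: measurable_powR_comp.
have P0 x : D x -> 0 <= \prod_i (h i x `^ th i).
  by move=> Dx; apply: prodr_ge0 => i _; exact: powR_ge0.
(* If some [A i] is 0, no normalization is possible; but then [h i], and with it the product, is 0
   a.e. *)
have [/existsP[i /eqP Ai]|/existsPn An] := boolP [exists i, A i == 0].
  rewrite [leRHS](_ : _ = 0%E); last first.
    by rewrite (bigD1 i)//= Ai powR0 ?mul0r// gt_eqF.
  have hi0 : ae_eq mu D (fun x => (h i x)%:E) (cst 0%E).
    apply/ae_eq_integral_abs => //; first exact/measurable_EFinP.
    apply/eqP; rewrite eq_le integral_ge0// andbT.
    rewrite -[leRHS]/((0 : R)%:E) -Ai (eq_integral (fun x => (h i x)%:E))// => x xD.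
    by rewrite gee0_abs// lee_fin h0//; exact: set_mem.
  rewrite (ae_eq_integral (cst 0%E)) ?integral0//.
  - exact/measurable_EFinP.
  - apply: filterS hi0 => x /[apply] -[hx].
    by rewrite /= (bigD1 i)//= hx powR0 ?mul0r// gt_eqF.
have {}A0 i : 0 < A i by rewrite lt_neqAle eq_sym An A0.
have PA : 0 < \prod_i (A i `^ th i) by apply: prodr_gt0 => i _; exact: powR_gt0.
have split x : D x -> \prod_i (h i x `^ th i) <=
    (\prod_i (A i `^ th i)) * \sum_i (th i / A i * h i x).
  move=> Dx; have := @weighted_AMGM I th (fun i => h i x / A i) th0 th1.
  have -> : \prod_i ((h i x / A i) `^ th i) =
      (\prod_i (h i x `^ th i)) / \prod_i (A i `^ th i).
    rewrite -prodfV -big_split/=; apply: eq_bigr => i _.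
    rewrite powRM ?h0 ?invr_ge0 ?(ltW (A0 _))//.
    by rewrite -powR_inv1 ?(ltW (A0 _))// -powRrM mulN1r powRN.
  rewrite ler_pdivrMr// mulrC => H; apply: le_trans (H _) _.
    by move=> i; rewrite divr_ge0 ?h0// ltW.
  by rewrite ler_wpM2l ?(ltW PA)// ler_sum// => i _; rewrite mulrA mulrAC.
apply: (@le_trans _ _ (\int[mu]_(x in D)
  ((\prod_i (A i `^ th i))%:E * \sum_i ((th i / A i)%:E * (h i x)%:E)))%E).
  apply: ge0_le_integral => //.
  - exact/measurable_EFinP.
  - apply: measurable_funeM; apply: emeasurable_sum => i.
    by apply: measurable_funeM; exact/measurable_EFinP.
  - move=> x Dx.
    rewrite (eq_bigr (fun i => (th i / A i * h i x)%:E))//.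
    by rewrite sumEFin -EFinM lee_fin split.
have c0 i : 0 <= th i / A i by rewrite divr_ge0 ?ltW.
rewrite ge0_integralZl//; last 3 first.
- apply: emeasurable_sum => i.
  by apply: measurable_funeM; exact/measurable_EFinP.
- by move=> x Dx; apply: sume_ge0 => i _; rewrite mule_ge0// lee_fin ?c0 ?h0.
- by rewrite lee_fin ltW.
rewrite ge0_integral_sum//; last 2 first.
- by move=> i; apply: measurable_funeM; exact/measurable_EFinP.
- by move=> i x Dx; rewrite mule_ge0// lee_fin ?c0 ?h0.
rewrite -[X in (_ <= X)%E]mule1 lee_wpmul2l ?lee_fin ?(ltW PA)//.
apply: (@le_trans _ _ (\sum_i (th i)%:E)%E); last by rewrite sumEFin th1.
apply: lee_sum => i _; rewrite ge0_integralZl//.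
- apply: (@le_trans _ _ ((th i / A i)%:E * (A i)%:E)%E).
    by rewrite lee_wpmul2l// lee_fin.
  by rewrite -EFinM divfK// gt_eqF.
- exact/measurable_EFinP.
- by move=> x Dx; rewrite lee_fin h0.
- by rewrite lee_fin.
Qed.

Lemma hoelder_two (th : R) (D : set T) (h k : T -> R) (A B : R) : measurable D ->
  0 < th < 1 -> measurable_fun D h -> measurable_fun D k ->
  (forall x, D x -> 0 <= h x) -> (forall x, D x -> 0 <= k x) ->
  (\int[mu]_(x in D) (h x)%:E <= A%:E)%E ->
  (\int[mu]_(x in D) (k x)%:E <= B%:E)%E ->
  (\int[mu]_(x in D) (h x `^ th * k x `^ (1 - th))%:E <=
   (A `^ th * B `^ (1 - th))%:E)%E.
Proof.
move=> mD /andP[th0 th1] mh mk h0 k0 hA kB.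
have H := @hoelder_prod bool (fun b => if b then th else 1 - th) D
  (fun b => if b then h else k) (fun b => if b then A else B) mD.
rewrite (_ : A `^ th * _ = \prod_b ((if b then A else B) `^ (if b then th else 1 - th))).
  rewrite (eq_integral (fun x => (\prod_b ((if b then h else k) x `^
      (if b then th else 1 - th)))%:E)).
    apply: H => //.
    - by case; rewrite ?subr_gt0.
    - by rewrite big_bool/= addrC subrK.
    - by case.
    - by case.
    - by case.
  by move=> x _; rewrite big_bool.
by rewrite big_bool.
Qed.

End weighted_hoelder.

(** * The Gagliardo-Nirenberg inequality by induction on the dimension *)

Section gagliardo.
Context (R : realType).
Implicit Types n : nat.
Local Notation mu := (@lebesgue_measure R).
Local Notation leb n := (lebesgue_rV R n).

Lemma powR_prod (I : finType) (x : I -> R) (a : R) : (forall i, 0 <= x i) ->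
  (\prod_i x i) `^ a = \prod_i (x i `^ a).
Proof.
move=> x0; suff [] : 0 <= \prod_i x i /\ (\prod_i x i) `^ a = \prod_i (x i `^ a) by [].
apply: (big_rec2 (fun u v => 0 <= u /\ u `^ a = v)) => [|i u v _ [u0 <-]].
  by rewrite powR1.
by rewrite mulr_ge0// powRM.
Qed.

(** A class stable under restriction to slices and under integration along a line, inside which
    every integral is finite; the induction stays in it. *)
Definition bounded_weight n (L M : R) (g : 'rV[R]_n -> R) : Prop :=
  [/\ measurable_fun setT g, forall x, 0 <= g x <= M & supported L g].

Lemma lebesgue_measure_segment_lty (a b : R) : (mu `[a, b] < +oo)%E.
Proof.
rewrite [X in (X < _)%E](lebesgue_measure_itv `[a, b]) /=.
by case: ifP => _; rewrite ltry.
Qed.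

Section bounded_weight.
Variables (L M : R).

Lemma bounded_weight_integrable n (g : 'rV[R]_n -> R) :
  bounded_weight L M g -> (leb n).-integrable setT (EFin \o g).
Proof.
move=> [mg gM sg]; rewrite (supported_box sg) -restrict_EFin.
apply: (integrable_mkcond (EFin \o g) (measurable_box _ _)).1.
apply: measurable_bounded_integrable.
- exact: measurable_box.
- exact: lebesgue_box_lty.
- exact: measurable_funTS.
- exists M; split; first exact: num_real.
  move=> K MK x _ /=; have /andP[g0 gxM] := gM x.
  by rewrite ger0_norm// (le_trans gxM)// ltW.
Qed.

Lemma bounded_weight_integral n (g : 'rV[R]_n -> R) : bounded_weight L M g ->
  (\int[leb n]_x (g x)%:E = (\int[leb n]_x g x)%:E)%E.
Proof.
move=> /bounded_weight_integrable gi; rewrite /Rintegral fineK//.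
exact: integrable_fin_num.
Qed.

Lemma bounded_weight_integral_ge0 n (g : 'rV[R]_n -> R) : bounded_weight L M g ->
  0 <= \int[leb n]_x g x.
Proof. by move=> [_ gM _]; apply: Rintegral_ge0 => x _; have /andP[] := gM x. Qed.

Lemma bounded_weight_consrVr n (g : 'rV[R]_n.+1 -> R) t : bounded_weight L M g ->
  bounded_weight L M (fun y => g (consrV (t, y))).
Proof.
move=> [mg gM sg]; split => [|y|].
- exact: measurableT_comp mg (@measurable_consrVr R n t).
- exact: gM.
- exact: (@supported_consrVr _ _ _ t _ sg).
Qed.

Lemma measurable_slice_integral n (g : 'rV[R]_n.+1 -> R) : bounded_weight L M g ->
  measurable_fun setT (fun t => \int[leb n]_y g (consrV (t, y))).
Proof.
move=> gw; have [mg gM _] := gw; apply/measurable_EFinP.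
rewrite (_ : EFin \o _ = fun t => (\int[leb n]_y (g (consrV (t, y)))%:E)%E).
  apply: (@measurable_int_consrVr R n (EFin \o g)); first exact/measurable_EFinP.
  by move=> x; rewrite lee_fin; have /andP[] := gM x.
apply/funext => t /=.
by rewrite -(bounded_weight_integral (bounded_weight_consrVr t gw)).
Qed.

Lemma integral_slice_integral n (g : 'rV[R]_n.+1 -> R) : bounded_weight L M g ->
  (\int[mu]_t (\int[leb n]_y g (consrV (t, y)))%:E = (\int[leb n.+1]_x g x)%:E)%E.
Proof.
move=> gw; have [mg gM _] := gw.
rewrite -(bounded_weight_integral gw) tonelli_consrV//.
- apply: eq_integral => t _.
  by rewrite -(bounded_weight_integral (bounded_weight_consrVr t gw)).
- exact/measurable_EFinP.
- by move=> x; rewrite lee_fin; have /andP[] := gM x.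
Qed.

Lemma bounded_weight_line n (g : 'rV[R]_n.+1 -> R) y : bounded_weight L M g ->
  mu.-integrable setT (fun t => (g (consrV (t, y)))%:E).
Proof.
move=> [mg gM sg].
have E : (fun t => g (consrV (t, y))) =
    (fun t => g (consrV (t, y))) \_ `[- L, L]%classic.
  apply/funext => t; rewrite /patch; case: ifPn => //.
  apply: contraNeq => /sg /(_ ord0); rewrite consrV0 inE /= in_itv /=.
  by move=> /andP[/ltW -> /ltW ->].
have H : mu.-integrable `[- L, L] (EFin \o (fun t => g (consrV (t, y)))).
  apply: measurable_bounded_integrable => //.
  - exact: lebesgue_measure_segment_lty.
  - by apply: measurable_funTS; exact: measurableT_comp mg (@measurable_consrVl R n y).
  - exists M; split; first exact: num_real.
    move=> K MK x _ /=; have /andP[g0 gxM] := gM (consrV (x, y)).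
    by rewrite ger0_norm// (le_trans gxM)// ltW.
have [+ _] := @integrable_mkcond _ _ R mu `[- L, L]%classic
  (EFin \o (fun t => g (consrV (t, y)))) (measurable_itv _).
by move=> /(_ H); rewrite restrict_EFin -E.
Qed.

Lemma line_integral_EFin n (g : 'rV[R]_n.+1 -> R) y : bounded_weight L M g ->
  (\int[mu]_t (g (consrV (t, y)))%:E = (\int[mu]_t g (consrV (t, y)))%:E)%E.
Proof.
move=> gw; rewrite /Rintegral fineK//; apply: integrable_fin_num => //.
exact: bounded_weight_line.
Qed.

Lemma bounded_weight_line_integral n (g : 'rV[R]_n.+1 -> R) : bounded_weight L M g ->
  bounded_weight L (M * fine (mu `[- L, L])) (fun y => \int[mu]_t g (consrV (t, y))).
Proof.
move=> gw; have [mg gM sg] := gw; split.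
- apply/measurable_EFinP.
  rewrite (_ : EFin \o _ = fun y => (\int[mu]_t (g (consrV (t, y)))%:E)%E).
    apply: (@measurable_int_consrVl R n (EFin \o g)); first exact/measurable_EFinP.
    by move=> x; rewrite lee_fin; have /andP[] := gM x.
  by apply/funext => y /=; rewrite -line_integral_EFin.
- move=> y; rewrite Rintegral_ge0/=; last by move=> t _; have /andP[] := gM (consrV (t, y)).
  have -> : \int[mu]_t g (consrV (t, y)) = \int[mu]_(t in `[- L, L]) g (consrV (t, y)).
    rewrite [RHS]Rintegral_mkcond; apply: eq_Rintegral => t _; rewrite /patch.
    case: ifPn => //.
    rewrite notin_setE /= in_itv /=; apply: contra_notP => /eqP.
    by move=> /sg /(_ ord0); rewrite consrV0 => /andP[/ltW -> /ltW ->].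
  rewrite -Rintegral_cst//; apply: le_Rintegral => //.
  + exact: integrableS (bounded_weight_line y gw).
  + apply: measurable_bounded_integrable => //.
      exact: lebesgue_measure_segment_lty.
    by exists `|M|; split => // K MK x _ /=; rewrite ltW.
  + by move=> t _; have /andP[] := gM (consrV (t, y)).
- move=> y; apply: contra_neqP => /existsNP[i yi].
  rewrite /Rintegral integral0_eq// => t _; congr EFin; apply/eqP.
  by apply: contra_notT yi => /sg /(_ (lift ord0 i)); rewrite consrVS.
Qed.

End bounded_weight.

Lemma integral_line_integral n (L M : R) (g : 'rV[R]_n.+1 -> R) : bounded_weight L M g ->
  \int[leb n]_y (\int[mu]_t g (consrV (t, y))) = \int[leb n.+1]_x g x.
Proof.
move=> gw; have [mg gM _] := gw; apply: EFin_inj.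
rewrite -(bounded_weight_integral gw) -(bounded_weight_integral (bounded_weight_line_integral gw)).
rewrite tonelli_consrV_swap//.
- by apply: eq_integral => t _; rewrite -(line_integral_EFin _ gw).
- exact/measurable_EFinP.
- by move=> x; rewrite lee_fin; have /andP[] := gM x.
Qed.

Lemma integral_rV1 (g : 'rV[R]_1 -> \bar R) : measurable_fun setT g ->
  (forall x, 0 <= g x)%E -> (\int[leb 1]_x g x = \int[mu]_t g (consrV (t, (0%R : 'rV[R]_0))))%E.
Proof.
move=> mg g0; rewrite tonelli_consrV//; apply: eq_integral => t _.
rewrite /= integral_dirac//; first by rewrite diracT mul1e.
exact: measurableT_comp mg (@measurable_consrVr R 0 t).
Qed.

(* The induction is carried by the extra weight g; taking for g a power of f
   gives the Gagliardo-Nirenberg inequality. *)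
Lemma gagliardo n (L M : R) (f g : 'rV[R]_n.+1 -> R)
    (G : 'I_n.+1 -> 'rV[R]_n.+1 -> R) :
  measurable_fun setT f -> (forall x, 0 <= f x) ->
  bounded_weight L M g -> (forall i, bounded_weight L M (G i)) ->
  (forall i x, ((f x)%:E <= \int[mu]_t (G i (set_coord i t x))%:E)%E) ->
  (\int[leb n.+1]_x (g x `^ (n.+1%:R^-1) * f x)%:E <=
   ((\int[leb n.+1]_x g x) `^ (n.+1%:R^-1) *
    \prod_i ((\int[leb n.+1]_x G i x) `^ (n.+1%:R^-1)))%:E)%E.
Proof.
elim: n L M f g G => [|n IH] L M f g G mf f0 gw Gw fG.
  have [mg gM _] := gw; have [mG GM _] := Gw ord0.
  rewrite invr1 big_ord_recl big_ord0 mulr1 !powRr1 ?(bounded_weight_integral_ge0 (Gw _))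
    ?(bounded_weight_integral_ge0 gw)//.
  have fC x : f x <= \int[leb 1]_x G ord0 x.
    rewrite -lee_fin -(bounded_weight_integral (Gw ord0)) integral_rV1.
    - apply: le_trans (fG ord0 x) _; rewrite le_eqVlt; apply/orP; left; apply/eqP.
      apply: eq_integral => t _; congr (G _ _)%:E.
      by rewrite -{1}(consrVK x) set_coord0; congr (consrV (_, _)); apply/rowP => -[].
    - exact/measurable_EFinP.
    - by move=> y; rewrite lee_fin; have /andP[] := GM y.
  rewrite EFinM -(bounded_weight_integral gw) -ge0_integralZr//.
  - apply: ge0_le_integral => //.
    + by move=> x _; rewrite lee_fin mulr_ge0// powR_ge0.
    + apply/measurable_EFinP; apply: measurable_funM => //.
      exact: measurable_powR_comp.
    + by apply: emeasurable_funM => //; exact/measurable_EFinP.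
    + move=> x _; have /andP[gx0 _] := gM x.
      by rewrite powRr1// -EFinM lee_fin ler_wpM2l.
  - exact/measurable_EFinP.
  - by move=> x _; rewrite lee_fin; have /andP[] := gM x.
  - by rewrite lee_fin (bounded_weight_integral_ge0 (Gw _)).
have [mg gM sg] := gw; have [mG0 G0M sG0] := Gw ord0.
pose th : R := n.+2%:R^-1; rewrite -/th.
have th01 : 0 < th < 1 by rewrite invr_gt0 ltr0n /= invf_lt1 ?ltr1n.
(* Hoelder on a slice raises the lower-dimensional estimate to the power [1 - th]; its exponents
   [1/(n+1)] then become the exponent [th] of the next dimension. *)
have nth : n.+1%:R^-1 * (1 - th) = th :> R.
  have n1 : (n.+1%:R : R) != 0 by rewrite pnatr_eq0.
  have n2 : (n.+2%:R : R) != 0 by rewrite pnatr_eq0.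
  rewrite /th -[in RHS](mulKf n1 n.+2%:R^-1); congr (_ * _).
  apply: (mulIf n2); rewrite divfK// mulrBl mulVf// mul1r.
  by rewrite -[n.+2%:R]natr1 addrK.
(* On every slice the induction hypothesis is used with this line integral as the weight; its
   integral over the slice does not depend on [t]. *)
pose g' (y : 'rV[R]_n.+1) := \int[mu]_t G ord0 (consrV (t, y)).
have gw' := bounded_weight_line_integral (Gw ord0); rewrite -/g' in gw'.
(* Integration along a line multiplies the bound by the length of the segment; the induction
   hypothesis wants one bound for all weights. *)
pose M' := Num.max M (M * fine (mu `[- L, L])).
have wS K (h : 'rV[R]_n.+1 -> R) : K <= M' -> bounded_weight L K h -> bounded_weight L M' h.
  by move=> KM [mh hK sh]; split => // x; have /andP[-> /le_trans ->] := hK x.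
have MM' : M <= M' by rewrite le_max lexx.
have MM'2 : M * fine (mu `[- L, L]) <= M' by rewrite le_max lexx orbT.
have {}gw' : bounded_weight L M' g' by exact: wS MM'2 _.
pose J (h : 'rV[R]_n.+2 -> R) t := \int[leb n.+1]_y h (consrV (t, y)).
have inner t : (\int[leb n.+1]_y ((g (consrV (t, y)) `^ th * f (consrV (t, y)))%:E) <=
    ((\int[leb n.+2]_x G ord0 x) `^ th *
     (J g t `^ th * \prod_(i < n.+1) (J (G (lift ord0 i)) t `^ th)))%:E)%E.
  pose k y := g' y `^ (n.+1%:R^-1) * f (consrV (t, y)).
  pose B := (\int[leb n.+1]_y g' y) `^ (n.+1%:R^-1) *
    \prod_(i < n.+1) (J (G (lift ord0 i)) t `^ (n.+1%:R^-1)).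
  have mft : measurable_fun setT (fun y => f (consrV (t, y))).
    exact: measurableT_comp mf (@measurable_consrVr R n.+1 t).
  have kB : (\int[leb n.+1]_y (k y)%:E <= B%:E)%E.
    apply: (IH L M' (fun y => f (consrV (t, y))) g'
      (fun i y => G (lift ord0 i) (consrV (t, y)))) => //.
    - by move=> i; apply: (wS M) => //; exact: bounded_weight_consrVr.
    - move=> i y; apply: le_trans (fG (lift ord0 i) (consrV (t, y))) _.
      by under eq_integral do rewrite set_coordS.
  have [mg' g'M _] := gw'.
  have mk : measurable_fun setT k.
    apply: measurable_funM => //.
    exact: measurable_powR_comp.
  have gtw := bounded_weight_consrVr t gw.
  have [mgt gtM _] := gtw.
  have := @hoelder_two _ _ R (leb n.+1) th setT (fun y => g (consrV (t, y))) k (J g t) B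
    measurableT th01 mgt mk.
  rewrite (bounded_weight_integral gtw) => /(_ _ _ _ kB) H.
  have g_ge0 y : [set: 'rV[R]_n.+1] y -> 0 <= g (consrV (t, y)).
    by move=> _; have /andP[] := gtM y.
  have k_ge0 y : [set: 'rV[R]_n.+1] y -> 0 <= k y.
    by move=> _; rewrite mulr_ge0// powR_ge0.
  have {}H := H g_ge0 k_ge0 (lexx (J g t)%:E).
  apply: (@le_trans _ _ (J g t `^ th * B `^ (1 - th))%:E).
    apply: le_trans H; apply: ge0_le_integral => //.
    + by move=> y _; rewrite lee_fin mulr_ge0// powR_ge0.
    + apply/measurable_EFinP; apply: measurable_funM => //.
      exact: measurable_powR_comp.
    + apply/measurable_EFinP; apply: measurable_funM.
        exact: measurable_powR_comp.
      exact: measurable_powR_comp.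
    + move=> y _; rewrite lee_fin ler_wpM2l ?powR_ge0// /k.
      have /andP[g'0 _] := g'M y.
      rewrite powRM ?powR_ge0// -powRrM nth.
      (* Writing [f = f^th f^(1 - th)], only the first factor is traded for [g'^th]; the second is
         already in [k^(1 - th)]. *)
      have fg' : f (consrV (t, y)) <= g' y.
        rewrite -lee_fin /g' -(line_integral_EFin _ (Gw ord0)).
        apply: le_trans (fG ord0 (consrV (t, y))) _.
        by under eq_integral do rewrite set_coord0.
      have fE : f (consrV (t, y)) = f (consrV (t, y)) `^ th * f (consrV (t, y)) `^ (1 - th).
        have th1 : th + (1 - th) = 1 by rewrite addrC subrK.
        by rewrite -powRD th1 ?powRr1 ?oner_eq0.
      by rewrite [leLHS]fE ler_wpM2r ?powR_ge0// ge0_ler_powR ?nnegrE// ltW//; case/andP: th01.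
  rewrite /B /g' (integral_line_integral (Gw ord0)).
  have G0ge := bounded_weight_integral_ge0 (Gw ord0).
  rewrite lee_fin powRM ?powR_ge0 ?prodr_ge0// => [|i _]; last exact: powR_ge0.
  rewrite -powRrM nth mulrCA ler_wpM2l ?powR_ge0// ler_wpM2l ?powR_ge0//.
  have -> : (\prod_(i < n.+1) J (G (lift ord0 i)) t `^ n.+1%:R^-1) `^ (1 - th) =
      \prod_(i < n.+1) J (G (lift ord0 i)) t `^ th.
    rewrite powR_prod => [|i]; last exact: powR_ge0.
    by apply: eq_bigr => i _; rewrite -powRrM nth.
  exact: lexx.
rewrite tonelli_consrV; last 2 first.
- apply/measurable_EFinP; apply: measurable_funM => //.
  exact: measurable_powR_comp.
- by move=> x; rewrite lee_fin mulr_ge0// powR_ge0.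
(* Once [G ord0] is integrated out, [g] takes its slot: [n + 2] functions of [t] remain, each with
   exponent [th = 1/(n+2)], so that Hoelder applies in [t]. *)
pose H (i : 'I_n.+2) := if unlift ord0 i is Some j then G (lift ord0 j) else g.
have Hw i : bounded_weight L M (H i).
  by rewrite /H; case: unliftP => [j _|_]; [exact: Gw|exact: gw].
have HE t : J g t `^ th * \prod_(i < n.+1) (J (G (lift ord0 i)) t `^ th) =
    \prod_i (J (H i) t `^ th).
  rewrite [RHS]big_ord_recl /H unlift_none; congr (_ * _).
  by apply: eq_bigr => i _; rewrite liftK.
have hH : (\int[mu]_t (\prod_i (J (H i) t `^ th))%:E <=
    (\prod_i ((\int[leb n.+2]_x H i x) `^ th))%:E)%E.
  apply: hoelder_prod => //.
  - by move=> i; case/andP: th01.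
  - by rewrite sumr_const card_ord -[LHS]mulr_natr mulVf// pnatr_eq0.
  - by move=> i; exact: measurable_slice_integral (Hw i).
  - move=> i t _; exact: (bounded_weight_integral_ge0 (bounded_weight_consrVr t (Hw i))).
  - by move=> i; rewrite /J (integral_slice_integral (Hw i)).
apply: (@le_trans _ _ (((\int[leb n.+2]_x G ord0 x) `^ th)%:E *
    \int[mu]_t (\prod_i (J (H i) t `^ th))%:E)%E).
  have mJ : measurable_fun setT (fun t => \prod_i (J (H i) t `^ th)).
    apply: measurable_prod => i _.
    by apply: measurable_powR_comp; exact: measurable_slice_integral (Hw i).
  rewrite -ge0_integralZl//; last 3 first.
  - exact/measurable_EFinP.
  - by move=> t _; rewrite lee_fin prodr_ge0// => i _; exact: powR_ge0.
  - by rewrite lee_fin powR_ge0.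
  apply: ge0_le_integral => //.
  - by move=> t _; apply: integral_ge0 => y _; rewrite lee_fin mulr_ge0// powR_ge0.
  - apply: (@measurable_int_consrVr R n.+1 (fun x => (g x `^ th * f x)%:E)).
      apply/measurable_EFinP; apply: measurable_funM => //.
      exact: measurable_powR_comp.
    by move=> x; rewrite lee_fin mulr_ge0// powR_ge0.
  - by apply: measurable_funeM; exact/measurable_EFinP.
  - by move=> t _; rewrite -EFinM -HE; exact: inner.
apply: (@le_trans _ _ (((\int[leb n.+2]_x G ord0 x) `^ th)%:E *
    (\prod_i ((\int[leb n.+2]_x H i x) `^ th))%:E)%E).
  by rewrite lee_wpmul2l// lee_fin powR_ge0.
rewrite -EFinM lee_fin le_eqVlt; apply/orP; left; apply/eqP.
rewrite big_ord_recl [in RHS]big_ord_recl {1}/H unlift_none mulrCA; congr (_ * (_ * _)).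
by apply: eq_bigr => i _; rewrite /H liftK.
Qed.

End gagliardo.

(** * Powers of the absolute value and their derivatives *)

Section absolute_powers.
Context (R : realType).
Implicit Types a b u : R.

Lemma continuous_norm_powR b : 0 < b -> continuous (fun u : R => `|u| `^ b).
Proof.
move=> b0 u; have [->|u0] := eqVneq u 0.
  have z : `|0 : R| `^ b = 0 by rewrite normr0 powR0// gt_eqF.
  rewrite /continuous_at z; apply/cvgrPdist_le => e e0.
  have e'0 : 0 < e `^ b^-1 by exact: powR_gt0.
  near=> v; rewrite sub0r normrN ger0_norm ?powR_ge0//.
  have ve : `|v| <= e `^ b^-1.
    near: v; have := @nbhs0_le R R _ e'0; exact.
  have eE : e = (e `^ b^-1) `^ b by rewrite -powRrM mulVf ?gt_eqF// powRr1// ltW.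
  by rewrite [leRHS]eE ge0_ler_powR ?nnegrE ?powR_ge0// ltW.
apply: (@continuous_comp _ _ _ (fun v : R => `|v|) (fun t : R => t `^ b)).
  exact: norm_continuous.
by apply: is_derive_continuous (is_derive1_powR b _); rewrite normr_gt0.
Unshelve. all: by end_near. Qed.

(** The signed power, which up to a factor is the derivative of the power [b + 1] of the absolute
    value. *)
Definition spowR b u : R := `|u| `^ b * Num.sg u.

Lemma norm_spowR b u : 0 < b -> `|spowR b u| = `|u| `^ b.
Proof.
move=> b0; rewrite /spowR normrM (ger0_norm (powR_ge0 _ _)) normr_sg.
have [->|_] := eqVneq u 0; last by rewrite mulr1.
by rewrite normr0 powR0 ?gt_eqF// mul0r.
Qed.

Lemma continuous_spowR b : 0 < b -> continuous (spowR b).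
Proof.
move=> b0 u; have cb := continuous_norm_powR b0.
have [u0|u0|->] := ltgtP u 0.
- have E : \forall v \near u, - (`|v| `^ b) = spowR b v.
    near=> v; have v0 : v < 0 by near: v; exact: lt_nbhsl.
    by rewrite /spowR ltr0_sg// mulrN1.
  rewrite /continuous_at -(nbhs_singleton E).
  apply: cvg_trans (cvgN (cb u)); apply: near_eq_cvg.
  by apply: filterS E => v Ev; rewrite -Ev.
- have E : \forall v \near u, `|v| `^ b = spowR b v.
    near=> v; have v0 : 0 < v by near: v; exact: lt_nbhsr.
    by rewrite /spowR gtr0_sg// mulr1.
  rewrite /continuous_at -(nbhs_singleton E).
  apply: cvg_trans (cb u); apply: near_eq_cvg.
  by apply: filterS E => v Ev; rewrite -Ev.
- rewrite /continuous_at {2}/spowR sgr0 mulr0; apply/cvgrPdist_le => e e0.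
  have /cvgrPdist_le/(_ _ e0) := cb 0; rewrite normr0 powR0 ?gt_eqF//.
  by apply: filterS => v; rewrite !sub0r !normrN norm_spowR// ger0_norm ?powR_ge0.
Unshelve. all: by end_near. Qed.

(** Away from 0 the sign is locally constant; at 0 the difference quotient has absolute value
    [|h|^(a - 1)], which tends to 0. *)
Lemma is_derive_norm_powR a u : 1 < a ->
  is_derive u (1 : R) (fun v : R => `|v| `^ a) (a * spowR (a - 1) u).
Proof.
move=> a1; have a10 : 0 < a - 1 by rewrite subr_gt0.
have [u0|u0|->] := ltgtP u 0.
- have E : \forall v \near u, ((fun v => v `^ a) \o (-%R : R -> R)) v = `|v| `^ a.
    near=> v; have v0 : v < 0 by near: v; exact: lt_nbhsl.
    by rewrite ltr0_norm.
  apply: near_eq_is_derive E _.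
  have nu : 0 < - u by rewrite oppr_gt0.
  have := is_derive_comp (is_deriveNid u (1 : R)) (is_derive1_powR a nu).
  by rewrite /spowR ltr0_sg// ltr0_norm// mulrA.
- have E : \forall v \near u, v `^ a = `|v| `^ a.
    near=> v; have v0 : 0 < v by near: v; exact: lt_nbhsr.
    by rewrite gtr0_norm.
  apply: near_eq_is_derive E _.
  by have := is_derive1_powR a u0; rewrite /spowR gtr0_sg// gtr0_norm// mulr1.
- have cv : (fun h : R => h^-1 *: (((fun v : R => `|v| `^ a) \o shift 0) (h *: (1 : R))
      - `|0 : R| `^ a)) @ 0^' --> (0 : R).
    apply/cvgrPdist_le => e e0.
    have /cvgrPdist_le/(_ _ e0) := continuous_norm_powR a10 (x := 0).
    rewrite normr0 powR0 ?gt_eqF// => /nbhs_dnbhs near_e.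
    near=> h; rewrite sub0r normrN /= addr0 powR0 ?subr0; last by rewrite gt_eqF// (lt_trans ltr01).
    have h0 : h != 0 by near: h; exact: nbhs_dnbhs_neq.
    have : `|0 - `|h| `^ (a - 1)| <= e by near: h.
    rewrite -[_ *: _]/(_ * _) -[h *: _]/(h * 1) mulr1 sub0r normrN normrM normfV.
    rewrite powRB ?normr_eq0 ?h0 ?implybT// powRr1// normrM normfV normr_id.
    by rewrite mulrC.
  split; first by apply/cvg_ex; exists 0.
  by rewrite /spowR sgr0 !mulr0; exact: cvg_lim cv.
Unshelve. all: by end_near. Qed.

End absolute_powers.

Section sobolev_test_functions.
Context (R : realType) (n : nat).
Local Notation mu := (@lebesgue_measure R).
Local Notation leb := (lebesgue_rV R n).
Implicit Types f phi : 'rV[R]_n -> R.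

(** The power vanishes far out on the line, so its value at [x] is the integral of its derivative up
    to [x]; passing to absolute values and to the whole line only enlarges it. *)
Lemma norm_powR_le_line_integral a L (i : 'I_n) phi x :
  1 < a -> C1dir i phi -> supported L phi ->
  ((`|phi x| `^ a)%:E <=
   \int[mu]_t (a * `|phi (set_coord i t x)| `^ (a - 1) *
               `|partial i phi (set_coord i t x)|)%:E)%E.
Proof.
move=> a1 C sphi; have [cphi dphi pphi] := C.
have a10 : 0 < a - 1 by rewrite subr_gt0.
have a0 : 0 < a by rewrite (lt_trans ltr01).
pose x0 := set_coord i 0 x.
have lineE t : set_coord i t x = x0 + t *: delta_mx 0 i.
  rewrite (_ : set_coord i t x = set_coord i t x0).
    by rewrite set_coord_line /x0 mxE eqxx subr0.
  by apply/rowP => j; rewrite !mxE; case: eqP.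
pose g t := `|phi (x0 + t *: delta_mx 0 i)| `^ a.
pose g' t := a * spowR (a - 1) (phi (x0 + t *: delta_mx 0 i)) *
  partial i phi (x0 + t *: delta_mx 0 i).
have Dg t : is_derive t (1 : R) g (g' t).
  exact: is_derive_comp (is_derive_partial x0 t C) (is_derive_norm_powR _ a1).
have cg' : continuous g'.
  move=> t; apply: cvgM; last exact: (continuous_along (i := i) (x := x0) pphi).
  apply: cvgMl_tmp.
  apply: (@continuous_comp _ _ _ (fun t : R => phi (x0 + t *: delta_mx 0 i)) (spowR (a - 1))).
    exact: continuous_along.
  exact: continuous_spowR.
(* A starting point to the left of both the support and [x]. *)
pose s := x ord0 i; pose K := - (`|L| + `|s|).
have Ks : K <= s.
  by rewrite /K; have := ler_norm (- s); rewrite normrN; have := normr_ge0 L; lra.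
have gK : g K = 0.
  rewrite /g (_ : phi _ = 0) ?normr0 ?powR0 ?gt_eqF//.
  apply/eqP; apply/negPn/negP => /sphi /(_ i).
  rewrite -lineE mxE eqxx /K => /andP[+ _].
  by have := ler_norm L; have := normr_ge0 s; lra.
have gs : g s = `|phi x| `^ a by rewrite /g -lineE set_coord_id.
have FT := FTC_segment Ks Dg cg'; rewrite gs gK subr0 in FT.
rewrite -FT; apply: (@le_trans _ _ (\int[mu]_(t in `[K, s]) (`|g' t|)%:E)%E).
  apply: le_integral => //.
  - by apply: continuous_compact_integrable; [exact: segment_compact|exact: continuous_subspaceT].
  - apply: continuous_compact_integrable; first exact: segment_compact.
    apply: continuous_subspaceT => t; apply: (@continuous_comp _ _ _ g' Num.norm).
      exact: cg'.
    exact: norm_continuous.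
  - by move=> t _; rewrite lee_fin ler_norm.
have E t : `|g' t| = a * `|phi (set_coord i t x)| `^ (a - 1) *
    `|partial i phi (set_coord i t x)|.
  by rewrite /g' -lineE normrM normrM (gtr0_norm a0) norm_spowR.
under eq_integral do rewrite E.
apply: ge0_subset_integral => //.
- apply/measurable_EFinP; under eq_fun do rewrite -E.
  apply: measurableT_comp => //; exact: continuous_measurable_fun.
- by move=> t _; rewrite lee_fin !mulr_ge0 ?powR_ge0// ltW.
Qed.

Lemma supported_norm_powR L b phi : b != 0 -> supported L phi ->
  supported L (fun x => `|phi x| `^ b).
Proof.
move=> b0 sphi x H; apply: sphi; apply: contra_neq H => ->.
by rewrite normr0 powR0.
Qed.

Lemma bounded_weight_continuous L f : continuous f -> supported L f ->
  (forall x, 0 <= f x) -> exists2 M, 0 < M & bounded_weight L M f.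
Proof.
move=> cf sf f0; have [M M0 fM] := supported_continuous_bounded cf sf.
exists M => //; split => // [|x]; first exact: continuous_measurable_rV.
by rewrite f0 (le_trans (ler_norm _)).
Qed.

Lemma bounded_weightW L M M' f : M <= M' -> bounded_weight L M f -> bounded_weight L M' f.
Proof.
move=> MM [mf fM sf]; split => // x.
by have /andP[-> /le_trans ->] := fM x.
Qed.

Lemma continuous_norm_powR_comp b f : 0 < b -> continuous f ->
  continuous (fun x => `|f x| `^ b).
Proof.
move=> b0 cf x; apply: (@continuous_comp _ _ _ f (fun u : R => `|u| `^ b)).
  exact: cf.
exact: continuous_norm_powR.
Qed.

End sobolev_test_functions.

(** * The Sobolev inequality with the critical exponent *)

Section sobolev.
Context (R : realType).
Local Notation leb n := (lebesgue_rV R n).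

(** Exponents for [f = |phi|^a], [a = 2(n-1)/(n-2)], and the weight [g = |phi|^s]. The last identity
    turns [g^(1/n) f] into [|phi|^s], the second makes [|phi|^(a-1)] the square root of [|phi|^s],
    and the third lets the powers of the integral cancel. *)
Lemma crit_expE n : (3 <= n)%N ->
  [/\ crit_exp R n > 2,
      crit_exp R n / 2 = 2 * (n%:R - 1) / (n%:R - 2) - 1,
      n%:R^-1 + 2^-1 + (crit_exp R n)^-1 = 1 &
      crit_exp R n / n%:R + 2 * (n%:R - 1) / (n%:R - 2) = crit_exp R n].
Proof.
move=> n3; have N3 : 3 <= (n%:R : R) by rewrite (ler_nat R 3).
rewrite /crit_exp; set N := (n%:R : R) in N3 *.
have N2 : N - 2 != 0 by apply/eqP => E; move: N3; lra.
have N0 : N != 0 by apply/eqP => E; move: N3; lra.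
clearbody N; split.
- by rewrite ltr_pdivlMr; lra.
- by field.
- by field; rewrite N0 N2.
- by field; rewrite N0 N2.
Qed.

(** With [X] the integral of [|phi|^s] and [D] the Dirichlet sum, Cauchy-Schwarz bounds each line
    weight by [a X^(1/2) D^(1/2)]. Hence [X <= X^(1/n) a X^(1/2) D^(1/2)], and dividing by the
    powers of [X] leaves [X^(1/s) <= a D^(1/2)]. *)
Lemma sobolev_supported n L (phi : 'rV[R]_n -> R) : (3 <= n)%N ->
  (forall i, C1dir i phi) -> supported L phi ->
  (\int[leb n]_x (`|phi x| `^ crit_exp R n)) `^ (2 / crit_exp R n) <=
  (2 * (n%:R - 1) / (n%:R - 2)) ^+ 2 *
    \sum_i \int[leb n]_x (partial i phi x ^+ 2).
Proof.
move=> n3; have [s2 s_half s_inv s_sum] := crit_expE n3.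
have N3 : 3 <= (n%:R : R) by rewrite (ler_nat R 3).
move: s2 s_half s_inv s_sum; set s := crit_exp R n.
set a := 2 * (n%:R - 1) / (n%:R - 2) => s2 s_half s_inv s_sum C sphi.
have s0 : 0 < s by lra.
have a1 : 1 < a by lra.
have a0 : 0 < a by lra.
have a10 : 0 < a - 1 by lra.
clearbody s a.
case: n => [//|m] in phi n3 N3 s_inv s_sum C sphi *.
set n := m.+1 in phi n3 N3 s_inv s_sum C sphi *.
have cphi : continuous phi by case: (C ord0).
have cp i : continuous (partial i phi) by case: (C i).
have n0 : (n%:R : R) != 0 by rewrite pnatr_eq0.
pose G i x := a * `|phi x| `^ (a - 1) * `|partial i phi x|.
pose g x := `|phi x| `^ s.
have cg : continuous g by exact: continuous_norm_powR_comp.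
have sg : supported L g by apply: supported_norm_powR => //; rewrite gt_eqF.
have g0 x : 0 <= g x by exact: powR_ge0.
have [Mg Mg0 gw] := bounded_weight_continuous cg sg g0.
have cG i : continuous (G i).
  apply: (@CkM R n 0%N).
    apply: (@CkM R n 0%N); first exact: (@Ck_cst R n 0%N).
    exact: continuous_norm_powR_comp.
  move=> x; apply: (@continuous_comp _ _ _ (partial i phi) (fun v : R => `|v|)); first exact: cp.
  exact: norm_continuous.
have sG i : supported L (G i).
  move=> x H; apply: sphi; apply: contra_neq H => phi0.
  by rewrite /G phi0 normr0 powR0 ?gt_eqF// mulr0 mul0r.
have G0 i x : 0 <= G i x.
  by apply: mulr_ge0 => //; apply: mulr_ge0; [exact: ltW|exact: powR_ge0].
have /choice [MG HG] : forall i, exists M, 0 < M /\ bounded_weight L M (G i).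
  by move=> i; have [M M0 w] := bounded_weight_continuous (cG i) (sG i) (G0 i); exists M.
pose M := Mg + \sum_i MG i.
have SM0 : 0 <= \sum_i MG i by apply: sumr_ge0 => i _; have [/ltW] := HG i.
have {}gw : bounded_weight L M g by apply: bounded_weightW gw; rewrite lerDl.
have Gw i : bounded_weight L M (G i).
  have [_ w] := HG i; apply: bounded_weightW w.
  rewrite /M (bigD1 i)//= addrCA lerDl addr_ge0 ?(ltW Mg0)//.
  by apply: sumr_ge0 => j _; have [/ltW] := HG j.
have mf : measurable_fun setT (fun x => `|phi x| `^ a).
  by apply: continuous_measurable_rV; exact: continuous_norm_powR_comp.
have f0 x : 0 <= `|phi x| `^ a by exact: powR_ge0.
have fG i x : ((`|phi x| `^ a)%:E <=
    \int[lebesgue_measure]_t (G i (set_coord i t x))%:E)%E.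
  exact: norm_powR_le_line_integral (C i) sphi.
have := gagliardo mf f0 gw Gw fG; rewrite -/n.
have -> : (fun x => (g x `^ n%:R^-1 * `|phi x| `^ a)%:E) = (fun x => (g x)%:E).
  apply/funext => x; congr EFin; rewrite /g -powRrM -powRD ?s_sum//.
  by rewrite gt_eqF.
rewrite (bounded_weight_integral gw) lee_fin.
set X := \int[_]_x g x; set D := \sum_i _ => HX.
have X0 : 0 <= X := bounded_weight_integral_ge0 gw.
have D0 i : 0 <= \int[leb n]_x (partial i phi x ^+ 2).
  by apply: Rintegral_ge0 => x _; exact: sqr_ge0.
have DD0 : 0 <= D by apply: sumr_ge0 => i _.
pose A := a * (X `^ 2^-1 * D `^ 2^-1).
have A0 : 0 <= A by rewrite mulr_ge0 ?(ltW a0)// mulr_ge0// powR_ge0.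
have GA i : \int[leb n]_x G i x <= A.
  have cp2 : continuous (fun x => partial i phi x ^+ 2).
    by under eq_fun do rewrite expr2; apply: (@CkM R n 0%N); exact: cp.
  have sp2 : supported (L + 1) (fun x => partial i phi x ^+ 2).
    by move=> x; rewrite sqrf_eq0 => /(@supported_partial _ _ _ i _ sphi).
  have [Mp _ pw] := bounded_weight_continuous cp2 sp2 (fun x => sqr_ge0 _).
  have half : 0 < (2^-1 : R) < 1 by apply/andP; split; lra.
  have := @hoelder_two _ _ R (leb n) 2^-1 setT g (fun x => partial i phi x ^+ 2) X
    (\int[leb n]_x (partial i phi x ^+ 2)) measurableT half.
  rewrite (bounded_weight_integral gw) (bounded_weight_integral pw).
  move=> /(_ _ _ (fun x _ => g0 x) (fun x _ => sqr_ge0 _) (lexx _) (lexx _)).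
  have [[mg _ _] [mp _ _]] := (gw, pw).
  move=> /(_ mg mp); have -> : 1 - 2^-1 = 2^-1 :> R by lra.
  have Ei x : g x `^ 2^-1 * (partial i phi x ^+ 2) `^ 2^-1 = a^-1 * G i x.
    rewrite /g /G -powRrM s_half powR12_sqrt ?sqr_ge0// sqrtr_sqr.
    by rewrite -[X in _ = _ * X]mulrA mulKf// gt_eqF.
  under eq_integral do rewrite Ei EFinM.
  rewrite ge0_integralZl//; last 3 first.
  - by have [mG _ _] := Gw i; exact/measurable_EFinP.
  - by move=> x _; rewrite lee_fin.
  - by rewrite lee_fin invr_ge0 ltW.
  rewrite (bounded_weight_integral (Gw i)) -EFinM lee_fin ler_pdivrMl// => H.
  apply: le_trans H _; rewrite /A ler_wpM2l ?(ltW a0)// ler_wpM2l ?powR_ge0//.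
  rewrite ge0_ler_powR ?nnegrE ?invr_ge0//.
  by rewrite /D (bigD1 i)//= lerDl sumr_ge0.
have prodA : \prod_i ((\int[leb n]_x G i x) `^ n%:R^-1) <= A.
  have -> : A = \prod_(i < n) (A `^ n%:R^-1).
    rewrite prodr_const card_ord -powR_mulrn ?powR_ge0// -powRrM mulVf//.
    by rewrite powRr1.
  apply: ler_prod => i _; rewrite powR_ge0/= ge0_ler_powR ?nnegrE ?invr_ge0//.
  exact: bounded_weight_integral_ge0 (Gw i).
have {}HX : X <= X `^ n%:R^-1 * A.
  by apply: le_trans HX _; rewrite ler_wpM2l// powR_ge0.
have [X00|Xn0] := eqVneq X 0.
  have s_neq0 : 2 / s != 0 by apply: lt0r_neq0; exact: divr_gt0.
  by rewrite X00 powR0// mulr_ge0// sqr_ge0.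
have Xpos : 0 < X by rewrite lt_neqAle eq_sym Xn0.
have Xs : X `^ s^-1 <= a * D `^ 2^-1.
  have P1 : 0 < X `^ n%:R^-1 by exact: powR_gt0.
  have P2 : 0 < X `^ 2^-1 by exact: powR_gt0.
  rewrite -(ler_pM2l (mulr_gt0 P1 P2)) -!powRD ?Xn0 ?implybT// s_inv powRr1//.
  apply: le_trans HX _; rewrite powRD ?Xn0 ?implybT// /A.
  by rewrite le_eqVlt; apply/orP; left; apply/eqP; ring.
have -> : X `^ (2 / s) = (X `^ s^-1) ^+ 2.
  by rewrite -powR_mulrn ?powR_ge0// -powRrM mulrC.
have -> : a ^+ 2 * D = (a * D `^ 2^-1) ^+ 2.
  rewrite exprMn -[X in _ = _ * X]powR_mulrn ?powR_ge0// -powRrM mulVf ?powRr1//.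
by rewrite lerXn2r ?nnegrE ?powR_ge0// mulr_ge0 ?powR_ge0// (ltW a0).
Qed.

End sobolev.

(** * The Poincare inequality on cubes *)

Section variance.
Context d (T : measurableType d) (R : realType) (mu : {measure set T -> \bar R}).

Lemma integral_sqr_sub_mean (E : set T) (v : R) (g : T -> R) : measurable E ->
  mu E = v%:E -> v != 0 ->
  mu.-integrable E (EFin \o g) -> mu.-integrable E (EFin \o (fun x => g x ^+ 2)) ->
  \int[mu]_(x in E) ((g x - (\int[mu]_(x in E) g x) / v) ^+ 2) =
  \int[mu]_(x in E) (g x ^+ 2) - (\int[mu]_(x in E) g x) ^+ 2 / v.
Proof.
move=> mE vE v0 gi g2i; set m := _ / v.
have ci : mu.-integrable E (EFin \o (fun=> m ^+ 2)).
  apply: measurable_bounded_integrable => //; first by rewrite vE ltry.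
  by exists (m ^+ 2); split => [|K mK x _ /=]; rewrite ?num_real// ger0_norm ?sqr_ge0// ltW.
have gmi : mu.-integrable E (EFin \o (fun x => (- 2 * m) * g x)).
  exact: (integrableZl mE (- 2 * m) gi).
rewrite (_ : \int[mu]_(x in E) _ =
    \int[mu]_(x in E) (g x ^+ 2 + ((- 2 * m) * g x + m ^+ 2))); last first.
  by apply: eq_Rintegral => x _; ring.
rewrite RintegralD//; last exact: (integrableD mE gmi ci).
rewrite RintegralD// RintegralZl// Rintegral_cst// vE /=.
by rewrite /m; field.
Qed.

(** Nonnegativity of the variance. *)
Lemma sqr_integral_le (E : set T) (v : R) (g : T -> R) : measurable E ->
  mu E = v%:E -> v != 0 ->
  mu.-integrable E (EFin \o g) -> mu.-integrable E (EFin \o (fun x => g x ^+ 2)) ->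
  (\int[mu]_(x in E) g x) ^+ 2 <= v * \int[mu]_(x in E) (g x ^+ 2).
Proof.
move=> mE vE v0 gi g2i.
have vpos : 0 < v.
  by rewrite lt_neqAle eq_sym v0 -lee_fin -vE measure_ge0.
have := integral_sqr_sub_mean mE vE v0 gi g2i.
have : 0 <= \int[mu]_(x in E) ((g x - (\int[mu]_(x in E) g x) / v) ^+ 2).
  by apply: Rintegral_ge0 => x _; exact: sqr_ge0.
by move=> /[swap] ->; rewrite subr_ge0 ler_pdivrMr// mulrC.
Qed.

(** The mean lies within [sqrt D] of every value, so the variance is at most [v D]. *)
Lemma integral_sqr_le_osc (E : set T) (v D : R) (g : T -> R) : measurable E ->
  mu E = v%:E -> v != 0 ->
  mu.-integrable E (EFin \o g) -> mu.-integrable E (EFin \o (fun x => g x ^+ 2)) ->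
  (forall x y, E x -> E y -> (g x - g y) ^+ 2 <= D) ->
  \int[mu]_(x in E) (g x ^+ 2) <= (\int[mu]_(x in E) g x) ^+ 2 / v + v * D.
Proof.
move=> mE vE v0 gi g2i osc.
have vpos : 0 < v.
  by rewrite lt_neqAle eq_sym v0 -lee_fin -vE measure_ge0.
have cst_i (c : R) : mu.-integrable E (EFin \o (fun=> c)).
  apply: measurable_bounded_integrable => //; first by rewrite vE ltry.
  by exists `|c|; split => [|K mK x _ /=]; rewrite ?num_real// ltW.
rewrite -lerBlDl -integral_sqr_sub_mean//; set m := _ / v.
have mD x : E x -> (g x - m) ^+ 2 <= D.
  move=> Ex; have D0 : 0 <= D by apply: le_trans (osc x x Ex Ex); exact: sqr_ge0.
  pose r := Num.sqrt D; have r0 : 0 <= r by exact: sqrtr_ge0.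
  have rD : r ^+ 2 = D by rewrite sqr_sqrtr.
  have gx y : E y -> g x - r <= g y <= g x + r.
    move=> Ey; have := osc x y Ex Ey; rewrite -rD -(real_normK (num_real (_ - _))).
    by rewrite ler_sqr ?nnegrE// ler_norml => /andP[h1 h2]; apply/andP; split; lra.
  have mle : \int[mu]_(y in E) g y <= (g x + r) * v.
    rewrite -[v]/(fine v%:E) -vE -Rintegral_cst//; apply: le_Rintegral => // y Ey.
    by have /andP[] := gx y Ey.
  have mge : (g x - r) * v <= \int[mu]_(y in E) g y.
    rewrite -[v]/(fine v%:E) -vE -Rintegral_cst//; apply: le_Rintegral => // y Ey.
    by have /andP[] := gx y Ey.
  have m1 : m <= g x + r by rewrite /m ler_pdivrMr.
  have m2 : g x - r <= m by rewrite /m ler_pdivlMr.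
  by rewrite -rD -(real_normK (num_real (_ - _))) ler_sqr ?nnegrE// ler_norml;
    apply/andP; split; lra.
have g_m2 : mu.-integrable E (EFin \o (fun x => (g x - m) ^+ 2)).
  apply: (le_integrable mE _ _ (cst_i D)).
    apply/measurable_EFinP; apply: measurable_funX; apply: measurable_funB => //.
    by apply/measurable_EFinP; exact: measurable_int gi.
  move=> x Ex /=; rewrite lee_fin ger0_norm ?sqr_ge0//.
  by apply: le_trans (mD x Ex) _; exact: ler_norm.
rewrite mulrC -[v]/(fine v%:E) -vE -Rintegral_cst//.
exact: le_Rintegral.
Qed.

End variance.

Section poincare_cube.
Context (R : realType).
Local Notation mu := (@lebesgue_measure R).
Local Notation leb n := (lebesgue_rV R n).
Implicit Types (L M h : R).

Definition cube n (a : 'I_n -> R) h : set 'rV[R]_n := box a (fun i => a i + h).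

Lemma lebesgue_cube n (a : 'I_n -> R) h : 0 <= h ->
  leb n (cube a h) = (h ^+ n)%:E.
Proof.
move=> h0; rewrite lebesgue_box => [|i]; last by rewrite lerDl.
by under eq_bigr do rewrite addrC addKr; rewrite prodr_const card_ord.
Qed.

Lemma bounded_weight_sqr n L M (F : 'rV[R]_n -> R) : bounded_weight L M F ->
  bounded_weight L (M ^+ 2) (fun x => F x ^+ 2).
Proof.
move=> [mF FM sF]; split => [|x|x]; first exact: measurable_funX.
  have /andP[F0 FxM] := FM x; rewrite sqr_ge0 ler_sqr ?nnegrE//.
  exact: le_trans FxM.
by rewrite sqrf_eq0; exact: sF.
Qed.

Lemma integral_vanish_outside d (T : measurableType d) (m : {measure set T -> \bar R})
    (E : set T) (F : T -> R) :
  (forall x, ~ E x -> F x = 0) -> \int[m]_(x in E) F x = \int[m]_x F x.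
Proof.
move=> FE; rewrite Rintegral_mkcond; apply: eq_Rintegral => x _.
rewrite /patch; case: ifPn => // xE; rewrite FE//.
by move: xE; rewrite notin_setE.
Qed.

(** Induction on the dimension. On each slice the induction hypothesis bounds the square integral by
    that of the slice mean plus the other directions; the slice integrals [J F] form a function of
    one variable, to which [integral_sqr_le_osc] applies. Derivatives enter only through the
    oscillation along coordinate lines, a hypothesis that passes to slices. *)
Lemma poincare_cube n L M (a : 'I_n -> R) h (F : 'rV[R]_n -> R)
    (G : 'I_n -> 'rV[R]_n -> R) : 0 < h ->
  bounded_weight L M F -> (forall i, bounded_weight L M (G i)) ->
  (forall x, ~ cube a h x -> F x = 0) ->
  (forall i x, ~ cube a h x -> G i x = 0) ->
  (forall i x s, cube a h x -> (a i <= s < a i + h)%R ->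
    ((F x - F (set_coord i s x)) ^+ 2)%R%:E <=
    h%:E * \int[mu]_t (G i (set_coord i t x))%:E)%E ->
  \int[leb n]_x (F x ^+ 2) <=
  (\int[leb n]_x F x) ^+ 2 / h ^+ n + h ^+ 2 * \sum_i \int[leb n]_x G i x.
Proof.
move=> h0; elim: n L M a F G => [|n IH] L M a F G Fw Gw FQ GQ osc.
  have [mF FM _] := Fw.
  rewrite big_ord0 mulr0 addr0 expr0 divr1 le_eqVlt; apply/orP; left; apply/eqP.
  have E (g : 'rV[R]_0 -> R) : measurable_fun setT g -> \int[leb 0]_x g x = g 0.
    move=> mg; rewrite /Rintegral integral_dirac//; last exact/measurable_EFinP.
    by rewrite diracT mul1e.
  by rewrite !E//; exact: measurable_funX.
pose a' i := a (lift ord0 i).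
pose I : set R := `[a ord0, a ord0 + h[%classic.
have cubeE t y : cube a h (consrV (t, y)) <-> I t /\ cube a' h y.
  by rewrite /cube box_consrV /I /= in_itv.
have F2w := bounded_weight_sqr Fw.
pose J (g : 'rV[R]_n.+1 -> R) t := \int[leb n]_y g (consrV (t, y)).
have slice t : J (fun x => F x ^+ 2) t <=
    J F t ^+ 2 / h ^+ n + h ^+ 2 * \sum_i J (G (lift ord0 i)) t.
  have [It|nIt] := pselect (I t).
    apply: (IH L M a' (fun y => F (consrV (t, y)))
      (fun i y => G (lift ord0 i) (consrV (t, y)))).
    - exact: bounded_weight_consrVr.
    - by move=> i; exact: bounded_weight_consrVr.
    - by move=> y ny; apply: FQ => /cubeE[_].
    - by move=> i y ny; apply: GQ => /cubeE[_].
    - move=> i y s Qy si.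
      have := osc (lift ord0 i) (consrV (t, y)) s ((cubeE t y).2 (conj It Qy)) si.
      by rewrite set_coordS; under eq_integral do rewrite set_coordS.
  have F0 y : F (consrV (t, y)) = 0 by apply: FQ => /cubeE[].
  have -> : J (fun x => F x ^+ 2) t = 0.
    by rewrite /J /Rintegral integral0_eq// => y _; rewrite F0 expr0n.
  rewrite addr_ge0 ?divr_ge0 ?sqr_ge0 ?exprn_ge0 ?(ltW h0)//.
  rewrite mulr_ge0 ?sqr_ge0// sumr_ge0// => i _.
  exact: bounded_weight_integral_ge0 (bounded_weight_consrVr t (Gw _)).
have JFE : \int[mu]_t J F t = \int[leb n.+1]_x F x.
  by rewrite /Rintegral (integral_slice_integral Fw).
have JF2E : \int[mu]_t J (fun x => F x ^+ 2) t = \int[leb n.+1]_x (F x ^+ 2).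
  by rewrite /Rintegral (integral_slice_integral F2w).
have JGE i : \int[mu]_t J (G i) t = \int[leb n.+1]_x G i x.
  by rewrite /Rintegral (integral_slice_integral (Gw i)).
have J_int g L' M' : bounded_weight L' M' g -> mu.-integrable setT (EFin \o J g).
  move=> gw; apply/integrableP; split.
    by apply/measurable_EFinP; exact: measurable_slice_integral gw.
  rewrite [X in (X < _)%E](_ : _ = \int[mu]_t (J g t)%:E)%E.
    by rewrite (integral_slice_integral gw) ltry.
  apply: eq_integral => t _; rewrite gee0_abs//= lee_fin.
  exact: bounded_weight_integral_ge0 (bounded_weight_consrVr t gw).
have mI : measurable I by exact: measurable_itv.
have muI : mu I = h%:E.
  rewrite [LHS](lebesgue_measure_itv `[a ord0, a ord0 + h[) /= lte_fin ltrDl h0.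
  by rewrite -EFinB addrC addKr.
have JF0 t : ~ I t -> J F t = 0.
  move=> nIt; rewrite /J /Rintegral integral0_eq// => y _.
  by rewrite FQ// => /cubeE[].
have hn0 : h ^+ n != 0 by rewrite expf_neq0// gt_eqF.
have mQ' : measurable (cube a' h) by exact: measurable_box.
have muQ' : leb n (cube a' h) = (h ^+ n)%:E by rewrite lebesgue_cube// ltW.
have F_int t : (leb n).-integrable (cube a' h) (EFin \o (fun y => F (consrV (t, y)))).
  apply: integrableS (bounded_weight_integrable (bounded_weight_consrVr t Fw)) => //.
(* Cauchy-Schwarz on the slice, of volume [h^n], then the oscillation hypothesis in direction
   [ord0], which brings one more factor [h]. *)
have JFosc s t : I s -> I t -> (J F s - J F t) ^+ 2 <=
    h ^+ n.+1 * \int[leb n.+1]_x G ord0 x.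
  move=> Is It.
  have JQ r : J F r = \int[leb n]_(y in cube a' h) F (consrV (r, y)).
    by rewrite integral_vanish_outside// => y ny; apply: FQ => /cubeE[].
  rewrite !JQ -RintegralB//.
  have [mF FM _] := Fw.
  have di : (leb n).-integrable (cube a' h)
      (EFin \o (fun y => F (consrV (s, y)) - F (consrV (t, y)))).
    exact: (integrableB mQ' (F_int s) (F_int t)).
  have d2i : (leb n).-integrable (cube a' h)
      (EFin \o (fun y => (F (consrV (s, y)) - F (consrV (t, y))) ^+ 2)).
    apply: measurable_bounded_integrable => //.
    - by rewrite muQ' ltry.
    - by apply: measurable_funX; apply/measurable_EFinP; exact: measurable_int di.
    - exists (M ^+ 2); split; first exact: num_real.
      move=> K MK y _ /=; rewrite ger0_norm ?sqr_ge0//; apply: le_trans (ltW MK).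
      have /andP[s0 sM] := FM (consrV (s, y)); have /andP[t0 tM] := FM (consrV (t, y)).
      by move: s0 sM t0 tM; move: (F _) (F _) => p q; nra.
  apply: le_trans (sqr_integral_le mQ' muQ' hn0 di d2i) _.
  rewrite exprSr -mulrA ler_wpM2l ?exprn_ge0 ?(ltW h0)//.
  have G0w := bounded_weight_line_integral (Gw ord0).
  rewrite -(integral_line_integral (Gw ord0)) -RintegralZl//; last first.
    exact: bounded_weight_integrable G0w.
  rewrite -(@integral_vanish_outside _ _ _ (cube a' h)); last first.
    move=> y ny; rewrite /Rintegral integral0_eq ?mulr0// => r _.
    by rewrite GQ// => /cubeE[].
  apply: le_Rintegral => //.
    have gi : (leb n).-integrable (cube a' h)
        (EFin \o (fun y => \int[mu]_r G ord0 (consrV (r, y)))).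
      apply: integrableS (bounded_weight_integrable G0w); [|exact: mQ'|by []].
      exact: measurableT.
    exact: (integrableZl mQ' h gi).
  move=> y Qy; have := osc ord0 (consrV (s, y)) t ((cubeE s y).2 (conj Is Qy)).
  rewrite set_coord0 => H; rewrite -lee_fin [leRHS]EFinM -[in leRHS](line_integral_EFin _ (Gw ord0)).
  move: It; rewrite /I /= in_itv /= => /H.
  by under eq_integral do rewrite set_coord0.
have JF_int := J_int _ _ _ Fw.
have JF2_int : mu.-integrable setT (EFin \o (fun t => J F t ^+ 2)).
  have [K HK] : exists K, forall t, J F t <= K.
    exists (fine (leb n (cube a' h)) * M + 0) => t.
    have -> : J F t = \int[leb n]_(y in cube a' h) F (consrV (t, y)).
      by rewrite integral_vanish_outside// => y ny; apply: FQ => /cubeE[].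
    rewrite addr0 mulrC -Rintegral_cst//; apply: le_Rintegral => //.
      apply: measurable_bounded_integrable => //; first by rewrite muQ' ltry.
      by exists `|M|; split => [|K' mK x _ /=]; rewrite ?num_real// ltW.
    by move=> y _; have [_ FM _] := Fw; have /andP[] := FM (consrV (t, y)).
  have JF_ge0 t : 0 <= J F t.
    exact: bounded_weight_integral_ge0 (bounded_weight_consrVr t Fw).
  apply: (le_integrable measurableT _ _ (integrableZl measurableT K JF_int)).
    by apply/measurable_EFinP/measurable_funX; exact: measurable_slice_integral Fw.
  move=> t _ /=; rewrite lee_fin ger0_norm ?sqr_ge0//.
  apply: le_trans (ler_norm _); rewrite expr2 ler_wpM2r//.
have phi2 : \int[mu]_t (J F t ^+ 2) <=
    (\int[leb n.+1]_x F x) ^+ 2 / h + h * (h ^+ n.+1 * \int[leb n.+1]_x G ord0 x).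
  have E2 := @integral_vanish_outside _ _ mu I (fun t => J F t ^+ 2).
  rewrite -JFE -(@integral_vanish_outside _ _ mu I (J F))// -E2; last first.
    by move=> t /JF0 ->; rewrite expr0n.
  apply: integral_sqr_le_osc => //; first by rewrite gt_eqF.
  - exact: integrableS JF_int.
  - exact: integrableS JF2_int.
have Ji i : mu.-integrable setT (EFin \o J (G (lift ord0 i))) by exact: J_int (Gw _).
have iS : mu.-integrable setT (EFin \o (fun t => \sum_i J (G (lift ord0 i)) t)).
  have : mu.-integrable setT (fun t => \sum_i (J (G (lift ord0 i)) t)%:E)%E.
    by apply: integrable_sum => // i _; exact: Ji.
  by apply: eq_integrable => // t _; rewrite /= sumEFin.
rewrite -JF2E.
apply: (@le_trans _ _ (\int[mu]_t ((h ^+ n)^-1 * J F t ^+ 2 +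
    h ^+ 2 * \sum_i J (G (lift ord0 i)) t))).
  have i2 : mu.-integrable setT (EFin \o (fun t => h ^+ 2 * \sum_i J (G (lift ord0 i)) t)).
    exact: (integrableZl measurableT (h ^+ 2) iS).
  apply: le_Rintegral => //.
  - exact: J_int F2w.
  - exact: (integrableD measurableT (integrableZl measurableT _ JF2_int) i2).
  - by move=> t _; rewrite mulrC; exact: slice.
rewrite RintegralD//; last 2 first.
- exact: (integrableZl measurableT _ JF2_int).
- exact: (integrableZl measurableT _ iS).
rewrite !RintegralZl// (_ : \int[mu]_t (\sum_i J (G (lift ord0 i)) t) =
    \sum_i \int[leb n.+1]_x G (lift ord0 i) x); last first.
  rewrite /Rintegral; under eq_integral do rewrite -sumEFin.
  rewrite integral_sum//.
  rewrite (eq_bigr (fun i => (\int[leb n.+1]_x G (lift ord0 i) x)%:E)) ?sumEFin//.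
  by move=> i _; exact: integral_slice_integral (Gw _).
rewrite big_ord_recl mulrDr addrA lerD2r.
apply: le_trans (ler_wpM2l _ phi2) _; first by rewrite invr_ge0 exprn_ge0// ltW.
rewrite le_eqVlt; apply/orP; left; apply/eqP.
rewrite !exprS; move: hn0; set H := h ^+ n => H0; rewrite expr0 mulr1.
by field; rewrite H0 gt_eqF.
Qed.

End poincare_cube.

(** * The space H^1_0 *)

Section H10_facts.
Context (R : realType) (n : nat) (Omega : set 'rV[R]_n).
Hypothesis oO : open Omega.
Hypothesis Ofin : (lebesgue_rV R n Omega < +oo)%E.
Implicit Types f g u v phi psi : 'rV[R]_n -> R.

Local Notation leb := (lebesgue_rV R n).

Let mO : measurable Omega. Proof. exact: open_measurable_rV. Qed.

Lemma ae_Rintegral f g : measurable_fun Omega f -> measurable_fun Omega g ->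
  f = g %[ae leb in Omega] ->
  \int[leb]_(x in Omega) f x = \int[leb]_(x in Omega) g x.
Proof.
move=> mf mg fg; rewrite /Rintegral; congr fine; apply: ae_eq_integral => //.
- exact/measurable_EFinP.
- exact/measurable_EFinP.
- by apply: filterS fg => x /[apply] ->.
Qed.

Lemma Lp2_sqr_EFin f : Lp Omega 2 f ->
  (Lp_norm Omega 2 f ^+ 2 = (\int[leb]_(x in Omega) (f x ^+ 2))%:E)%E.
Proof.
move=> f2; rewrite Lp_norm2_sqr /Rintegral fineK//.
by apply: integrable_fin_num => //; exact: Lp2_integrable_sqr.
Qed.

Lemma sqr_lin_le (a b : R) f g : Lp Omega 2 f -> Lp Omega 2 g ->
  \int[leb]_(x in Omega) ((a * f x + b * g x) ^+ 2) <=
  2 * a ^+ 2 * \int[leb]_(x in Omega) (f x ^+ 2) +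
  2 * b ^+ 2 * \int[leb]_(x in Omega) (g x ^+ 2).
Proof.
move=> f2 g2; have fi := Lp2_integrable_sqr mO f2; have gi := Lp2_integrable_sqr mO g2.
have fi' := integrableZl mO (2 * a ^+ 2) fi.
have gi' := integrableZl mO (2 * b ^+ 2) gi.
rewrite -!RintegralZl// -RintegralD//.
apply: le_Rintegral => //.
- exact: (Lp2_integrable_sqr mO (Lp2_lin mO a b f2 g2)).
- exact: (integrableD mO fi' gi').
- by move=> x _; have := sqr_ge0 (a * f x - b * g x); nra.
Qed.

Lemma sqr_sub_le f g : Lp Omega 2 f -> Lp Omega 2 g ->
  \int[leb]_(x in Omega) (f x ^+ 2) <=
  2 * \int[leb]_(x in Omega) (g x ^+ 2) + 2 * \int[leb]_(x in Omega) ((f x - g x) ^+ 2).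
Proof.
move=> f2 g2; have h2 := Lp2_lin mO 1 (-1) f2 g2.
have := sqr_lin_le 1 1 g2 h2; rewrite !expr1n !mulr1.
by congr (_ <= _ + _ * _); apply: eq_Rintegral => x _; congr (_ ^+ _); ring.
Qed.

Lemma weak_partial_Lp2 i u : H1 Omega u -> Lp Omega 2 (weak_partial Omega i u).
Proof. by move=> hu; have [] := weak_partialP i hu. Qed.

Lemma weak_partial_measurable i u : H1 Omega u ->
  measurable_fun Omega (weak_partial Omega i u).
Proof. by move=> hu; apply: Lp2_measurable; [exact: mO|exact: weak_partial_Lp2]. Qed.

Definition grad_sqr v : R :=
  \sum_(i < n) \int[leb]_(x in Omega) (weak_partial Omega i v x ^+ 2).

Lemma grad_sqr_ge0 v : 0 <= grad_sqr v.
Proof. by apply: sumr_ge0 => i _; apply: Rintegral_ge0 => x _; exact: sqr_ge0. Qed.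

Lemma H1_norm_lt u (e : R) : 0 < e -> H1 Omega u ->
  (H1_norm Omega u < e%:E)%E <->
  \int[leb]_(x in Omega) (u x ^+ 2) + grad_sqr u < e ^+ 2.
Proof.
move=> e0 hu; rewrite /H1_norm Lp2_sqr_EFin; last by case: hu.
rewrite (eq_bigr (fun i => (\int[leb]_(x in Omega) (weak_partial Omega i u x ^+ 2))%:E)); last first.
  by move=> i _; rewrite Lp2_sqr_EFin//; exact: weak_partial_Lp2.
rewrite sumEFin -EFinD poweR_EFin lte_fin -/(grad_sqr u).
set a := _ + _; have a0 : 0 <= a.
  by rewrite addr_ge0 ?grad_sqr_ge0//; apply: Rintegral_ge0 => x _; exact: sqr_ge0.
by rewrite powR12_sqrt// -[a in X in _ <-> X]sqr_sqrtr// ltr_sqr ?nnegrE ?sqrtr_ge0 ?ltW.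
Qed.

Lemma grad_sqr_sub_test v phi : H1 Omega v -> test_function Omega phi ->
  grad_sqr (fun x => v x - phi x) =
  \sum_(i < n) \int[leb]_(x in Omega) ((weak_partial Omega i v x - partial i phi x) ^+ 2).
Proof.
move=> hv t; have hp := test_function_H1 oO Ofin t.
have hl := H1_lin oO Ofin 1 (-1) hv hp.
rewrite (_ : (fun x => v x - phi x) = (fun x => 1 * v x + -1 * phi x)); last first.
  by apply/funext => x; ring.
apply: eq_bigr => i _; apply: ae_Rintegral.
- by apply: measurable_funX; exact: weak_partial_measurable.
- apply: measurable_funX; apply: measurable_funB; first exact: weak_partial_measurable.
  exact: test_function_measurable (test_function_partial i t).
- apply: filterS2 (weak_partial_lin oO Ofin i 1 (-1) hv hp) (weak_partial_test oO Ofin i t).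
  by move=> x H1 H2 Ox; rewrite H1// H2//; congr (_ ^+ _); ring.
Qed.

(** The working form of the definition: real square integrals, and classical partials of [phi] in
    place of the chosen weak derivative of a difference. *)
Lemma H10P v : H10 Omega v <-> H1 Omega v /\ forall e : R, 0 < e ->
  exists2 phi, test_function Omega phi &
    \int[leb]_(x in Omega) ((v x - phi x) ^+ 2) +
    \sum_(i < n) \int[leb]_(x in Omega) ((weak_partial Omega i v x - partial i phi x) ^+ 2) < e.
Proof.
have E phi : H1 Omega v -> test_function Omega phi -> H1 Omega (fun x => v x - phi x).
  move=> hv t; rewrite (_ : (fun x => _) = (fun x => 1 * v x + -1 * phi x)); last first.
    by apply/funext => x; ring.
  by apply: H1_lin => //; exact: test_function_H1.
split=> -[hv av]; split => // e e0.
  have se0 : 0 < Num.sqrt e by rewrite sqrtr_gt0.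
  have [phi [t]] := av _ se0; rewrite H1_norm_lt//; last exact: E.
  by rewrite grad_sqr_sub_test// sqr_sqrtr ?ltW// => ?; exists phi.
have [phi t lte] := av _ (exprn_gt0 2 e0); exists phi; split => //.
by rewrite H1_norm_lt ?grad_sqr_sub_test//; exact: E.
Qed.

Lemma H10_H1 v : H10 Omega v -> H1 Omega v. Proof. by case. Qed.

Lemma H10_Lp2 v : H10 Omega v -> Lp Omega 2 v. Proof. by case=> -[]. Qed.

Lemma test_function_H10 phi : test_function Omega phi -> H10 Omega phi.
Proof.
move=> t; have hp := test_function_H1 oO Ofin t; apply/H10P; split => // e e0.
exists phi => //; rewrite -grad_sqr_sub_test// [X in X + _](_ : _ = 0); last first.
  by rewrite /Rintegral integral0_eq// => x _; rewrite subrr expr0n.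
rewrite grad_sqr_sub_test// add0r big1// => i _.
rewrite (@ae_Rintegral _ (cst 0)).
- by rewrite Rintegral_cst// mul0r.
- apply: measurable_funX; apply: measurable_funB; first exact: weak_partial_measurable.
  exact: test_function_measurable (test_function_partial i t).
- exact: measurable_cst.
- apply: filterS (weak_partial_test oO Ofin i t) => x H Ox.
  by rewrite H// subrr expr0n.
Qed.

Lemma H10_lin (a b : R) u v : H10 Omega u -> H10 Omega v ->
  H10 Omega (fun x => a * u x + b * v x).
Proof.
move=> /H10P[hu au] /H10P[hv av]; apply/H10P; split; first exact: H1_lin.
(* Errors combine through [(a p + b q)^2 <= 2 a^2 p^2 + 2 b^2 q^2]; [K] bounds both factors and is
   positive even when [a = b = 0]. *)
move=> e e0; pose K := 2 * a ^+ 2 + 2 * b ^+ 2 + 1.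
have K0 : 0 < K by rewrite /K; have := sqr_ge0 a; have := sqr_ge0 b; lra.
have d0 : 0 < e / (2 * K) by rewrite divr_gt0// mulr_gt0.
have small A B C D : A + B < e / (2 * K) -> C + D < e / (2 * K) ->
    2 * a ^+ 2 * A + 2 * b ^+ 2 * C + (2 * a ^+ 2 * B + 2 * b ^+ 2 * D) < e.
  have : K * (e / (2 * K)) = e / 2 by field; rewrite gt_eqF.
  move: d0; set d := e / _; rewrite /K.
  have := sqr_ge0 a; have := sqr_ge0 b; move: (a ^+ 2) (b ^+ 2) => p q q0 p0 d0 Ee ltA ltC.
  have := ler_wpM2l p0 (ltW ltA); have := ler_wpM2l q0 (ltW ltC); nra.
have [phi tp ltp] := au _ d0; have [psi tq ltq] := av _ d0.
have tl := test_function_lin a b tp tq.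
exists (fun x => a * phi x + b * psi x) => //.
have Lsub f g : Lp Omega 2 f -> Lp Omega 2 g -> Lp Omega 2 (fun x => f x - g x).
  move=> f2 g2; rewrite (_ : (fun x => _) = (fun x => 1 * f x + -1 * g x)).
    exact: Lp2_lin.
  by apply/funext => x; ring.
have u2 : Lp Omega 2 (fun x => u x - phi x).
  by apply: Lsub; [case: hu|exact: test_function_Lp2].
have v2 : Lp Omega 2 (fun x => v x - psi x).
  by apply: Lsub; [case: hv|exact: test_function_Lp2].
have ui2 i : Lp Omega 2 (fun x => weak_partial Omega i u x - partial i phi x).
  apply: Lsub; first exact: weak_partial_Lp2.
  by apply: test_function_Lp2 => //; exact: test_function_partial.
have vi2 i : Lp Omega 2 (fun x => weak_partial Omega i v x - partial i psi x).
  apply: Lsub; first exact: weak_partial_Lp2.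
  by apply: test_function_Lp2 => //; exact: test_function_partial.
have E0 := sqr_lin_le a b u2 v2.
have Ei i := sqr_lin_le a b (ui2 i) (vi2 i).
rewrite [X in X + _](_ : _ = \int[leb]_(x in Omega)
    ((a * (u x - phi x) + b * (v x - psi x)) ^+ 2)); last first.
  by apply: eq_Rintegral => x _; congr (_ ^+ _); ring.
rewrite (eq_bigr (fun i => \int[leb]_(x in Omega)
    ((a * (weak_partial Omega i u x - partial i phi x) +
      b * (weak_partial Omega i v x - partial i psi x)) ^+ 2))); last first.
  move=> i _; apply: ae_Rintegral.
  - apply: measurable_funX; apply: measurable_funB.
      by apply: weak_partial_measurable; exact: H1_lin.
    exact: test_function_measurable (test_function_partial i tl).
  - by apply: measurable_funX; exact: Lp2_measurable (Lp2_lin mO a b (ui2 i) (vi2 i)).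
  - apply: filterS (weak_partial_lin oO Ofin i a b hu hv) => x H Ox.
    rewrite H// (_ : partial i _ x = a * partial i phi x + b * partial i psi x).
      by congr (_ ^+ _); ring.
    have [_ dp _] : C1dir i phi by case: tp => /smooth_C1dir.
    have [_ dq _] : C1dir i psi by case: tq => /smooth_C1dir.
    by rewrite partialD ?partialZ//; exact: derivableZ.
have sumE (F G H : 'I_n -> R) (p q : R) : (forall i, F i <= p * G i + q * H i) ->
    \sum_i F i <= p * \sum_i G i + q * \sum_i H i.
  by move=> FGH; rewrite !mulr_sumr -big_split; exact: ler_sum.
exact: le_lt_trans (lerD E0 (sumE _ _ _ _ _ Ei)) (small _ _ _ _ ltp ltq).
Qed.

End H10_facts.

(** * The Poincare inequality on one cube for continuously differentiable functions *)

Section poincare_test.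
Context (R : realType).
Local Notation mu := (@lebesgue_measure R).
Local Notation leb n := (lebesgue_rV R n).

(** The fundamental theorem of calculus and Cauchy-Schwarz between [s] and [t], whose distance is at
    most [h]. *)
Lemma line_oscillation (g g' : R -> R) (a h s t : R) :
  (forall r, is_derive r (1 : R) g (g' r)) -> continuous g' ->
  a <= s < a + h -> a <= t < a + h ->
  (((g s - g t) ^+ 2)%:E <= h%:E * \int[mu]_(r in `[a, (a + h)%R[) (g' r ^+ 2)%:E)%E.
Proof.
move=> Dg cg'; wlog st : s t / s < t => [W sI tI|].
  have [ts|st|->] := ltgtP t s; [|exact: W|].
    by rewrite -sqrrN opprB; exact: W.
  rewrite subrr expr0n; apply: mule_ge0.
    by rewrite lee_fin; move/andP: sI => [h1 h2]; lra.
  by apply: integral_ge0 => r _; rewrite lee_fin sqr_ge0.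
move=> /andP[as_ sb] /andP[a_t tb].
have h0 : 0 < h by lra.
pose E : set R := `[s, t]%classic.
have mE : measurable E by exact: measurable_itv.
have muE : mu E = (t - s)%:E.
  by rewrite [LHS](lebesgue_measure_itv `[s, t]) /= lte_fin st -EFinB.
have gi : mu.-integrable E (EFin \o g').
  apply: continuous_compact_integrable; first exact: segment_compact.
  exact: continuous_subspaceT.
have g2c : continuous (fun r => g' r ^+ 2).
  by move=> r; rewrite (_ : (fun _ => _) = (fun r => g' r * g' r))//; apply: cvgM; exact: cg'.
have g2i : mu.-integrable E (EFin \o (fun r => g' r ^+ 2)).
  apply: continuous_compact_integrable; first exact: segment_compact.
  exact: continuous_subspaceT.
have ts0 : t - s != 0 by rewrite subr_eq0 gt_eqF.
have := @sqr_integral_le _ _ R mu E _ g' mE muE ts0 gi g2i.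
rewrite {1}/Rintegral (FTC_segment (ltW st) Dg cg') /= -lee_fin -sqrrN opprB.
move=> /le_trans; apply; rewrite EFinM.
apply: lee_pmul.
- by rewrite lee_fin subr_ge0 ltW.
- by rewrite lee_fin; apply: Rintegral_ge0 => r _; exact: sqr_ge0.
- by rewrite lee_fin; lra.
rewrite /Rintegral fineK; last exact: integrable_fin_num.
apply: ge0_subset_integral => //.
- by apply/measurable_EFinP; apply: measurable_funTS; exact: continuous_measurable_fun.
- by move=> r _; rewrite lee_fin sqr_ge0.
- rewrite /E => r /=; rewrite !in_itv /= => /andP[h1 h2]; apply/andP; split; lra.
Qed.

Lemma poincare_C1_cube n K (phi : 'rV[R]_n -> R) (a : 'I_n -> R) h : 0 < h ->
  (forall i, C1dir i phi) -> continuous phi -> supported K phi ->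
  \int[leb n]_(x in cube a h) (phi x ^+ 2) <=
  (\int[leb n]_(x in cube a h) phi x) ^+ 2 / h ^+ n +
  h ^+ 2 * \sum_i \int[leb n]_(x in cube a h) (partial i phi x ^+ 2).
Proof.
move=> h0 C cphi sphi; set Q := cube a h.
have mQ : measurable Q by exact: measurable_box.
have muQ : leb n Q = (h ^+ n)%:E by rewrite lebesgue_cube// ltW.
have hn0 : h ^+ n != 0 by rewrite expf_neq0// gt_eqF.
have [M M0 phiM] := supported_continuous_bounded cphi sphi.
have /choice[Mi HMi] : forall i : 'I_n, exists m, forall x, `|partial i phi x| <= m.
  move=> i; have [_ _ ci] := C i.
  by have [m _ Hm] := supported_continuous_bounded ci (@supported_partial _ _ _ i _ sphi); exists m.
pose S := \sum_i `|Mi i|; pose B := 2 * M + S ^+ 2.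
have MiS i : `|Mi i| <= S by rewrite /S (bigD1 i)//= lerDl sumr_ge0.
(* Large enough for the whole cube to fit in the box of half-side [L]. *)
pose L := h + \sum_i `|a i| + 1.
have QL x : Q x -> forall i, - L < x ord0 i < L.
  move=> Qx i; have /andP[h1 h2] := Qx i.
  have : `|a i| <= \sum_i `|a i| by rewrite [leRHS](bigD1 i)//= lerDl sumr_ge0.
  have := ler_norm (a i); have := ler_norm (- a i); rewrite normrN /L => *.
  by apply/andP; split; lra.
(* [poincare_cube] is about nonnegative functions, hence the shift by the bound [M]. It changes both
   sides by the same [2 M A + M^2 h^n], where [A] is the integral of [phi] over the cube. *)
pose F := (fun x => phi x + M) \_ Q.
pose G i := (fun x => partial i phi x ^+ 2) \_ Q.
have cadd : continuous (fun x => phi x + M).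
  exact: (@CkD R n 0%N phi (fun=> M) cphi (@Ck_cst R n 0%N M)).
have S0 : 0 <= S by exact: sumr_ge0.
have Fw : bounded_weight L B F.
  split => [|x|x].
  - apply: (measurable_restrictT _ mQ).1; apply: measurable_funTS.
    exact: continuous_measurable_rV.
  - rewrite /F /patch; case: ifP => _; last by rewrite lexx /= /B addr_ge0 ?sqr_ge0 ?mulr_ge0 ?ltW.
    have := phiM x; rewrite ler_norml => /andP[h1 h2]; have := sqr_ge0 S; rewrite /B => *.
    by apply/andP; split; lra.
  - by rewrite /F /patch; case: ifP => [xQ _|]; [apply: QL; rewrite inE in xQ|rewrite eqxx].
have mpar i : measurable_fun setT (partial i phi).
  by have [_ _ ci] := C i; exact: continuous_measurable_rV.
have Gw i : bounded_weight L B (G i).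
  split => [|x|x].
  - apply: (measurable_restrictT _ mQ).1; apply: measurable_funTS.
    exact: measurable_funX.
  - rewrite /G /patch; case: ifP => _; last by rewrite lexx /= /B addr_ge0 ?sqr_ge0 ?mulr_ge0 ?ltW.
    rewrite sqr_ge0 /= -(real_normK (num_real (partial i phi x))) /B.
    have : `|partial i phi x| ^+ 2 <= S ^+ 2.
      rewrite ler_sqr ?nnegrE//; apply: le_trans (HMi i x) _.
      exact: le_trans (ler_norm _) (MiS i).
    by lra.
  - by rewrite /G /patch; case: ifP => [xQ _|]; [apply: QL; rewrite inE in xQ|rewrite eqxx].
have FQ x : ~ Q x -> F x = 0 by move=> nQ; rewrite /F patchN ?notin_setE.
have GQ i x : ~ Q x -> G i x = 0 by move=> nQ; rewrite /G patchN ?notin_setE.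
have := poincare_cube h0 Fw Gw FQ GQ.
have -> : \int[leb n]_x F x = \int[leb n]_(x in Q) (phi x + M).
  by rewrite [RHS]Rintegral_mkcond.
have -> : \int[leb n]_x (F x ^+ 2) = \int[leb n]_(x in Q) ((phi x + M) ^+ 2).
  rewrite [RHS]Rintegral_mkcond; apply: eq_Rintegral => x _.
  by rewrite /F /patch; case: ifP => // _; rewrite expr0n.
have -> : \sum_i \int[leb n]_x G i x =
    \sum_i \int[leb n]_(x in Q) (partial i phi x ^+ 2).
  by apply: eq_bigr => i _; rewrite [RHS]Rintegral_mkcond.
have phi_i : (leb n).-integrable Q (EFin \o phi).
  by apply: integrableS (supported_integrable cphi sphi).
have phi2_i : (leb n).-integrable Q (EFin \o (fun x => phi x ^+ 2)).
  apply: measurable_bounded_integrable => //; first by rewrite muQ ltry.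
    by apply: measurable_funX; apply: measurable_funTS; exact: continuous_measurable_rV.
  exists (M ^+ 2); split => [|k Mk x _ /=]; first exact: num_real.
  by apply: le_trans (ltW Mk); rewrite normrX ler_sqr ?nnegrE// ltW.
have cst_i (c : R) : (leb n).-integrable Q (EFin \o (fun=> c)).
  apply: measurable_bounded_integrable => //; first by rewrite muQ ltry.
  by exists `|c|; split => [|k Mk x _ /=]; rewrite ?num_real// ltW.
have -> : \int[leb n]_(x in Q) (phi x + M) = \int[leb n]_(x in Q) phi x + M * h ^+ n.
  by rewrite RintegralD// Rintegral_cst// muQ.
have -> : \int[leb n]_(x in Q) ((phi x + M) ^+ 2) =
    \int[leb n]_(x in Q) (phi x ^+ 2) + (2 * M) * \int[leb n]_(x in Q) phi x + M ^+ 2 * h ^+ n.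
  rewrite (_ : \int[leb n]_(x in Q) _ =
      \int[leb n]_(x in Q) (phi x ^+ 2 + ((2 * M) * phi x + M ^+ 2))); last first.
    by apply: eq_Rintegral => x _; ring.
  have Mphi := integrableZl mQ (2 * M) phi_i.
  rewrite RintegralD//; last exact: (integrableD mQ Mphi (cst_i _)).
  by rewrite RintegralD// RintegralZl// Rintegral_cst// muQ /= addrA.
set A := \int[leb n]_(x in Q) phi x; set A2 := \int[leb n]_(x in Q) (phi x ^+ 2).
set D := h ^+ 2 * _; move=> P.
have -> : A ^+ 2 / h ^+ n + D =
    (A + M * h ^+ n) ^+ 2 / h ^+ n + D - ((2 * M) * A + M ^+ 2 * h ^+ n).
  by move: hn0; move: (h ^+ n) => H H0; field.
rewrite lerBrDr addrA; apply: P => i x s Qx sI.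
have line t : set_coord i t x = x + (t - x ord0 i) *: delta_mx 0 i by exact: set_coord_line.
have Qset t : Q (set_coord i t x) <-> a i <= t < a i + h.
  split=> [/(_ i)|tI j]; first by rewrite mxE eqxx.
  by rewrite mxE; case: eqP => [->//|_]; exact: Qx.
pose g t := phi (set_coord i t x); pose g' t := partial i phi (set_coord i t x).
have Dg r : is_derive r (1 : R) g (g' r).
  pose k (t : R) := t - x ord0 i.
  have Dk : is_derive r (1 : R) k 1.
    rewrite -[X in is_derive _ _ _ X]subr0.
    exact: (is_deriveB (is_derive_id r (1 : R)) (is_derive_cst (x ord0 i) r (1 : R))).
  have := is_derive_partial x (r - x ord0 i) (C i) => Dp.
  have := @is_derive_comp R (fun r => phi (x + r *: delta_mx 0 i)) k r _ _ Dk Dp.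
  rewrite mulr1 /g' line.
  by congr is_derive; apply/funext => t; rewrite /g /= line.
have cg' : continuous g'.
  have [_ _ ci] := C i => t.
  rewrite (_ : g' = (fun r => partial i phi (x + r *: delta_mx 0 i)) \o (fun t => t - x ord0 i)).
    apply: continuous_comp; last exact: continuous_along.
    by apply: cvgB; [exact: cvg_id|exact: cvg_cst].
  by apply/funext => r; rewrite /g' /= line.
have xi : a i <= x ord0 i < a i + h by exact: Qx.
have -> : F x - F (set_coord i s x) = g (x ord0 i) - g s.
  rewrite /F !patchT ?inE//; last exact/Qset.
  by rewrite /g set_coord_id; ring.
have -> : (\int[mu]_t (G i (set_coord i t x))%:E =
    \int[mu]_(t in `[a i, (a i + h)%R[) (g' t ^+ 2)%:E)%E.
  rewrite [RHS]integral_mkcond; apply: eq_integral => t _.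
  rewrite /G /patch !mem_setE /= in_itv /=.
  by rewrite (_ : set_coord i t x \in Q = (a i <= t < a i + h)); [case: ifP|apply/idP/idP; rewrite inE => /Qset].
exact: line_oscillation.
Qed.

End poincare_test.

Section finite_sums.
Context d (T : measurableType d) (R : realType) (m : {measure set T -> \bar R}).

Lemma integrable_sumR (I : Type) (s : seq I) (D : set T) (F : I -> T -> R) : measurable D ->
  (forall i, m.-integrable D (EFin \o F i)) ->
  m.-integrable D (EFin \o (fun x => \sum_(i <- s) F i x)).
Proof.
move=> mD Fi; have : m.-integrable D (fun x => \sum_(i <- s) (F i x)%:E)%E.
  by apply: integrable_sum => // i _; exact: Fi.
by apply: eq_integrable => // x _; rewrite /= sumEFin.
Qed.

Lemma Rintegral_sum (I : Type) (s : seq I) (D : set T) (F : I -> T -> R) : measurable D ->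
  (forall i, m.-integrable D (EFin \o F i)) ->
  \int[m]_(x in D) (\sum_(i <- s) F i x) = \sum_(i <- s) \int[m]_(x in D) F i x.
Proof.
move=> mD Fi; elim: s => [|i s IH].
  rewrite big_nil (_ : \int[m]_(x in D) _ = \int[m]_(x in D) (cst 0 x)).
    by rewrite Rintegral_cst// mul0r.
  by apply: eq_Rintegral => x _; rewrite big_nil.
rewrite big_cons -IH -RintegralD//; last exact: integrable_sumR.
by apply: eq_Rintegral => x _; rewrite big_cons.
Qed.

(** Extends the estimate to null sets [E], where both sides are 0. *)
Lemma sqr_integral_le_fin (E : set T) (g : T -> R) : measurable E -> (m E < +oo)%E ->
  m.-integrable E (EFin \o g) -> m.-integrable E (EFin \o (fun x => g x ^+ 2)) ->
  (\int[m]_(x in E) g x) ^+ 2 <= fine (m E) * \int[m]_(x in E) (g x ^+ 2).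
Proof.
move=> mE Efin gi g2i.
have vE : m E = (fine (m E))%:E by rewrite fineK// ge0_fin_numE.
have [v0|v0] := eqVneq (fine (m E)) 0; last exact: sqr_integral_le.
rewrite v0 mul0r /Rintegral null_set_integral ?expr0n//.
- by apply/measurable_EFinP; move/measurable_int: gi => /measurable_EFinP.
- by rewrite vE v0.
Qed.

End finite_sums.

(** * Partition of a box into congruent cubes *)

Section grid.
Context (R : realType).

Lemma ler_sum_exchange (I J : finType) (A a : J -> R) (b : I -> J -> R) p q :
  (forall j, A j <= a j / p + q * \sum_i b i j) ->
  \sum_j A j <= (\sum_j a j) / p + q * \sum_i \sum_j b i j.
Proof.
by move=> H; rewrite exchange_big mulr_suml mulr_sumr -big_split; exact: ler_sum.
Qed.

Lemma sum_intervals (c h t : R) m : 0 < h ->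
  \sum_(k < m) (nat_of_bool (c + k%:R * h <= t < c + k%:R * h + h)%R)%:R =
  (nat_of_bool (c <= t < c + m%:R * h)%R)%:R :> R.
Proof.
move=> h0; elim: m => [|m IH].
  by rewrite big_ord0 mul0r addr0; case: (leP c t).
rewrite big_ord_recr /= IH -addrA -[X in c + (_ + X)]mul1r -mulrDl natr1.
have m0 : 0 <= m%:R * h by rewrite mulr_ge0// ltW.
have mS : m.+1%:R * h = m%:R * h + h by rewrite -natr1 mulrDl mul1r.
rewrite mS.
by case: (leP c t); case: (leP (c + m%:R * h) t); case: (ltP t (c + m%:R * h));
  case: (ltP t (c + (m%:R * h + h))) => //= *; rewrite ?addr0 ?add0r//; exfalso; lra.
Qed.

Definition grid_cube n N (L : R) (j : {ffun 'I_n -> 'I_N}) : set 'rV[R]_n :=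
  cube (fun i => - L + (j i)%:R * (2 * L / N%:R)) (2 * L / N%:R).

(** The indicator of a cube is a product of interval indicators, so the sum over the grid factors
    into one-dimensional sums, each equal to 1. *)
Lemma sum_grid n N (L : R) (x : 'rV[R]_n) : 0 < L -> (0 < N)%N ->
  box (fun=> - L) (fun=> L) x ->
  \sum_(j : {ffun 'I_n -> 'I_N}) \1_(grid_cube L j) x = 1 :> R.
Proof.
move=> L0 N0 xL; set h := 2 * L / N%:R.
have h0 : 0 < h by rewrite divr_gt0 ?ltr0n// mulr_gt0.
pose F (i : 'I_n) (k : 'I_N) : R :=
  (nat_of_bool (- L + k%:R * h <= x ord0 i < - L + k%:R * h + h)%R)%:R.
rewrite (eq_bigr (fun j : {ffun 'I_n -> 'I_N} => \prod_i F i (j i))) => [|j _].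
  rewrite -bigA_distr_bigA big1// => i _.
  rewrite sum_intervals// (_ : N%:R * h = 2 * L).
    by have := xL i; rewrite (_ : - L + 2 * L = L) => [->//|]; ring.
  by rewrite /h mulrC divfK// pnatr_eq0 -lt0n.
rewrite indicE; have [xj|xj] := boolP (x \in grid_cube L j).
  by rewrite big1// => i _; rewrite /F; rewrite inE in xj; rewrite (xj i).
rewrite notin_setE in xj; have /existsNP[i xi] := xj.
by rewrite (bigD1 i)//= {1}/F (negbTE (introN idP xi)) mul0r.
Qed.

End grid.

(** * The Poincare inequality on H^1_0 under finitely many mean conditions *)

Section poincare_grid.
Context (R : realType) (n : nat) (Omega : set 'rV[R]_n).
Hypothesis oO : open Omega.
Hypothesis Ofin : (lebesgue_rV R n Omega < +oo)%E.
Local Notation leb := (lebesgue_rV R n).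

Let mO : measurable Omega. Proof. exact: open_measurable_rV. Qed.

Lemma indic_mul_Lp2 (Q : set 'rV[R]_n) f : measurable Q -> Lp Omega 2 f ->
  Lp Omega 2 (fun x => \1_Q x * f x).
Proof.
move=> mQ f2; apply/Lp2P; first exact: mO.
have mQf : measurable_fun Omega (fun x => \1_Q x * f x).
  apply: measurable_funM; first exact: measurable_funTS.
  exact: Lp2_measurable f2.
split => //; have /Lp2P[//|_] := f2; apply: le_lt_trans.
apply: ge0_le_integral => //.
- by move=> x _; rewrite lee_fin sqr_ge0.
- by apply/measurable_EFinP; exact: measurable_funX.
- by apply/measurable_EFinP; apply: measurable_funX; exact: Lp2_measurable f2.
- move=> x _; rewrite lee_fin exprMn indicE.
  by case: (x \in Q); rewrite ?expr1n ?mul1r// expr0n mul0r sqr_ge0.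
Qed.

Lemma poincare_grid_test (L : R) N phi : 0 < L -> (0 < N)%N ->
  Omega `<=` box (fun=> - L) (fun=> L) -> test_function Omega phi ->
  \int[leb]_(x in Omega) (phi x ^+ 2) <=
  (\sum_(j : {ffun 'I_n -> 'I_N}) (\int[leb]_(x in Omega) (\1_(grid_cube L j) x * phi x)) ^+ 2) /
    (2 * L / N%:R) ^+ n +
  (2 * L / N%:R) ^+ 2 * \sum_i \int[leb]_(x in Omega) (partial i phi x ^+ 2).
Proof.
move=> L0 N0 OL t; set h := 2 * L / N%:R.
have h0 : 0 < h by rewrite divr_gt0 ?ltr0n// mulr_gt0.
have mQ (j : {ffun 'I_n -> 'I_N}) : measurable (grid_cube L j) by exact: measurable_box.
have loc (Q : set 'rV[R]_n) f : (forall x, ~ Omega x -> f x = 0) ->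
    \int[leb]_(x in Q) f x = \int[leb]_(x in Omega) (\1_Q x * f x).
  move=> f0; rewrite Rintegral_mkcond [RHS]Rintegral_mkcond; apply: eq_Rintegral => x _.
  rewrite /patch indicE; case: (boolP (x \in Omega)) => xO; first by case: ifP; rewrite ?mul1r ?mul0r.
  by rewrite notin_setE in xO; rewrite f0//; case: ifP.
have split_grid f : leb.-integrable Omega (EFin \o f) ->
    \int[leb]_(x in Omega) f x =
    \sum_(j : {ffun 'I_n -> 'I_N}) \int[leb]_(x in Omega) (\1_(grid_cube L j) x * f x).
  move=> fi; rewrite -Rintegral_sum//.
    by apply: eq_Rintegral => x; rewrite inE => Ox; rewrite -mulr_suml sum_grid ?mul1r//; exact: OL.
  move=> j; apply: (le_integrable mO _ _ fi).
    apply/measurable_EFinP; apply: measurable_funM; first exact: measurable_funTS.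
    by apply/measurable_EFinP; exact: measurable_int fi.
  move=> x _ /=; rewrite lee_fin normrM indicE.
  by case: (x \in _); rewrite ?normr1 ?mul1r// normr0 mul0r.
have tp i := test_function_partial i t.
have sqi f : test_function Omega f -> leb.-integrable Omega (EFin \o (fun x => f x ^+ 2)).
  by move=> tf; apply: Lp2_integrable_sqr => //; exact: test_function_Lp2.
rewrite (split_grid (fun x => phi x ^+ 2))//; last exact: sqi.
rewrite (eq_bigr (fun i => \sum_(j : {ffun 'I_n -> 'I_N})
    \int[leb]_(x in Omega) (\1_(grid_cube L j) x * (partial i phi x ^+ 2)))); last first.
  by move=> i _; rewrite (split_grid (fun x => partial i phi x ^+ 2))//; exact: sqi.
apply: ler_sum_exchange => j.
have [K _ sphi] := test_function_bounded_support t.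
have C i : C1dir i phi by case: t => /smooth_C1dir.
have := @poincare_C1_cube R n K phi (fun i => - L + (j i)%:R * h) h h0 C (test_function_continuous t) sphi.
rewrite -[cube _ h]/(grid_cube L j) (loc _ phi); last first.
  by move=> x nx; exact: test_function_eq0 t nx.
rewrite (loc _ (fun x => phi x ^+ 2)); last first.
  by move=> x nx; rewrite (test_function_eq0 t nx) expr0n.
move=> /le_trans; apply; rewrite lerD2l ler_wpM2l ?sqr_ge0//.
apply: ler_sum => i _; rewrite (loc _ (fun x => partial i phi x ^+ 2))// => x nx.
by rewrite (test_function_eq0 (tp i) nx) expr0n.
Qed.

(** The estimate for a test function near [v], up to an error that tends to 0; passing from [v] to
    [phi] and from the partials back to weak ones costs a factor 2 each, whence the 4. *)
Lemma poincare_grid_H10 (L : R) N v : 0 < L -> (0 < N)%N ->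
  Omega `<=` box (fun=> - L) (fun=> L) -> H10 Omega v ->
  (forall j : {ffun 'I_n -> 'I_N},
    \int[leb]_(x in Omega) (\1_(grid_cube L j) x * v x) = 0) ->
  \int[leb]_(x in Omega) (v x ^+ 2) <= 4 * (2 * L / N%:R) ^+ 2 * grad_sqr Omega v.
Proof.
move=> L0 N0 OL vH v0; set h := 2 * L / N%:R.
have h0 : 0 < h by rewrite divr_gt0 ?ltr0n// mulr_gt0.
have /(H10P oO Ofin)[hv av] := vH.
have v2 : Lp Omega 2 v by case: hv.
pose m : R := fine (leb Omega).
pose J := #|{ffun 'I_n -> 'I_N}|.
have m0 : 0 <= m by rewrite fine_ge0.
(* Collects the coefficients of [D] and [Ds], the approximation errors, in the final estimate. *)
pose C := 2 * (J%:R * m / h ^+ n) + 4 * h ^+ 2 + 2.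
have Jm0 : 0 <= J%:R * m / h ^+ n by rewrite divr_ge0 ?mulr_ge0// exprn_ge0// ltW.
have C0 : 0 < C by rewrite /C; have := sqr_ge0 h; lra.
apply/ler_addgt0Pr => e e0; have d0 : 0 < e / C by rewrite divr_gt0.
have [phi t] := av _ d0; set D := \int[leb]_(x in Omega) _; set Ds := \sum_i _ => De.
have p2 := test_function_Lp2 oO Ofin t.
have A_le := sqr_sub_le oO v2 p2.
have B_le := poincare_grid_test L0 N0 OL t.
have w2 := Lp2_lin mO (-1) 1 v2 p2.
have D0 : 0 <= D by apply: Rintegral_ge0 => x _; exact: sqr_ge0.
have Ds0 : 0 <= Ds.
  by apply: sumr_ge0 => i _; apply: Rintegral_ge0 => x _; exact: sqr_ge0.
(* The integral of [v] over the cube is 0, so that of [phi] is that of [phi - v], small by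
   Cauchy-Schwarz. *)
have l_le (j : {ffun 'I_n -> 'I_N}) :
    (\int[leb]_(x in Omega) (\1_(grid_cube L j) x * phi x)) ^+ 2 <= m * D.
  have mQ : measurable (grid_cube L j) by exact: measurable_box.
  have g2 := indic_mul_Lp2 mQ w2.
  have vQ := indic_mul_Lp2 mQ v2; have pQ := indic_mul_Lp2 mQ p2.
  have -> : \int[leb]_(x in Omega) (\1_(grid_cube L j) x * phi x) =
      \int[leb]_(x in Omega) (\1_(grid_cube L j) x * (-1 * v x + 1 * phi x)).
    have vi := Lp2_integrable mO Ofin vQ; have pi := Lp2_integrable mO Ofin pQ.
    rewrite -[LHS]subr0 -(v0 j) -RintegralB//.
    by apply: eq_Rintegral => x _; ring.
  apply: le_trans (sqr_integral_le_fin mO Ofin (Lp2_integrable mO Ofin g2)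
    (Lp2_integrable_sqr mO g2)) _.
  rewrite ler_wpM2l//; apply: le_Rintegral => //.
  - exact: Lp2_integrable_sqr.
  - have := Lp2_integrable_sqr mO w2; apply: eq_integrable => // x _.
    by congr (_%:E); ring.
  move=> x _; rewrite exprMn indicE (_ : -1 * v x + 1 * phi x = - (v x - phi x)); last by ring.
  by rewrite sqrrN; case: (x \in _); rewrite ?expr1n ?mul1r// expr0n mul0r sqr_ge0.
have S_le : (\sum_(j : {ffun 'I_n -> 'I_N})
    (\int[leb]_(x in Omega) (\1_(grid_cube L j) x * phi x)) ^+ 2) / h ^+ n <=
    J%:R * m / h ^+ n * D.
  rewrite mulrAC ler_wpM2r ?invr_ge0 ?exprn_ge0 ?(ltW h0)//.
  apply: le_trans (ler_sum _ (fun j _ => l_le j)) _.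
  by rewrite sumr_const -/J -mulrA mulr_natl.
have G_le : \sum_i \int[leb]_(x in Omega) (partial i phi x ^+ 2) <=
    2 * grad_sqr Omega v + 2 * Ds.
  rewrite !mulr_sumr -big_split; apply: ler_sum => i _ /=.
  have wi2 := weak_partial_Lp2 i hv.
  have pi2 := test_function_Lp2 oO Ofin (test_function_partial i t).
  have := sqr_sub_le oO pi2 wi2.
  have -> : \int[leb]_(x in Omega) ((partial i phi x - weak_partial Omega i v x) ^+ 2) =
      \int[leb]_(x in Omega) ((weak_partial Omega i v x - partial i phi x) ^+ 2).
    by apply: eq_Rintegral => x _; rewrite -sqrrN opprB.
  by [].
have hG := ler_wpM2l (sqr_ge0 h) G_le.
have Ce : C * (D + Ds) <= e.
  by rewrite mulrC -ler_pdivlMr// ltW.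
have : 0 <= J%:R * m / h ^+ n * Ds by exact: mulr_ge0.
have : 0 <= h ^+ 2 * D by rewrite mulr_ge0// sqr_ge0.
move: A_le B_le S_le hG Ce; rewrite -/D -/h /C.
move: (\int[leb]_(x in Omega) (v x ^+ 2)) (\int[leb]_(x in Omega) (phi x ^+ 2)) => A B.
move: (_ / h ^+ n) (\sum_i \int[leb]_(x in Omega) (partial i phi x ^+ 2)) => S P.
move: (J%:R * m / h ^+ n) (grad_sqr Omega v) (h ^+ 2) => Q G H; lra.
Qed.

(** The substitute for compactness: finitely many linear conditions make the L^2 norm as small as
    desired against the Dirichlet energy. The number of cubes is chosen so that
    [4 (2L/N)^2 = (4L/N)^2 <= e]. *)
Lemma poincare_finite_codim (L : R) (e : R) : 0 < L -> 0 < e ->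
  Omega `<=` box (fun=> - L) (fun=> L) ->
  exists (J : finType) (Q : J -> set 'rV[R]_n), (forall j, measurable (Q j)) /\
    forall v, H10 Omega v ->
      (forall j, \int[leb]_(x in Omega) (\1_(Q j) x * v x) = 0) ->
      \int[leb]_(x in Omega) (v x ^+ 2) <= e * grad_sqr Omega v.
Proof.
move=> L0 e0 OL; pose s := Num.sqrt e; have s0 : 0 < s by rewrite sqrtr_gt0.
pose N := (Num.truncn (4 * L / s)).+1.
exists {ffun 'I_n -> 'I_N}, (grid_cube L); split => [j|v vH v0].
  exact: measurable_box.
apply: le_trans (poincare_grid_H10 L0 (ltn0Sn _) OL vH v0) _.
rewrite ler_wpM2r ?grad_sqr_ge0//.
have : 4 * L / N%:R <= s.
  rewrite ler_pdivrMr ?ltr0n// [s * _]mulrC -ler_pdivrMr//.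
  by apply: ltW; exact: truncnS_gt.
move=> H; apply: (@le_trans _ _ (s ^+ 2)); last by rewrite sqr_sqrtr// ltW.
rewrite (_ : 4 * _ = (4 * L / N%:R) ^+ 2); last by ring.
by rewrite ler_sqr ?nnegrE ?(ltW s0)// divr_ge0 ?mulr_ge0 ?ler0n ?(ltW L0).
Qed.

End poincare_grid.

(** * Almost everywhere limits under integral bounds *)

Section fatou_ae.
Context d (T : measurableType d) (R : realType) (m : {measure set T -> \bar R}).
Variables (D : set T) (mD : measurable D).
Local Open Scope ereal_scope.

(** The integrals of the squares are summable, so the series of squares is a.e. finite and its terms
    tend to 0. *)
Lemma ae_cvg0_sqr (f : nat -> T -> R) : (forall k, measurable_fun D (f k)) ->
  (forall k, \int[m]_(x in D) (f k x ^+ 2)%:E <= (1 / (2 ^ k.+1)%:R)%:E) ->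
  {ae m, forall x, D x -> f ^~ x @ \oo --> (0 : R)%R}.
Proof.
move=> mf fle.
have mf2 k : measurable_fun D (fun x => (f k x ^+ 2)%:E).
  by apply/measurable_EFinP; exact: measurable_funX.
pose g x := \sum_(k <oo) (f k x ^+ 2)%:E.
have g0 x : 0 <= g x by apply: nneseries_ge0 => k _ _; rewrite lee_fin sqr_ge0.
have gi : m.-integrable D g.
  apply/integrableP; split.
    by apply: ge0_emeasurable_sum => // k x _ _; rewrite lee_fin sqr_ge0.
  under eq_integral do rewrite gee0_abs//.
  rewrite integral_nneseries//; last by move=> k x _; rewrite lee_fin sqr_ge0.
  apply: (@le_lt_trans _ _ 1); last by rewrite ltry.
  apply: le_trans (epsilon_trick0 xpredT (@ler01 R)).
  apply: lee_nneseries => [k _ _|k _]; last exact: fle.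
  by apply: integral_ge0 => x _; rewrite lee_fin sqr_ge0.
apply: filterS (integrable_ae mD gi) => x Hx Dx; have gx := Hx Dx.
have tail := @nneseries_tail_cvg R (fun k => (f k x ^+ 2)%:E) xpredT.
have {}tail : \sum_(N <= k <oo) (f k x ^+ 2)%:E @[N --> \oo] --> 0.
  by apply: tail => [|k _]; [rewrite ltey_eq gx|rewrite lee_fin sqr_ge0].
have sq0 : (f k x ^+ 2)%:E @[k --> \oo] --> 0.
  apply: squeeze_cvge tail; [|exact: (cvg_cst 0)]; apply: nearW => k.
  rewrite lee_fin sqr_ge0 /=.
  have := @nneseries_lim_ge R (fun k => (f k x ^+ 2)%:E) xpredT k k.+1.
  by rewrite big_nat1; apply=> j _ _; rewrite lee_fin sqr_ge0.
apply/cvgrPdist_lt => e e0; have /fine_cvgP[_ /cvgrPdist_lt/(_ _ (exprn_gt0 2 e0))] := sq0.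
apply: filterS => k /=; rewrite !sub0r !normrN normrX.
by rewrite ltr_sqr ?nnegrE// ltW.
Qed.

Lemma fatou_ae (F : nat -> T -> R) (G : T -> R) (B : R) :
  (forall k, measurable_fun D (F k)) -> measurable_fun D G ->
  (forall k x, D x -> (0 <= F k x)%R) ->
  (forall k, \int[m]_(x in D) (F k x)%:E <= B%:E) ->
  {ae m, forall x, D x -> F ^~ x @ \oo --> G x} ->
  \int[m]_(x in D) (G x)%:E <= B%:E.
Proof.
move=> mF mG F0 FB FG.
have mE k : measurable_fun D (EFin \o F k) by exact/measurable_EFinP.
have := @fatou _ _ _ m D mD (fun k => EFin \o F k) mE.
have F0' k x : D x -> 0 <= (EFin \o F k) x by move=> Dx; rewrite lee_fin F0.
move=> /(_ F0').
rewrite (_ : \int[m]_(x in D) limn_einf _ = \int[m]_(x in D) (G x)%:E).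
  move=> /le_trans; apply; rewrite limn_einf_lim.
  apply: lime_le; first exact: is_cvg_einfs.
  apply: nearW => k; apply: le_trans (FB k).
  by apply: ereal_inf_lbound; exists k => /=.
apply: ae_eq_integral => //.
- rewrite (_ : (fun x => _) =
      (fun x => - limn_esup (fun k => - (EFin \o F k) x))).
    apply: measurableT_comp => //; apply: measurable_fun_limn_esup => k.
    exact: measurableT_comp.
  apply/funext => x; rewrite -[LHS]oppeK; congr (- _).
  by rewrite -(limn_esupN (fun k => (EFin \o F k) x)).
- exact/measurable_EFinP.
apply: filterS FG => x /[apply] FGx.
have FGx' : (F k x)%:E @[k --> \oo] --> (G x)%:E by apply: cvg_EFin; [exact: nearW|].
by have [-> _] := cvg_limn_einf_sup FGx'.
Qed.

End fatou_ae.

(** * The Sobolev inequality on H^1_0 *)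

Section sobolev_H10.
Context (R : realType) (n : nat) (Omega : set 'rV[R]_n).
Hypothesis n3 : (3 <= n)%N.
Hypothesis oO : open Omega.
Hypothesis Ofin : (lebesgue_rV R n Omega < +oo)%E.
Local Notation leb := (lebesgue_rV R n).
Local Notation s := (crit_exp R n).

Let mO : measurable Omega. Proof. exact: open_measurable_rV. Qed.

Definition sobolev_const : R := (2 * (n%:R - 1) / (n%:R - 2)) ^+ 2.

Lemma crit_exp_gt2 : 2 < s.
Proof. by have [] := @crit_expE R n n3. Qed.

Lemma sobolev_test phi : test_function Omega phi ->
  (\int[leb]_(x in Omega) (`|phi x| `^ s)%:E <=
   ((sobolev_const * \sum_i \int[leb]_(x in Omega) (partial i phi x ^+ 2)) `^ (s / 2))%:E)%E.
Proof.
move=> t; have s2 := crit_exp_gt2.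
have s0 : s != 0 by rewrite gt_eqF//; lra.
have [K _ sphi] := test_function_bounded_support t.
have C i : C1dir i phi by case: t => /smooth_C1dir.
have := sobolev_supported n3 C sphi.
have -> : \sum_i \int[leb]_x (partial i phi x ^+ 2) =
    \sum_i \int[leb]_(x in Omega) (partial i phi x ^+ 2).
  apply: eq_bigr => i _; symmetry; apply: integral_vanish_outside => x nx.
  by rewrite (test_function_eq0 (test_function_partial i t) nx) expr0n.
rewrite -(@integral_vanish_outside _ _ _ leb Omega); last first.
  by move=> x nx; rewrite (test_function_eq0 t nx) normr0 powR0.
have [M M0 phiM] := supported_continuous_bounded (test_function_continuous t) sphi.
have phii : leb.-integrable Omega (fun x => (`|phi x| `^ s)%:E).
  apply: measurable_bounded_integrable => //.
    apply: measurable_powR_comp; apply: measurableT_comp => //.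
    exact: test_function_measurable t.
  exists (M `^ s); split => [|k Mk x _ /=]; first exact: num_real.
  rewrite ger0_norm ?powR_ge0//; apply: le_trans (ltW Mk).
  by apply: ge0_ler_powR; rewrite ?nnegrE//; [lra|exact: ltW].
move=> H; rewrite -[leLHS]fineK; last exact: integrable_fin_num.
rewrite lee_fin -[leLHS]/(\int[leb]_(x in Omega) (`|phi x| `^ s)).
have A0 : 0 <= \int[leb]_(x in Omega) (`|phi x| `^ s).
  by apply: Rintegral_ge0 => x _; exact: powR_ge0.
rewrite (_ : \int[leb]_(x in Omega) _ =
    (\int[leb]_(x in Omega) (`|phi x| `^ s)) `^ (2 / s) `^ (s / 2)); last first.
  by rewrite -powRrM (_ : 2 / s * (s / 2) = 1) ?powRr1//; field.
apply: ge0_ler_powR => //; rewrite ?nnegrE ?powR_ge0//.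
  by apply: divr_ge0 => //; lra.
by apply: le_trans H; exact: powR_ge0.
Qed.

(** The inequality for test functions passes to an a.e. convergent sequence of approximations by
    Fatou. The factor 2 absorbs the comparison of gradients, and the remaining [e] tends to 0. *)
Lemma sobolev_H10 v : H10 Omega v -> Lp Omega s v /\
  (\int[leb]_(x in Omega) (`|v x| `^ s)) `^ (2 / s) <=
    (2 * sobolev_const) * grad_sqr Omega v.
Proof.
move=> vH; have s2 := crit_exp_gt2; have s0 : s != 0 by rewrite gt_eqF//; lra.
have /(H10P oO Ofin)[hv av] := vH.
have v2 : Lp Omega 2 v by case: hv.
have mv := Lp2_measurable mO v2.
have mvs : measurable_fun Omega (fun x => `|v x| `^ s).
  by apply: measurable_powR_comp; exact: measurableT_comp.
have S0 : 0 <= sobolev_const by exact: sqr_ge0.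
have G0 := grad_sqr_ge0 Omega v.
have key e : 0 < e -> (\int[leb]_(x in Omega) (`|v x| `^ s)%:E <=
    (((2 * sobolev_const) * (grad_sqr Omega v + e)) `^ (s / 2))%:E)%E.
  (* The geometric bound gives a.e. convergence, the bound [e] controls the gradients uniformly. *)
  move=> e0; pose eps k : R := Num.min e (1 / (2 ^ k.+1)%:R).
  have eps0 k : 0 < eps k by rewrite lt_min e0 /= divr_gt0// ltr0n expn_gt0.
  have /choice[phi Hphi] : forall k, exists phi, test_function Omega phi /\
      \int[leb]_(x in Omega) ((v x - phi x) ^+ 2) +
      \sum_(i < n) \int[leb]_(x in Omega) ((weak_partial Omega i v x - partial i phi x) ^+ 2) < eps k.
    by move=> k; have [phi ? ?] := av _ (eps0 k); exists phi.
  have d2 k : Lp Omega 2 (fun x => v x - phi k x).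
    have := Lp2_lin mO 1 (-1) v2 (test_function_Lp2 oO Ofin (Hphi k).1).
    by congr Lp; apply/funext => x; ring.
  have sqr0 k : 0 <= \int[leb]_(x in Omega) ((v x - phi k x) ^+ 2).
    by apply: Rintegral_ge0 => x _; exact: sqr_ge0.
  have sum0 k : 0 <= \sum_(i < n) \int[leb]_(x in Omega)
      ((weak_partial Omega i v x - partial i (phi k) x) ^+ 2).
    by apply: sumr_ge0 => i _; apply: Rintegral_ge0 => x _; exact: sqr_ge0.
  apply: (@fatou_ae _ _ _ leb Omega mO (fun k x => `|phi k x| `^ s)) => //.
  - move=> k; apply: measurable_powR_comp; apply: measurableT_comp => //.
    exact: test_function_measurable (Hphi k).1.
  - move=> k; have [t lt] := Hphi k; apply: le_trans (sobolev_test t) _.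
    rewrite lee_fin; apply: ge0_ler_powR; rewrite ?nnegrE.
    + by apply: divr_ge0 => //; lra.
    + by rewrite mulr_ge0// sumr_ge0// => i _; apply: Rintegral_ge0 => x _; exact: sqr_ge0.
    + by apply: mulr_ge0; [exact: mulr_ge0|apply: addr_ge0 => //; exact: ltW].
    rewrite (_ : 2 * sobolev_const * _ = sobolev_const * (2 * (grad_sqr Omega v + e))); last by ring.
    apply: ler_wpM2l => //.
    apply: (@le_trans _ _ (2 * grad_sqr Omega v + 2 * \sum_(i < n) \int[leb]_(x in Omega)
      ((weak_partial Omega i v x - partial i (phi k) x) ^+ 2))).
      rewrite !mulr_sumr -big_split; apply: ler_sum => i _ /=.
      have := sqr_sub_le oO (test_function_Lp2 oO Ofin (test_function_partial i t))
        (weak_partial_Lp2 i hv).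
      have -> : \int[leb]_(x in Omega) ((partial i (phi k) x - weak_partial Omega i v x) ^+ 2) =
          \int[leb]_(x in Omega) ((weak_partial Omega i v x - partial i (phi k) x) ^+ 2).
        by apply: eq_Rintegral => x _; rewrite -sqrrN opprB.
      by [].
    have := lt_le_trans lt (_ : eps k <= e); rewrite /eps ge_min lexx => /(_ isT).
    by have := sqr0 k; move: (\int[leb]_(x in Omega) _) (\sum_i _) => *; lra.
  - have mk k : measurable_fun Omega (fun x => v x - phi k x) by exact: Lp2_measurable (d2 k).
    have le k : (\int[leb]_(x in Omega) ((v x - phi k x) ^+ 2)%:E <= (1 / (2 ^ k.+1)%:R)%:E)%E.
      have := Lp2_sqr_EFin oO (d2 k); rewrite Lp_norm2_sqr// => ->.
      rewrite lee_fin; have [t lt] := Hphi k.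
      have := lt_le_trans lt (_ : eps k <= (1 / (2 ^ k.+1)%:R)); rewrite /eps ge_min lexx orbT => /(_ isT).
      have := sum0 k; move: (\sum_i _) (\int[leb]_(x in Omega) _) => *; lra.
    apply: filterS (ae_cvg0_sqr mO mk le) => x /[apply] cv.
    have cphi : phi k x @[k --> \oo] --> v x.
      rewrite -[v x]subr0 (_ : (fun k => phi k x) = (fun k => v x - (v x - phi k x))).
        by apply: cvgB => //; exact: cvg_cst.
      by apply/funext => k; ring.
    have s_gt0 : 0 < s by lra.
    exact: (cvg_comp _ _ cphi (@continuous_norm_powR R s s_gt0 (v x))).
have fin : (\int[leb]_(x in Omega) (`|v x| `^ s)%:E < +oo)%E.
  exact: le_lt_trans (key 1 ltr01) (ltry _).
split; first by apply/LpP; [exact: mO|lra|].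
set A := \int[leb]_(x in Omega) _.
have A0 : 0 <= A by apply: Rintegral_ge0 => x _; exact: powR_ge0.
have AE : (\int[leb]_(x in Omega) (`|v x| `^ s)%:E = A%:E)%E.
  rewrite /A /Rintegral fineK// ge0_fin_numE//.
  by apply: integral_ge0 => x _; rewrite lee_fin powR_ge0.
have bound e : 0 < e -> A `^ (2 / s) <= (2 * sobolev_const) * (grad_sqr Omega v + e).
  move=> e0; have := key e e0; rewrite AE lee_fin => H.
  have X0 : 0 <= (2 * sobolev_const) * (grad_sqr Omega v + e).
    by apply: mulr_ge0; [exact: mulr_ge0|apply: addr_ge0 => //; exact: ltW].
  rewrite [leRHS](_ : _ = ((2 * sobolev_const) * (grad_sqr Omega v + e)) `^ (s / 2) `^ (2 / s)); last first.
    by rewrite -powRrM (_ : s / 2 * (2 / s) = 1) ?powRr1//; field.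
  apply: ge0_ler_powR; rewrite ?nnegrE ?powR_ge0//.
  by apply: divr_ge0 => //; lra.
apply/ler_addgt0Pr => e e0.
have c0 : 0 < 2 * sobolev_const + 1 by lra.
have := bound (e / (2 * sobolev_const + 1)) (divr_gt0 e0 c0).
move=> /le_trans; apply; rewrite mulrDr lerD2l mulrCA ler_piMr ?(ltW e0)//.
by rewrite ler_pdivrMr// mul1r; lra.
Qed.

End sobolev_H10.

(** * Negative families of a quadratic form *)

Section negative_families.
Context (R : realFieldType) (E : lmodType R).
Variables (H Z : E -> Prop) (q : E -> E -> R).
Hypothesis H0 : H 0.
Hypothesis H_lin : forall a b x y, H x -> H y -> H (a *: x + b *: y).
Hypothesis Z_lin : forall a b x y, Z x -> Z y -> Z (a *: x + b *: y).
Hypothesis q_sym : forall x y, q x y = q y x.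
Hypothesis q_lin : forall a b x y z, H x -> H y -> H z ->
  q (a *: x + b *: y) z = a * q x z + b * q y z.

Definition lincomb k (c : 'I_k -> R) (v : 'I_k -> E) : E := \sum_i c i *: v i.

(** Independence in the quotient by [Z], without forming the quotient. *)
Definition indep_mod k (v : 'I_k -> E) : Prop :=
  forall c, Z (lincomb c v) -> forall i, c i = 0.

(** Asked of all nonzero coefficient vectors, so it entails linear independence, but not
    independence modulo [Z]. *)
Definition negative_on k (v : 'I_k -> E) : Prop :=
  forall c, (exists i, c i != 0) -> q (lincomb c v) (lincomb c v) < 0.

Lemma H_lincomb k (c : 'I_k -> R) v : (forall i, H (v i)) -> H (lincomb c v).
Proof.
move=> Hv; apply: big_ind => // [x y Hx Hy|i _].
  by rewrite -[x]scale1r -[y]scale1r; exact: H_lin.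
by rewrite -[_ *: _]addr0 -(scale0r 0); exact: H_lin.
Qed.

(** The family is nonempty because [Z 0] is obtained from one of its members. *)
Lemma Z_lincomb k (c : 'I_k.+1 -> R) v : (forall i, Z (v i)) -> Z (lincomb c v).
Proof.
have Z0 : (forall i, Z (v i)) -> Z 0.
  by move=> Zv; rewrite -(addr0 0) -{1}(scale0r (v ord0)) -(scale0r (v ord0)); exact: Z_lin.
move=> Zv; apply: big_ind => [|x y Zx Zy|i _]; first exact: Z0.
  by rewrite -[x]scale1r -[y]scale1r; exact: Z_lin.
by rewrite -[_ *: _]addr0 -(scale0r 0); apply: Z_lin => //; exact: Z0.
Qed.

Lemma q_lincombl k (c : 'I_k -> R) v z : (forall i, H (v i)) -> H z ->
  q (lincomb c v) z = \sum_i c i * q (v i) z.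
Proof.
move=> Hv Hz; have q0 : q 0 z = 0.
  by have := q_lin 0 0 H0 H0 Hz; rewrite !scale0r addr0 !mul0r addr0.
suff : H (lincomb c v) /\ q (lincomb c v) z = \sum_i c i * q (v i) z by case.
rewrite /lincomb; elim/big_ind2: _ => // [x1 s1 y1 s2 [Hx <-] [Hy <-]|i _].
  have := q_lin 1 1 Hx Hy Hz; have := H_lin 1 1 Hx Hy; rewrite !scale1r !mul1r.
  by [].
have := q_lin (c i) 0 (Hv i) H0 Hz; have := H_lin (c i) 0 (Hv i) H0.
by rewrite !scale0r !addr0 mul0r addr0.
Qed.

(** A matrix with more rows than columns has a nonzero left kernel. *)
Lemma dependent_coefs (k : nat) (J : finType) (a : 'I_k -> J -> R) : (#|J| < k)%N ->
  exists2 c : 'I_k -> R, (exists i, c i != 0) & forall j, \sum_i c i * a i j = 0.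
Proof.
move=> Jk; pose A : 'M[R]_(k, #|J|) := \matrix_(i, j) a i (enum_val j).
have /negPf nf : kermx A != 0.
  rewrite -mxrank_eq0 mxrank_ker subn_eq0 -ltnNge.
  exact: leq_ltn_trans (rank_leq_col A) Jk.
have [i ni] : exists i, row i (kermx A) != 0.
  apply/existsP; rewrite -negb_forall; apply: contraFN nf => /forallP Hz.
  by apply/eqP/row_matrixP => i; rewrite row0; exact/eqP.
pose c := row i (kermx A).
have cA : c *m A = 0 by rewrite -row_mul mulmx_ker row0.
move: ni; rewrite -/c; clearbody c => ni.
exists (fun j => c 0 j).
  apply/existsP; rewrite -negb_forall; apply: contra ni => /forallP Hz.
  by apply/eqP/rowP => j; rewrite [RHS]mxE; exact/eqP.
move=> j; have cAj : (c *m A) 0 (enum_rank j) = 0 by rewrite cA mxE.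
apply: etrans cAj; rewrite mxE; apply: eq_bigr => l _.
by rewrite mxE enum_rankK.
Qed.

(** With more vectors than conditions, a nonzero combination satisfies all conditions [l j = 0], and
    there [q] would be both negative and nonnegative. *)
Lemma negative_bound k (v : 'I_k -> E) (J : finType) (l : J -> E -> R) :
  (forall i, H (v i)) -> negative_on v ->
  (forall j c, l j (lincomb c v) = \sum_i c i * l j (v i)) ->
  (forall x, H x -> (forall j, l j x = 0) -> 0 <= q x x) -> (k <= #|J|)%N.
Proof.
move=> Hv nv ll pos; rewrite leqNgt; apply/negP => Jk.
have [c c0 cl] := dependent_coefs (fun i j => l j (v i)) Jk.
have := nv c c0; rewrite ltNge => /negP; apply; apply: pos; first exact: H_lincomb.
by move=> j; rewrite ll.
Qed.

(** If every [g j] were [lincomb (a j) v] modulo [Z], a linear relation between the [k + 1]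
    coefficient vectors [a j] would be one between the [g j] modulo [Z]. *)
Lemma exists_outside k (v : 'I_k -> E) (g : 'I_k.+1 -> E) : indep_mod g ->
  exists j, forall c, ~ Z (g j - lincomb c v).
Proof.
move=> ig; apply: contrapT => /forallNP nj.
have /choice[a Ha] : forall j, exists c, Z (g j - lincomb c v).
  by move=> j; have /existsNP[c /contrapT] := nj j; exists c.
have [c [i ci] ca] : exists2 c : 'I_k.+1 -> R, (exists i, c i != 0) &
    forall j, \sum_i c i * a i j = 0.
  by apply: dependent_coefs; rewrite card_ord.
move/eqP: ci; apply; apply: ig.
rewrite (_ : lincomb c g = lincomb c (fun j => g j - lincomb (a j) v)).
  exact: Z_lincomb.
rewrite [RHS](eq_bigr (fun j => c j *: g j - c j *: lincomb (a j) v)); last first.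
  by move=> j _; rewrite scalerBr.
rewrite sumrB (_ : \sum_j c j *: lincomb (a j) v = 0) ?subr0//.
rewrite (eq_bigr (fun j => \sum_i (c j * a j i) *: v i)); last first.
  by move=> j _; rewrite scaler_sumr; apply: eq_bigr => l _; rewrite scalerA.
by rewrite exchange_big big1// => l _; rewrite -scaler_suml ca scale0r.
Qed.

(** The Gram matrix of [v] is invertible: a kernel vector would give a nonzero combination with
    [q = 0]. The coefficients solve the resulting linear system. *)
Lemma orthogonal_part k (v : 'I_k -> E) f : (forall i, H (v i)) -> H f ->
  negative_on v -> exists c, forall i, q (f - lincomb c v) (v i) = 0.
Proof.
move=> Hv Hf nv; pose A : 'M[R]_k := \matrix_(i, j) q (v i) (v j).
have uA : A \in unitmx.
  rewrite -row_free_unit -kermx_eq0; apply/eqP/row_matrixP => i; rewrite row0.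
  apply/rowP => j; rewrite [RHS]mxE; apply/eqP; apply: contrapT => /negP nj.
  pose c := row i (kermx A); have cA : c *m A = 0 by rewrite -row_mul mulmx_ker row0.
  have nc : c 0 j != 0 by [].
  clearbody c; have := nv (fun j => c 0 j) (ex_intro _ j nc).
  rewrite q_lincombl//; last exact: H_lincomb.
  rewrite big1 ?ltxx// => l _; rewrite q_sym q_lincombl//.
  have cAl : (c *m A) 0 l = 0 by rewrite cA mxE.
  suff -> : \sum_p c 0 p * q (v p) (v l) = 0 by rewrite mulr0.
  apply: etrans cAl; rewrite mxE; apply: eq_bigr => p _.
  by rewrite mxE.
pose b : 'rV[R]_k := \row_j q f (v j).
exists (fun i => (b *m invmx A) 0 i) => j.
rewrite -[f]scale1r -scaleN1r q_lin//; last exact: H_lincomb.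
rewrite q_lincombl// mul1r mulN1r; set c := b *m invmx A.
have cA : (c *m A) 0 j = q f (v j) by rewrite mulmxKV// mxE.
clearbody c; move: cA; rewrite mxE => <-; apply/eqP; rewrite subr_eq0; apply/eqP.
by apply: eq_bigr => i _; rewrite [A _ _]mxE.
Qed.

(** Expand [q <= 0] at [x + t y] with the critical value [t = - q x y / q y y], then multiply by the
    negative number [q y y]. *)
Lemma neg_cauchy_schwarz k (v : 'I_k -> E) c e : (forall i, H (v i)) -> negative_on v ->
  q (lincomb c v) (lincomb e v) ^+ 2 <=
  q (lincomb c v) (lincomb c v) * q (lincomb e v) (lincomb e v).
Proof.
move=> Hv nv; have Hc b : H (lincomb b v) by exact: H_lincomb.
set x := lincomb c v; set y := lincomb e v.
have [ce|/forallNP e0] := pselect (exists i, e i != 0); last first.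
  have -> : y = 0.
    by apply: big1 => i _; have /negP := e0 i; rewrite negbK => /eqP ->; rewrite scale0r.
  have q0 z : H z -> q 0 z = 0.
    by move=> Hz; have := q_lin 0 0 H0 H0 Hz; rewrite !scale0r addr0 !mul0r addr0.
  by rewrite q_sym !q0 ?expr0n ?mulr0//; exact: Hc.
have qy : q y y < 0 by exact: nv.
have le0 b : q (lincomb b v) (lincomb b v) <= 0.
  have [/nv/ltW//|/forallNP b0] := pselect (exists i, b i != 0).
  rewrite q_lincombl// big1// => i _.
  by have /negP := b0 i; rewrite negbK => /eqP ->; rewrite mul0r.
pose t := - q x y / q y y.
have := le0 (fun i => 1 * c i + t * e i).
rewrite (_ : lincomb _ v = 1 *: x + t *: y); last first.
  rewrite /x /y /lincomb !scaler_sumr -big_split; apply: eq_bigr => i _ /=.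
  by rewrite !scalerA scalerDl.
have Hx := Hc c; have Hy := Hc e.
rewrite q_lin//; last exact: H_lin.
rewrite (q_sym x) (q_sym y) !q_lin// (q_sym y x).
rewrite (_ : _ + _ = q x x - q x y ^+ 2 / q y y); last first.
  by rewrite /t; field; rewrite lt_eqF.
rewrite subr_le0 => h.
have := ler_wnM2r (ltW qy) h; rewrite divfK ?lt_eqF//.
Qed.

Definition snoc_fam k (v : 'I_k -> E) (u : E) (i : 'I_k.+1) : E :=
  if unlift ord_max i is Some j then v j else u.

Lemma lincomb_snoc k (v : 'I_k -> E) u (c : 'I_k.+1 -> R) :
  lincomb c (snoc_fam v u) =
  lincomb (fun i => c (lift ord_max i)) v + c ord_max *: u.
Proof.
rewrite /lincomb (bigD1 ord_max)//= {1}/snoc_fam unlift_none addrC; congr (_ + _).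
rewrite (reindex_omap (lift ord_max) (unlift ord_max)) /=; last first.
  by move=> i; case: unliftP => [j ->|->]; rewrite ?eqxx.
rewrite (eq_bigl xpredT) => [|i]; last by rewrite eq_sym neq_lift liftK eqxx.
by apply: eq_bigr => i _; rewrite /snoc_fam liftK.
Qed.

Lemma coefs_snoc0 k (c : 'I_k.+1 -> R) : (forall i, c (lift ord_max i) = 0) ->
  c ord_max = 0 -> forall i, c i = 0.
Proof. by move=> h1 h2 i; case: (unliftP ord_max i) => [j ->|->]. Qed.

Lemma nonpositive_extension k (v : 'I_k -> E) u : (forall i, H (v i)) ->
  indep_mod v -> negative_on v -> H u -> ~ Z u -> (forall y, H y -> q u y = 0) ->
  (exists2 f, H f & forall c, ~ Z (f - lincomb c v)) ->
  exists v' : 'I_k.+1 -> E, [/\ forall i, H (v' i), indep_mod v',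
    forall c, q (lincomb c v') (lincomb c v') <= 0 &
    exists c, u = lincomb c v'].
Proof.
move=> Hv iv nv Hu nZu qu [f0 Hf0 f0v].
have in_snoc (v1 : 'I_k -> E) : exists c, u = lincomb c (snoc_fam v1 u).
  exists (fun i => (i == ord_max)%:R); rewrite lincomb_snoc eqxx scale1r.
  rewrite /lincomb big1 ?add0r// => i _.
  by rewrite eq_sym (negbTE (neq_lift _ _)) scale0r.
have H_snoc (v1 : 'I_k -> E) : (forall i, H (v1 i)) -> forall i, H (snoc_fam v1 u i).
  by move=> Hv1 i; rewrite /snoc_fam; case: unlift.
have le0 b : q (lincomb b v) (lincomb b v) <= 0.
  have [/nv/ltW//|/forallNP b0] := pselect (exists i, b i != 0).
  rewrite q_lincombl//; last exact: H_lincomb.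
  rewrite big1// => i _.
  by have /negP := b0 i; rewrite negbK => /eqP ->; rewrite mul0r.
have q_addu a x : H x -> q (x + a *: u) (x + a *: u) = q x x.
  move=> Hx; have Hxu := H_lin 1 a Hx Hu; rewrite scale1r in Hxu.
  have qE z : H z -> q (x + a *: u) z = q x z.
    by move=> Hz; have := q_lin 1 a Hx Hu Hz; rewrite scale1r mul1r qu// mulr0 addr0.
  by rewrite qE// q_sym qE.
have [ind|dep] := pselect (indep_mod (snoc_fam v u)).
  exists (snoc_fam v u); split => //; first exact: H_snoc.
  by move=> c; rewrite lincomb_snoc q_addu//; exact: H_lincomb.
have [c0 Zc0 [i0 ci0]] : exists2 c, Z (lincomb c (snoc_fam v u)) & exists i, c i != 0.
  move/existsNP: dep => [c /not_implyP[Zc /existsNP[i /eqP ci]]].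
  by exists c => //; exists i.
set a0 := c0 ord_max.
have a00 : a0 != 0.
  apply/eqP => a0E; move: Zc0; rewrite lincomb_snoc -/a0 a0E scale0r addr0 => /iv c00.
  by move/eqP: ci0; apply; exact: coefs_snoc0.
(* The relation solved for [u]: modulo [Z], [u] equals the combination [y] of [v]. *)
pose e i := - (c0 (lift ord_max i) / a0).
set y := lincomb e v.
have Zuy : Z (u - y).
  have := Z_lin a0^-1 0 Zc0 Zc0; rewrite scale0r addr0 lincomb_snoc -/a0 scalerDr scalerA.
  rewrite mulVf// scale1r addrC; congr (Z (_ + _)).
  rewrite /y /lincomb scaler_sumr -sumrN; apply: eq_bigr => i _.
  by rewrite /e scalerA scaleNr opprK [_^-1 * _]mulrC.
have Hy : H y by exact: H_lincomb.
have [ie ei] : exists i, e i != 0.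
  apply: contrapT => /forallNP e0; apply: nZu; rewrite -[u]subr0 -(_ : y = 0)//.
  by apply: big1 => i _; have /negP := e0 i; rewrite negbK => /eqP ->; rewrite scale0r.
have qy : q y y < 0 by apply: nv; exists ie.
have [cf cfE] := orthogonal_part Hv Hf0 nv.
pose f := f0 - lincomb cf v.
have Hf : H f.
  by have := H_lin 1 (-1) Hf0 (H_lincomb cf Hv); rewrite scale1r scaleN1r.
have fv c : ~ Z (f - lincomb c v).
  move=> ZZ; apply: (f0v (fun i => cf i + c i)); move: ZZ; congr Z.
  rewrite /f -addrA -opprD /lincomb -big_split; congr (_ - _).
  by apply: eq_bigr => i _; rewrite scalerDl.
have fq c : q (lincomb c v) f = 0.
  by rewrite q_lincombl// big1// => i _; rewrite q_sym cfE mulr0.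
pose K := `|q f f| + 1; have K0 : 0 < K by rewrite ltr_wpDl.
(* Chosen so that [eps <= 1] and [eps K <= - q y y], whence [eps^2 q f f <= - q y y]. *)
pose eps := - q y y / (K * (1 - q y y)).
have d0 : 0 < K * (1 - q y y) by rewrite mulr_gt0// subr_gt0 (lt_trans qy).
have eps0 : 0 < eps by rewrite divr_gt0// oppr_gt0.
have epsq : eps ^+ 2 * q f f <= - q y y.
  have e1 : eps <= 1.
    rewrite ler_pdivrMr// mul1r; have K1 : 1 <= K by rewrite lerDr.
    by apply: (@le_trans _ _ (1 * (1 - q y y))); [lra|rewrite ler_wpM2r//; lra].
  have e2 : eps * K <= - q y y.
    rewrite /eps mulrAC ler_pdivrMr// [K * _]mulrC mulrA ler_pM2r//.
    by have := sqr_ge0 (q y y); nra.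
  apply: (@le_trans _ _ (eps ^+ 2 * K)).
    by rewrite ler_wpM2l ?sqr_ge0// (le_trans (ler_norm _))// lerDl.
  by rewrite expr2 -mulrA (le_trans _ e2)// ler_piMl// mulr_ge0// ltW.
(* The [y]-component for [q], normalized by [l y = 1]: vectors q-orthogonal to [y] stay put and [y]
   moves to [y + eps f]. *)
pose l x := q x y / q y y.
pose v1 i := v i + (eps * l (v i)) *: f.
have Hv1 i : H (v1 i).
  by have := H_lin 1 (eps * l (v i)) (Hv i) Hf; rewrite scale1r.
have l_lin c : l (lincomb c v) = \sum_i c i * l (v i).
  by rewrite /l q_lincombl// mulr_suml; apply: eq_bigr => i _; rewrite mulrA.
have v1E c : lincomb c v1 = lincomb c v + (eps * l (lincomb c v)) *: f.
  rewrite /lincomb (eq_bigr (fun i => c i *: v i + (eps * (c i * l (v i))) *: f)); last first.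
    by move=> i _; rewrite scalerDr scalerA mulrCA.
  by rewrite big_split /= -scaler_suml -mulr_sumr -l_lin.
exists (snoc_fam v1 u); split => //; first exact: H_snoc.
- move=> c; rewrite lincomb_snoc v1E; set b := fun i => c (lift ord_max i).
  set a := c ord_max => Zc.
  (* Replacing [u] by [y] modulo [Z] leaves a relation between [v] and [f]; as [f] is outside the
     span of [v] plus [Z], its coefficient must vanish. *)
  have Zc' : Z (lincomb (fun i => b i + a * e i) v + (eps * l (lincomb b v)) *: f).
    have := Z_lin 1 (- a) Zc Zuy; congr Z.
    rewrite (_ : lincomb (fun i => b i + a * e i) v = lincomb b v + a *: y); last first.
      rewrite /y /lincomb scaler_sumr -big_split; apply: eq_bigr => i _ /=.
      by rewrite scalerDl scalerA.
    by rewrite scale1r scaleNr scalerBr opprB addrA (addrAC _ (a *: u)) addrK addrAC.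
  have lb : l (lincomb b v) = 0.
    apply: contrapT => /eqP lb0; set g := eps * _ in Zc'.
    have g0 : g != 0 by rewrite mulf_neq0// gt_eqF.
    apply: (fv (fun i => - (g^-1 * (b i + a * e i)))).
    have := Z_lin g^-1 0 Zc' Zc'; rewrite scale0r addr0 scalerDr scalerA mulVf// scale1r addrC.
    congr (Z (_ + _)); rewrite /lincomb scaler_sumr -sumrN; apply: eq_bigr => i _.
    by rewrite scalerA scaleNr opprK.
  move: Zc'; rewrite lb mulr0 scale0r addr0 => /iv be.
  (* Independence of [v] gives [b = - a e], so [lincomb b v] is [- a y], on which [l] takes the
     value [- a]. *)
  have a0E : a = 0.
    have bE i : b i = - a * e i by have := be i => /eqP; rewrite addr_eq0 mulNr => /eqP.
    move: lb; rewrite (_ : lincomb b v = 0 *: y + (- a) *: y); last first.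
      rewrite scale0r add0r /y /lincomb scaler_sumr; apply: eq_bigr => i _.
      by rewrite bE scalerA.
    rewrite /l q_lin// mul0r add0r mulfK ?lt_eqF// => /eqP.
    by rewrite oppr_eq0 => /eqP.
  apply: coefs_snoc0 => // i; rewrite -/(b i).
  by have := be i; rewrite a0E mul0r addr0.
- move=> c; rewrite lincomb_snoc q_addu; last exact: H_lincomb.
  rewrite v1E; set b := fun i => _; set x := lincomb b v.
  have Hx : H x by exact: H_lincomb.
  set g := eps * l x.
  have -> : q (x + g *: f) (x + g *: f) = q x x + g ^+ 2 * q f f.
    have Hg := H_lin 1 g Hx Hf; rewrite scale1r in Hg.
    have qE z : H z -> q (x + g *: f) z = q x z + g * q f z.
      by move=> Hz; have := q_lin 1 g Hx Hf Hz; rewrite scale1r mul1r.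
    rewrite qE// (q_sym x) (q_sym f) !qE// (q_sym f x) fq; ring.
  have CS : q x y ^+ 2 <= q x x * q y y by exact: neg_cauchy_schwarz.
  have l2 : l x ^+ 2 <= q x x / q y y.
    have q2 : 0 < q y y ^+ 2 by rewrite exprn_even_gt0//= lt_eqF.
    rewrite /l expr_div_n ler_pdivrMr// expr2 mulrA divfK ?lt_eqF//.
  have lx0 := sqr_ge0 (l x).
  (* The choice of [eps] gives [g^2 q f f <= - l(x)^2 q y y], and Cauchy-Schwarz bounds this by
     [- q x x]. *)
  apply: (@le_trans _ _ (q x x + l x ^+ 2 * - q y y)).
    by rewrite lerD2l /g exprMn (mulrC (eps ^+ 2)) -mulrA; exact: ler_wpM2l.
  by have := ler_wnM2r (ltW qy) l2; rewrite divfK ?lt_eqF// mulrN subr_le0.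
Qed.

End negative_families.

(** * The weighted quadratic form *)

Section weights.
Context (R : realType) (n : nat) (Omega : set 'rV[R]_n).
Hypothesis n3 : (3 <= n)%N.
Hypothesis oO : open Omega.
Hypothesis Ofin : (lebesgue_rV R n Omega < +oo)%E.
Implicit Types (u v : 'rV[R]_n -> R) (lambda : R).
Local Notation leb := (lebesgue_rV R n).
Local Notation s := (crit_exp R n).

Let mO : measurable Omega. Proof. exact: open_measurable_rV. Qed.

Definition weight u (t : 'rV[R]_n) : R := `|u t| `^ (s - 2).

Lemma weight_ge0 u t : 0 <= weight u t.
Proof. exact: powR_ge0. Qed.

(** Each factor is at most the largest of [a], [b], [c], whose power [s] is one of the summands.
    This gives integrability of the weighted products by comparison. *)
Lemma powR_mul3_le (a b c : R) : 0 <= a -> 0 <= b -> 0 <= c ->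
  a `^ (s - 2) * (b * c) <= a `^ s + b `^ s + c `^ s.
Proof.
have s2 : 2 < s by exact: crit_exp_gt2 n3.
move=> a0 b0 c0; pose m := Num.max a (Num.max b c).
have [am bm cm] : [/\ a <= m, b <= m & c <= m] by rewrite /m !le_max !lexx !orbT.
have m0 : 0 <= m by exact: le_trans am.
apply: (@le_trans _ _ (m `^ (s - 2) * (m * m))).
  apply: ler_pM; rewrite ?powR_ge0 ?mulr_ge0//; last exact: ler_pM.
  by apply: ge0_ler_powR; rewrite ?nnegrE// subr_ge0 ltW.
rewrite -expr2 -powR_mulrn// -powRD; last first.
  by apply/implyP => /eqP; rewrite subrK => s0; move: s2; rewrite s0 ltrn0.
rewrite subrK; have [] : m = a \/ m = b \/ m = c.
- by rewrite /m; case: (leP a (Num.max b c)) => _; [right; case: (leP b c); [right|left]|left].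
- by move=> ->; rewrite -addrA lerDl addr_ge0 ?powR_ge0.
- have a1 := powR_ge0 a s; have b1 := powR_ge0 b s; have c1 := powR_ge0 c s.
  by case=> ->; lra.
Qed.

Lemma weight_measurable u : measurable_fun Omega u -> measurable_fun Omega (weight u).
Proof. by move=> mu; apply: measurable_powR_comp; exact: measurableT_comp. Qed.

Lemma weight_gt_measurable u (T : R) : measurable_fun Omega u ->
  measurable_fun Omega (\1_[set t | T < weight u t] : 'rV[R]_n -> R).
Proof.
move=> mu; rewrite (_ : \1__ = \1_[set r : R | T < r] \o weight u).
  apply: measurableT_comp (weight_measurable mu); apply: measurable_indic.
  by rewrite -set_itvoy; exact: measurable_itv.
by apply/funext => x; rewrite /= !indicE; congr (nat_of_bool _)%:R.
Qed.

Lemma weight_integrable u x y : Lp Omega s u -> Lp Omega s x -> Lp Omega s y ->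
  leb.-integrable Omega (EFin \o (fun t => weight u t * (x t * y t))).
Proof.
have s2 : 2 < s by exact: crit_exp_gt2 n3.
have s0 : 0 < s by lra.
move=> /(LpP mO _ s0)[mu fu] /(LpP mO _ s0)[mx fx] /(LpP mO _ s0)[my fy].
have int_s v : measurable_fun Omega v ->
    (\int[leb]_(t in Omega) (`|v t| `^ s)%:E < +oo)%E ->
    leb.-integrable Omega (fun t => (`|v t| `^ s)%:E).
  move=> mv fv; apply/integrableP; split.
    by apply/measurable_EFinP; apply: measurable_powR_comp; exact: measurableT_comp.
  by under eq_integral do rewrite gee0_abs ?lee_fin ?powR_ge0//.
have iS := integrableD mO (integrableD mO (int_s u mu fu) (int_s x mx fx)) (int_s y my fy).
apply: (le_integrable mO _ _ iS).
  apply/measurable_EFinP; apply: measurable_funM; first exact: weight_measurable.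
  exact: measurable_funM.
move=> t _ /=; rewrite lee_fin normrM (ger0_norm (weight_ge0 _ _)) normrM.
apply: le_trans (ler_norm _); exact: powR_mul3_le.
Qed.

(** Dominated convergence over integer thresholds: at each point the indicator is eventually 0. *)
Lemma weight_tail u (d : R) : Lp Omega s u -> 0 < d -> exists2 T : R, 0 <= T &
  (\int[leb]_(x in Omega) (`|u x| `^ s * \1_[set x | T < weight u x]%R x)%:E <= d%:E)%E.
Proof.
have s2 : 2 < s by exact: crit_exp_gt2 n3.
have s0 : 0 < s by lra.
move=> /(LpP mO _ s0)[mu fu] d0.
have mus : measurable_fun Omega (fun x => `|u x| `^ s).
  by apply: measurable_powR_comp; exact: measurableT_comp.
have ui : leb.-integrable Omega (fun t => (`|u t| `^ s)%:E).
  apply/integrableP; split; first exact/measurable_EFinP.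
  by under eq_integral do rewrite gee0_abs ?lee_fin ?powR_ge0//.
pose f (k : nat) x : R := `|u x| `^ s * \1_[set x | k%:R < weight u x] x.
have mf k : measurable_fun Omega (f k).
  by apply: measurable_funM => //; exact: weight_gt_measurable.
have [|||||_ _] := @dominated_convergence _ _ R leb Omega mO
  (fun k x => (f k x)%:E) (cst 0%E) (fun x => (`|u x| `^ s)%:E).
- by move=> k; exact/measurable_EFinP.
- exact: measurable_cst.
- apply: aeW => x _; rewrite /cst; apply: cvg_near_cst.
  near=> k; rewrite /f indicE memNset ?mulr0//=; apply/negP; rewrite -leNgt ltW//.
  near: k; exact: nbhs_infty_gtr.
- exact: ui.
- apply: aeW => x k _; rewrite /f lee_fin ger0_norm; last by rewrite mulr_ge0// powR_ge0.
  by rewrite ler_piMr ?powR_ge0// indicE lern1 leq_b1.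
rewrite integral0 => /fine_cvgP[fin /cvgrPdist_lt/(_ _ d0) close].
have [k [fk ck]] : exists k, (\int[leb]_(x in Omega) (f k x)%:E)%E \is a fin_num /\
    `|0 - fine (\int[leb]_(x in Omega) (f k x)%:E)| < d.
  have [k _ Hk] := filterI fin close.
  by exists k; have := Hk k (leqnn k).
exists k%:R => //; rewrite -[leLHS]fineK// lee_fin.
by apply: le_trans (ler_norm _) _; rewrite -normrN -[- _]add0r ltW.
Unshelve. all: by end_near.
Qed.

(** Cut the weight at height [T]: the lower part is bounded, the upper one is treated by Hoelder
    with exponents [(s-2)/s] and [2/s]. *)
Lemma weight_split u (e : R) : Lp Omega s u -> 0 < e -> exists2 T : R, 0 <= T &
  forall v, Lp Omega 2 v -> Lp Omega s v ->
  \int[leb]_(x in Omega) (weight u x * (v x * v x)) <=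
  T * \int[leb]_(x in Omega) (v x ^+ 2) +
  e * (\int[leb]_(x in Omega) (`|v x| `^ s)) `^ (2 / s).
Proof.
have s2 : 2 < s by exact: crit_exp_gt2 n3.
have s0 : 0 < s by lra.
have sn0 : s != 0 by rewrite gt_eqF.
move=> us e0; pose th := (s - 2) / s.
have th0 : 0 < th by apply: divr_gt0; lra.
have th1 : 1 - th = 2 / s by rewrite /th; field.
have th01 : 0 < th < 1 by rewrite th0 -subr_gt0 th1 divr_gt0.
(* The tail is asked to be at most [e^(1/th)] because Hoelder takes its power [th]. *)
have [T T0 HT] := weight_tail us (powR_gt0 th^-1 e0).
exists T => // v v2 vs; have /(LpP mO _ s0)[mu fu] := us; have /(LpP mO _ s0)[mv fv] := vs.
have mW := weight_measurable mu.
pose h x : R := `|u x| `^ s * \1_[set x | T < weight u x] x.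
have mh : measurable_fun Omega h.
  apply: measurable_funM; first by apply: measurable_powR_comp; exact: measurableT_comp.
  exact: weight_gt_measurable.
pose k x : R := `|v x| `^ s.
have mk : measurable_fun Omega k by apply: measurable_powR_comp; exact: measurableT_comp.
have h0 x : 0 <= h x by rewrite mulr_ge0// powR_ge0.
have k0 x : 0 <= k x by exact: powR_ge0.
set B := \int[leb]_(x in Omega) (`|v x| `^ s).
have BE : (\int[leb]_(x in Omega) (k x)%:E <= B%:E)%E.
  rewrite /B /Rintegral fineK// ge0_fin_numE//.
  by apply: integral_ge0 => x _; rewrite lee_fin.
have := hoelder_two mO th01 mh mk (fun x _ => h0 x) (fun x _ => k0 x) HT BE.
rewrite th1 (_ : (e `^ th^-1) `^ th = e); last first.
  by rewrite -powRrM mulVf ?gt_eqF// powRr1// ltW.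
move=> Hle.
have g0 x : 0 <= h x `^ th * k x `^ (2 / s) by rewrite mulr_ge0 ?powR_ge0.
have gi : leb.-integrable Omega (EFin \o (fun x => h x `^ th * k x `^ (2 / s))).
  apply/integrableP; split.
    by apply/measurable_EFinP; apply: measurable_funM; exact: measurable_powR_comp.
  under eq_integral do rewrite /= ger0_norm//.
  exact: le_lt_trans Hle (ltry _).
have v2i := Lp2_integrable_sqr mO v2.
(* [T v^2] dominates where the weight is at most [T]; elsewhere the Hoelder integrand equals the
   weight times [v^2], since [s th = s - 2]. *)
apply: (@le_trans _ _ (\int[leb]_(x in Omega) (T * v x ^+ 2 + h x `^ th * k x `^ (2 / s)))).
  apply: le_Rintegral => //.
  - exact: weight_integrable.
  - exact: (integrableD mO (integrableZl mO T v2i) gi).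
  move=> x _; rewrite -expr2; have [xT|xT] := leP (weight u x) T.
    by rewrite -[leLHS]addr0 lerD// ler_wpM2r// sqr_ge0.
  rewrite -[leLHS]add0r lerD//; first by rewrite mulr_ge0// sqr_ge0.
  rewrite /h indicE mem_set//= mulr1 /k -!powRrM.
  rewrite (_ : s * th = s - 2); last by rewrite /th; field.
  rewrite (_ : s * (2 / s) = 2%:R); last by field.
  by rewrite /weight powR_mulrn// -normrX (ger0_norm (sqr_ge0 _)).
rewrite RintegralD//; last exact: (integrableZl mO T v2i).
rewrite RintegralZl// lerD2l -lee_fin /Rintegral fineK//.
by apply: integrable_fin_num.
Qed.

Lemma grad_dot_integrable x y : H1 Omega x -> H1 Omega y ->
  leb.-integrable Omega (EFin \o grad_dot Omega x y).
Proof.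
move=> hx hy; apply: integrable_sumR => // i.
by apply: Lp2_mul_integrable => //; exact: weak_partial_Lp2.
Qed.

Definition energy lambda x y : R :=
  \int[leb]_(t in Omega) (grad_dot Omega x y t - lambda * (x t * y t)).

Definition mass u x y : R := \int[leb]_(t in Omega) (weight u t * (x t * y t)).

Lemma energy_integrable lambda x y : H1 Omega x -> H1 Omega y ->
  leb.-integrable Omega (EFin \o (fun t => grad_dot Omega x y t - lambda * (x t * y t))).
Proof.
move=> hx hy; have i2 := Lp2_mul_integrable mO hx.1 hy.1.
exact: (integrableB mO (grad_dot_integrable hx hy) (integrableZl mO lambda i2)).
Qed.

Lemma energyE lambda x y : H1 Omega x -> H1 Omega y ->
  energy lambda x y = \int[leb]_(t in Omega) (grad_dot Omega x y t) -
    lambda * \int[leb]_(t in Omega) (x t * y t).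
Proof.
move=> hx hy; have i2 := Lp2_mul_integrable mO hx.1 hy.1.
rewrite /energy RintegralB//; first by rewrite RintegralZl.
- exact: grad_dot_integrable.
- exact: (integrableZl mO lambda i2).
Qed.

Lemma grad_dot_lin (a b : R) x x' y : H1 Omega x -> H1 Omega x' -> H1 Omega y ->
  grad_dot Omega (fun t => a * x t + b * x' t) y =
  (fun t => a * grad_dot Omega x y t + b * grad_dot Omega x' y t) %[ae leb in Omega].
Proof.
move=> hx hx' hy.
have : \forall t \ae leb, forall i : 'I_n, Omega t ->
    weak_partial Omega i (fun t => a * x t + b * x' t) t =
    a * weak_partial Omega i x t + b * weak_partial Omega i x' t.
  by apply: filter_forall => i; exact: weak_partial_lin.
apply: filterS => t Ht Ot; rewrite /grad_dot !mulr_sumr -big_split.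
by apply: eq_bigr => i _ /=; rewrite Ht//; ring.
Qed.

Lemma grad_dot_sym x y t : grad_dot Omega x y t = grad_dot Omega y x t.
Proof. by apply: eq_bigr => i _; rewrite mulrC. Qed.

Lemma energy_sym lambda x y : energy lambda x y = energy lambda y x.
Proof.
by apply: eq_Rintegral => t _; rewrite grad_dot_sym; congr (_ - _ * _); rewrite mulrC.
Qed.

Lemma energy_lin lambda (a b : R) x x' y : H1 Omega x -> H1 Omega x' -> H1 Omega y ->
  energy lambda (fun t => a * x t + b * x' t) y =
  a * energy lambda x y + b * energy lambda x' y.
Proof.
move=> hx hx' hy; have hl := H1_lin oO Ofin a b hx hx'.
have i1 := energy_integrable lambda hx hy; have i2 := energy_integrable lambda hx' hy.
rewrite /energy -!RintegralZl// -RintegralD//; last 2 first.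
- exact: (integrableZl mO a i1).
- exact: (integrableZl mO b i2).
apply: ae_Rintegral => //.
- by apply/measurable_EFinP; exact: measurable_int (energy_integrable lambda hl hy).
- apply: measurable_funD; apply: measurable_funM => //; apply/measurable_EFinP.
    exact: measurable_int i1.
  exact: measurable_int i2.
apply: filterS (grad_dot_lin a b hx hx' hy) => t /[apply] ->; ring.
Qed.

Lemma mass_sym u x y : mass u x y = mass u y x.
Proof. by apply: eq_Rintegral => t _; congr (_ * _); rewrite mulrC. Qed.

Lemma mass_lin u (a b : R) x x' y : Lp Omega s u -> Lp Omega s x -> Lp Omega s x' ->
  Lp Omega s y ->
  mass u (fun t => a * x t + b * x' t) y = a * mass u x y + b * mass u x' y.
Proof.
move=> us xs xs' ys; have i1 := weight_integrable us xs ys.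
have i2 := weight_integrable us xs' ys.
rewrite /mass -!RintegralZl// -RintegralD//; last 2 first.
- exact: (integrableZl mO a i1).
- exact: (integrableZl mO b i2).
by apply: eq_Rintegral => t _; ring.
Qed.

Lemma H10_Lp_crit v : H10 Omega v -> Lp Omega s v.
Proof. by move=> vH; have [] := sobolev_H10 n3 oO Ofin vH. Qed.

(** The Dirichlet energy is spent in two halves: one on the small part of the weight through
    Sobolev, one on [lambda + T] times the L^2 norm through Poincare. The two fractions chosen below
    make each share at most one half. *)
Lemma energy_sub_mass_ge0 (L : R) lambda u : 0 < L -> 0 <= lambda ->
  Omega `<=` box (fun=> - L) (fun=> L) -> Lp Omega s u ->
  exists (J : finType) (Q : J -> set 'rV[R]_n), (forall j, measurable (Q j)) /\
    forall v, H10 Omega v ->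
      (forall j, \int[leb]_(x in Omega) (\1_(Q j) x * v x) = 0) ->
      0 <= energy lambda v v - mass u v v.
Proof.
move=> L0 l0 OL us; pose S := 2 * sobolev_const R n.
have S0 : 0 <= S by rewrite mulr_ge0// sqr_ge0.
have e0 : 0 < 1 / (2 * (S + 1)) by rewrite divr_gt0// mulr_gt0// ltr_wpDl.
have [T T0 HT] := weight_split us e0.
have d0 : 0 < 1 / (2 * (lambda + T + 1)) by rewrite divr_gt0// mulr_gt0// ltr_wpDl// addr_ge0.
have [J [Q [mQ HQ]]] := poincare_finite_codim oO Ofin L0 d0 OL.
exists J, Q; split => // v vH v0; have hv := H10_H1 vH.
have [vs sob] := sobolev_H10 n3 oO Ofin vH.
have v2 := H10_Lp2 vH.
have P := HQ v vH v0; have M := HT v v2 vs.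
have G : \int[leb]_(t in Omega) grad_dot Omega v v t = grad_sqr Omega v.
  rewrite Rintegral_sum// => i.
  by apply: Lp2_mul_integrable => //; exact: weak_partial_Lp2.
rewrite energyE// G.
rewrite (_ : \int[leb]_(t in Omega) (v t * v t) = \int[leb]_(t in Omega) (v t ^+ 2)); last first.
  by apply: eq_Rintegral => t _; rewrite expr2.
have G0 := grad_sqr_ge0 Omega v.
have A0 : 0 <= \int[leb]_(t in Omega) (v t ^+ 2) by apply: Rintegral_ge0 => t _; exact: sqr_ge0.
move: M sob; rewrite -/(mass u v v) -/S.
move: ((\int[leb]_(x in Omega) (`|v x| `^ s)) `^ (2 / s)) => B M sob.
have M2 : 1 / (2 * (S + 1)) * B <= grad_sqr Omega v / 2.
  apply: (@le_trans _ _ (1 / (2 * (S + 1)) * (S * grad_sqr Omega v))).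
    by rewrite ler_wpM2l// ltW.
  have -> : 1 / (2 * (S + 1)) * (S * grad_sqr Omega v) = S / (S + 1) * (grad_sqr Omega v / 2).
    by field; rewrite gt_eqF// ltr_wpDl.
  by rewrite ler_piMl ?divr_ge0// ler_pdivrMr ?ltr_wpDl// mul1r lerDl.
have P2 : (lambda + T) * \int[leb]_(t in Omega) (v t ^+ 2) <= grad_sqr Omega v / 2.
  apply: (@le_trans _ _ ((lambda + T) * (1 / (2 * (lambda + T + 1)) * grad_sqr Omega v))).
    by rewrite ler_wpM2l// addr_ge0.
  have lT : 0 <= lambda + T by exact: addr_ge0.
  have -> : (lambda + T) * (1 / (2 * (lambda + T + 1)) * grad_sqr Omega v) =
      (lambda + T) / (lambda + T + 1) * (grad_sqr Omega v / 2).
    by field; rewrite gt_eqF// ltr_wpDl.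
  by rewrite ler_piMl ?divr_ge0// ler_pdivrMr ?ltr_wpDl// mul1r lerDl.
move: P2 M M2; rewrite mulrDl; lra.
Qed.

End weights.

(** * Linearly independent test functions *)

Section independent_test_functions.
Context (R : realType) (n : nat) (Omega : set 'rV[R]_n.+1).
Hypothesis oO : open Omega.
Local Notation leb := (lebesgue_rV R n.+1).

Lemma is_derive_coord (i j : 'I_n.+1) (x : 'rV[R]_n.+1) :
  is_derive x (delta_mx 0 j) (fun x : 'rV[R]_n.+1 => x 0 i : R) (i == j)%:R.
Proof.
rewrite -{1}[x]addr0 -{1}[0](scale0r (delta_mx 0 j)); apply/is_derive_line.
have -> : (fun r : R => (x + r *: delta_mx 0 j) 0 i) =
    ((i == j)%:R \*: id + cst (x 0 i)).
  apply/funext => r; rewrite -[RHS]/((i == j)%:R * r + _) !mxE eqxx /=; ring.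
by apply: is_derive_eq; rewrite -[_ *: 1]/(_ * 1) mulr1 addr0.
Qed.

Lemma Ck_coord k (i : 'I_n.+1) : Ck k (fun x : 'rV[R]_n.+1 => x 0 i : R).
Proof.
case: k => [|k]; first exact: coord_continuous.
split; first exact: coord_continuous.
- by move=> j x; have [] := is_derive_coord i j x.
- move=> j; rewrite (_ : partial j _ = fun=> (i == j)%:R); first exact: Ck_cst.
  by apply/funext => x; have [_] := is_derive_coord i j x.
Qed.

Lemma test_function_mul (phi f : 'rV[R]_n.+1 -> R) : test_function Omega phi -> smooth f ->
  test_function Omega (fun x => phi x * f x).
Proof.
move=> [sp cp pO] sf.
have S : closure [set x | phi x * f x != 0] `<=` closure [set x | phi x != 0].
  by apply: closure_subset => x /=; rewrite mulf_eq0 negb_or => /andP[].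
split; first by move=> k; exact: CkM.
- by apply: subclosed_compact S; first exact: closed_closure.
- exact: subset_trans S pO.
Qed.

(** By the product structure, the section of the preimage over each point of the remaining
    coordinates is [A] itself. *)
Lemma null_slices (A : set R) : measurable A -> lebesgue_measure A = 0%E ->
  {ae leb, forall x : 'rV[R]_n.+1, ~ A (x ord0 ord0)}.
Proof.
move=> mA A0; exists ((fun x : 'rV[R]_n.+1 => x ord0 ord0) @^-1` A); split.
- by rewrite -[X in measurable X]setTI; exact: measurable_coord.
- set S := _ @^-1` A; transitivity (\int[lebesgue_rV R n]_y
      lebesgue_measure (ysection (@consrV R n @^-1` S) y))%E; first by [].
  rewrite integral0_eq// => y _.
  rewrite (_ : ysection _ y = A)//; apply/seteqP.
  by split => t; rewrite /ysection /= in_setE /S /= consrV0.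
- by move=> x /= /contrapT.
Qed.

Lemma roots_null (p : {poly R}) : p != 0 ->
  {ae leb, forall x : 'rV[R]_n.+1, p.[x ord0 ord0] != 0}.
Proof.
move=> p0; have fin : finite_set [set t | root p t].
  apply: contrapT => /(@infinite_set_fset _ _ (size p))[B BA sB].
  have : all (root p) (finmap.enum_fset B).
    by apply/allP => t tB; apply: (BA t).
  move=> /(max_poly_roots p0) /(_ (finmap.fset_uniq B)).
  by rewrite ltnNge sB.
have c := finite_set_countable fin.
have := null_slices (countable_measurable (@measurable_set1 R) c) (countable_lebesgue_measure0 c).
by apply: filterS => x /= /negP; rewrite rootE.
Qed.

Lemma nonzero_box u : nonzero_ae Omega u ->
  exists a b : 'I_n.+1 -> R, closed_box a b `<=` Omega /\
    ~ {ae leb, forall x, open_box a b x -> u x = 0}.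
Proof.
move=> nu; apply: contrapT => nab; apply: nu.
have : \forall x \ae leb, forall k : nat,
    if unpickle k is Some p then
      closed_box (rat_lo R p) (rat_hi R p) `<=` Omega ->
      open_box (rat_lo R p) (rat_hi R p) x -> u x = 0 else True.
  apply: ae_foralln => k; case: (unpickle k) => [p|]; last exact: aeW.
  have [pO|npO] := pselect (closed_box (rat_lo R p) (rat_hi R p) `<=` Omega).
    have : {ae leb, forall x, open_box (rat_lo R p) (rat_hi R p) x -> u x = 0}.
      by apply: contrapT => nH; apply: nab; exists (rat_lo R p), (rat_hi R p).
    by apply: filterS => x + _.
  exact: aeW.
apply: filterS => x Hx Ox.
have [p [px pO]] := open_rat_box oO Ox.
by have := Hx (pickle p); rewrite pickleK; exact.
Qed.

(** One bump times the powers of the first coordinate. A relation on the support of [u] says that a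
    polynomial in that coordinate vanishes wherever [u] does not, inside the box; a nonzero
    polynomial has a null zero set, so [u] would be 0 a.e. in a box chosen to prevent this. *)
Lemma independent_test_functions u m : nonzero_ae Omega u ->
  exists g : 'I_m -> 'rV[R]_n.+1 -> R, (forall i, test_function Omega (g i)) /\
    forall c : 'I_m -> R,
      {ae leb, forall x, Omega x -> u x != 0 -> \sum_i c i * g i x = 0} ->
      forall i, c i = 0.
Proof.
move=> /nonzero_box[a [b [abO nab]]].
exists (fun j x => bump a b 0 x * x 0 ord0 ^+ j); split => [j|c Hc].
  apply: test_function_mul; first exact: bump_test_function.
  move=> k; elim: (nat_of_ord j) => [|l IH]; first exact: Ck_cst.
  by under eq_fun do rewrite exprS; apply: CkM => //; exact: Ck_coord.
pose p := \poly_(j < m) (if insub j is Some i then c i else 0).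
have pE i : p`_(nat_of_ord i) = c i.
  by rewrite coef_poly ltn_ord; case: insubP => [i' _ /val_inj ->//|]; rewrite ltn_ord.
suff p0 : p = 0 by move=> i; rewrite -pE p0 coef0.
apply/eqP; apply: contrapT => /negP p0; apply: nab.
apply: filterS2 Hc (roots_null p0) => x Hx px xab.
apply/eqP; apply: contrapT => /negP ux.
have Ox : Omega x by apply: abO; exact: open_box_sub.
move/negP: px; apply; have /eqP := Hx Ox ux.
rewrite (eq_bigr (fun i : 'I_m => bump a b 0 x * (c i * x 0 ord0 ^+ i))) => [|i _]; last by ring.
rewrite -mulr_sumr mulf_eq0 gt_eqF ?bump_gt0//= horner_poly.
by congr (_ == _); apply: eq_bigr => i _; rewrite -pE coef_poly ltn_ord.
Qed.

End independent_test_functions.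

(** * The eigenvalue of a solution *)

Section variational_setting.
Context (R : realType) (n : nat) (Omega : set 'rV[R]_n).
Hypothesis n3 : (3 <= n)%N.
Hypothesis oO : open Omega.
Hypothesis Obounded : bounded_set Omega.
Local Notation leb := (lebesgue_rV R n).
Local Notation s := (crit_exp R n).
(** With values in [R^o], functions form a module over [R], as the abstract lemmas on negative
    families require. *)
Local Notation E := ('rV[R]_n -> R^o).

Let mO : measurable Omega. Proof. exact: open_measurable_rV. Qed.

Lemma bounded_set_box : exists2 L : R, 0 < L & Omega `<=` box (fun=> - L) (fun=> L).
Proof.
have [M [_ HM]] := Obounded; exists (`|M| + 2) => [|x Ox i]; first by rewrite ltr_wpDl.
have lt : M < `|M| + 1 by rewrite (le_lt_trans (ler_norm _))// ltrDl.
have xM : `|x| <= `|M| + 1 := HM _ lt x Ox.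
have : `|x ord0 i| <= `|M| + 1.
  by apply: le_trans xM; rewrite [leRHS]mx_normrE; exact: (le_bigmax _ _ (ord0, i)).
by rewrite ler_norml => /andP[? ?]; apply/andP; split; lra.
Qed.

Lemma bounded_set_finite_measure : (leb Omega < +oo)%E.
Proof.
have [L _ OL] := bounded_set_box.
apply: le_lt_trans (lebesgue_box_lty (fun=> - L) (fun=> L)).
by apply: le_measure; rewrite ?inE//; exact: measurable_box.
Qed.

Let Ofin := bounded_set_finite_measure.
Let s2 : 2 < s := crit_exp_gt2 R n3.

Variables (lambda : R) (u : 'rV[R]_n -> R).
Hypothesis lambda_ge0 : 0 <= lambda.
Hypothesis u_H10 : H10 Omega u.
Hypothesis u_neq0 : nonzero_ae Omega u.

Local Notation N := (crit_norm Omega u).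
Local Notation ut := (fun x : 'rV[R]_n => u x / N).
Local Notation w := (fun x : 'rV[R]_n => (`|u x / N| : R)).
Local Notation M := (N `^ (s - 2)).

Let us : Lp Omega s u. Proof. exact: H10_Lp_crit. Qed.

(** [crit_norm] is a [fine], which is 0 at infinity, so positivity rests on the finiteness given by
    Sobolev as well as on [u] being nonzero. *)
Lemma crit_norm_gt0 : 0 < N.
Proof.
have s0 : 0 < s by exact: lt_trans s2.
have [mu fu] := (LpP mO u s0).1 us.
rewrite lt_neqAle fine_ge0 ?Lnorm_ge0// andbT eq_sym; apply/negP => /eqP N0.
apply: u_neq0.
have L0 : Lp_norm Omega s u = 0%E.
  rewrite -[LHS]fineK ?[fine _]N0// ge0_fin_numE ?Lnorm_ge0//.
  by have /andP[_] := us; rewrite inE.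
have I0 : (\int[leb]_(x in Omega) `|(`|u x| `^ s)%:E| = 0)%E.
  have := poweR_Lnorm leb (EFin \o (u \_ Omega)) (negbT (gt_eqF s0)).
  rewrite -/(Lp_norm Omega s u) L0 poweR0r ?gt_eqF// => /esym I0.
  rewrite -[RHS]I0 [LHS]integral_mkcond; apply: eq_integral => x _.
  rewrite /= /patch; case: ifP => _; first by rewrite ger0_norm ?powR_ge0.
  by rewrite normr0 powR0 ?gt_eqF.
have mus : measurable_fun Omega (fun x => (`|u x| `^ s)%:E).
  by apply/measurable_EFinP; apply: measurable_powR_comp; exact: measurableT_comp.
apply: filterS ((ae_eq_integral_abs leb mO mus).1 I0) => x /[apply] -[].
by move=> /powR_eq0_eq0 /eqP; rewrite normr_eq0 => /eqP.
Qed.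

Let N0 := crit_norm_gt0.
Let M0 : 0 < M. Proof. exact: powR_gt0. Qed.

Lemma weight_normalized x : M * `|u x / N| `^ (s - 2) = weight u x.
Proof.
rewrite normrM normfV (gtr0_norm N0) powRM ?invr_ge0 ?(ltW N0)//.
by rewrite -powR_inv1 ?(ltW N0)// -powRrM mulN1r powRN mulrCA divff ?mulr1// gt_eqF.
Qed.

Lemma weak_solution_normalized :
  weak_solution Omega lambda (fun x => `|u x| `^ (s - 2) * u x) u <->
  weak_solution Omega lambda (fun x => M * `|u x / N| `^ (s - 2) * (u x / N)) ut.
Proof.
have ut_lin : ut = (fun x => N^-1 * u x + 0 * u x).
  by apply/funext => x; rewrite mul0r addr0 mulrC.
have utH : H10 Omega ut by rewrite ut_lin; exact: H10_lin.
have E1 v : H10 Omega v ->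
    \int[leb]_(x in Omega) (grad_dot Omega ut v x - lambda * (ut x * v x)) =
    N^-1 * \int[leb]_(x in Omega) (grad_dot Omega u v x - lambda * (u x * v x)).
  move=> vH; have := energy_lin oO Ofin lambda N^-1 0
    (H10_H1 u_H10) (H10_H1 u_H10) (H10_H1 vH).
  by rewrite -ut_lin mul0r addr0.
have E2 v : H10 Omega v ->
    \int[leb]_(x in Omega) (M * `|u x / N| `^ (s - 2) * (u x / N) * v x) =
    N^-1 * \int[leb]_(x in Omega) (`|u x| `^ (s - 2) * u x * v x).
  move=> vH; have vs := H10_Lp_crit n3 oO Ofin vH.
  have i1 := weight_integrable n3 oO us us vs.
  transitivity (N^-1 * \int[leb]_(x in Omega) (weight u x * (u x * v x))).
    by rewrite -RintegralZl//; apply: eq_Rintegral => x _; rewrite weight_normalized; ring.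
  by congr (_ * _); apply: eq_Rintegral => x _; rewrite mulrA.
have NV0 : N^-1 != 0 by rewrite invr_eq0 gt_eqF.
split=> -[_ H]; split => // v vH.
  by rewrite E1// E2// H.
by apply: (mulfI NV0); rewrite -E1// -E2// H.
Qed.

(** The Z of the overview, phrased without [w] so that it fits every positive power of the
    weight. *)
Definition null_on_support (f : E) : Prop :=
  {ae leb, forall x, Omega x -> u x != 0 -> f x = 0}.

Definition form (x y : E) : R := energy Omega lambda x y - mass Omega u x y.

Lemma form_sym x y : form x y = form y x.
Proof. by rewrite /form energy_sym mass_sym. Qed.

Lemma form_lin (a b : R) (x y z : E) : H10 Omega x -> H10 Omega y -> H10 Omega z ->
  form (a *: x + b *: y) z = a * form x z + b * form y z.
Proof.
move=> xH yH zH; have L v := @H10_Lp_crit R n Omega n3 oO Ofin v.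
have e := energy_lin oO Ofin lambda a b (H10_H1 xH) (H10_H1 yH) (H10_H1 zH).
have m := mass_lin n3 oO a b us (L _ xH) (L _ yH) (L _ zH).
rewrite /form -[a *: x + b *: y]/(fun t => a * x t + b * y t) e m; ring.
Qed.

Lemma H10_linS (a b : R) (x y : E) : H10 Omega x -> H10 Omega y -> H10 Omega (a *: x + b *: y).
Proof. exact: H10_lin. Qed.

Lemma H10_0 : H10 Omega (0 : E).
Proof.
have := H10_lin oO Ofin 0 0 u_H10 u_H10.
by congr H10; apply/funext => x; rewrite !mul0r addr0.
Qed.

Lemma H10_lincomb k (c : 'I_k -> R) (v : 'I_k -> E) :
  (forall i, H10 Omega (v i)) -> H10 Omega (lincomb c v).
Proof. exact: (@H_lincomb R E (H10 Omega) H10_0 H10_linS k c v). Qed.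

Lemma null_on_support_lin (a b : R) (x y : E) :
  null_on_support x -> null_on_support y -> null_on_support (a *: x + b *: y).
Proof.
apply: filterS2 => t xt yt Ot ut0.
by rewrite -[LHS]/(a * x t + b * y t) xt// yt// !mulr0 addr0.
Qed.

Lemma lincombE k (c : 'I_k -> R) (v : 'I_k -> E) :
  lincomb c v = (fun x => \sum_(i < k) c i * v i x).
Proof. by rewrite /lincomb; apply/funext => x; rewrite fct_sumE. Qed.

Lemma null_on_support_weighted (f : E) : null_on_support f <->
  (fun x => w x `^ (2 / (n%:R - 2)) * f x) = cst 0 %[ae leb in Omega].
Proof.
have N3 : 3 <= (n%:R : R) by rewrite (ler_nat R 3).
have a0 : 0 < 2 / (n%:R - 2) :> R by rewrite divr_gt0// subr_gt0; lra.
split; apply: filterS => x Hx Ox.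
  have [ux|ux] := eqVneq (u x) 0; last by rewrite Hx ?mulr0.
  by rewrite ux mul0r normr0 powR0 ?gt_eqF// mul0r.
move=> ux; have /eqP := Hx Ox; rewrite mulf_eq0 => /orP[|/eqP//].
have p0 : 0 < `|u x / N| by rewrite normr_gt0 mulf_neq0// invr_eq0 gt_eqF.
by rewrite gt_eqF// powR_gt0.
Qed.

Lemma lin_indep_weighted k (v : 'I_k -> E) :
  lin_indep_ae Omega (fun i x => w x `^ (2 / (n%:R - 2)) * v i x) <->
  indep_mod null_on_support v.
Proof.
have eqE (c : 'I_k -> R) x :
    \sum_(i < k) c i * (`|u x / N| `^ (2 / (n%:R - 2)) * v i x) =
    `|u x / N| `^ (2 / (n%:R - 2)) * lincomb c v x.
  by rewrite lincombE mulr_sumr; apply: eq_bigr => i _; ring.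
split=> ind c Hc; apply: ind.
  by move/null_on_support_weighted: Hc; apply: filterS => x Hx Ox; rewrite eqE Hx.
by apply/null_on_support_weighted; apply: filterS Hc => x Hx Ox; rewrite -eqE Hx.
Qed.

(** A nonnegative integrand of integral 0 vanishes a.e., which forces [f = 0] wherever [u] does not
    vanish. *)
Lemma mass_gt0 (f : E) : H10 Omega f -> ~ null_on_support f -> 0 < mass Omega u f f.
Proof.
move=> fH nZ; have fs := H10_Lp_crit n3 oO Ofin fH.
have i1 := weight_integrable n3 oO us fs fs.
have p x : 0 <= weight u x * (f x * f x) by rewrite mulr_ge0 ?powR_ge0// -expr2 sqr_ge0.
rewrite lt_neqAle eq_sym Rintegral_ge0 ?andbT//.
apply/negP => /eqP m0; apply: nZ.
have I0 : (\int[leb]_(x in Omega) `|(weight u x * (f x * f x))%:E| = 0)%E.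
  under eq_integral do rewrite gee0_abs ?lee_fin//.
  by rewrite -[LHS]fineK; [rewrite [fine _]m0|exact: integrable_fin_num].
apply: filterS ((ae_eq_integral_abs leb mO (measurable_int _ i1)).1 I0) => x /[apply] -[] /eqP.
rewrite mulf_eq0 => /orP[|]; last by rewrite -expr2 sqrf_eq0 => /eqP.
by rewrite /weight => /eqP /powR_eq0_eq0 /eqP; rewrite normr_eq0 => ->.
Qed.

Lemma rayleighE (f : E) : H10 Omega f ->
  rayleigh Omega lambda w f = energy Omega lambda f f / (mass Omega u f f / M).
Proof.
move=> fH; have fs := H10_Lp_crit n3 oO Ofin fH.
have i1 := weight_integrable n3 oO us fs fs.
rewrite /rayleigh; congr (_ / _).
transitivity (M^-1 * mass Omega u f f); last by rewrite mulrC.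
rewrite /mass -RintegralZl//; apply: eq_Rintegral => x _.
by rewrite -weight_normalized expr2 -!mulrA mulKf// gt_eqF.
Qed.

Lemma not_null_nonzero (f : E) : ~ null_on_support f -> nonzero_ae Omega f.
Proof. by apply: contra_not => Hf; apply: filterS Hf => x Hx Ox _; exact: Hx. Qed.

Lemma wdim_fam (V : set ('rV[R]_n -> R)) k : wdim Omega w V k <->
  exists v : 'I_k -> E, [/\ forall i, H10 Omega (v i), V = [set lincomb c v | c in setT] &
    indep_mod null_on_support v].
Proof.
have spanE (v : 'I_k -> E) : fun_span v = [set lincomb c v | c in setT].
  apply/seteqP; split => [f [c ->]|f [c _ <-]]; exists c => //; by rewrite lincombE.
by split=> -[v [vH VE vI]]; exists v; split => //; rewrite ?VE ?spanE//;
  exact/lin_indep_weighted.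
Qed.

Lemma lincomb_not_null k (v : 'I_k -> E) c : indep_mod null_on_support v ->
  (exists i, c i != 0) -> ~ null_on_support (lincomb c v).
Proof. by move=> vI [i ci] /vI/(_ i) c0; rewrite c0 eqxx in ci. Qed.

Lemma low_quotient_negative k (v : 'I_k -> E) (m : R) : (forall i, H10 Omega (v i)) ->
  indep_mod null_on_support v -> m < M ->
  ubound (rayleigh Omega lambda w @`
    ([set lincomb c v | c in setT] `&` nonzero_ae Omega)) m ->
  negative_on form v.
Proof.
move=> vH vI mM ub c c0; set f := lincomb c v.
have fH : H10 Omega f by exact: H10_lincomb.
have nZ : ~ null_on_support f by exact: lincomb_not_null.
have D0 := mass_gt0 fH nZ.
have : rayleigh Omega lambda w f <= m.
  by apply: ub; exists f => //; split; [exists c|exact: not_null_nonzero].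
rewrite rayleighE// ler_pdivrMr ?divr_gt0// => le_m.
rewrite /form subr_lt0; apply: le_lt_trans le_m _.
by rewrite mulrA -mulrAC mulrC gtr_pMr// ltr_pdivrMr// mul1r.
Qed.

Lemma nonpositive_quotient k (v : 'I_k -> E) : (forall i, H10 Omega (v i)) ->
  indep_mod null_on_support v -> (forall c, form (lincomb c v) (lincomb c v) <= 0) ->
  ubound (rayleigh Omega lambda w @`
    ([set lincomb c v | c in setT] `&` nonzero_ae Omega)) M.
Proof.
move=> vH vI neg _ [g [[c _ <-] nz] <-].
set f := lincomb c v in nz *.
have fH : H10 Omega f by exact: H10_lincomb.
have nZ : ~ null_on_support f.
  apply: lincomb_not_null => //; apply: contrapT => /forallNP c0; apply: nz.
  apply: aeW => x _; rewrite /f lincombE big1// => i _.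
  by have /negP := c0 i; rewrite negbK => /eqP ->; rewrite mul0r.
have D0 := mass_gt0 fH nZ.
rewrite rayleighE// ler_pdivrMr ?divr_gt0// mulrCA divff ?gt_eqF// mulr1.
by rewrite -subr_le0; exact: neg.
Qed.

Definition has_negative_family k : Prop := exists v : 'I_k -> E,
  [/\ forall i, H10 Omega (v i), indep_mod null_on_support v & negative_on form v].

Lemma has_negative_family_bounded : exists B, forall k, has_negative_family k -> (k <= B)%N.
Proof.
have [L L0 OL] := bounded_set_box.
have [J [Q [mQ pos]]] := energy_sub_mass_ge0 n3 oO Ofin L0 lambda_ge0 OL us.
exists #|J| => k [v [vH _ vneg]].
apply: (@negative_bound R E (H10 Omega) form H10_0 H10_linS k v J
  (fun j f => \int[leb]_(x in Omega) (\1_(Q j) x * f x))) => //.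
move=> j c; have i1 i : leb.-integrable Omega (EFin \o (fun x => \1_(Q j) x * v i x)).
  exact: (Lp2_integrable mO Ofin (indic_mul_Lp2 oO (mQ j) (H10_Lp2 (vH i)))).
transitivity (\int[leb]_(x in Omega) (\sum_i (c i * (\1_(Q j) x * v i x)))).
  apply: eq_Rintegral => x _; rewrite lincombE mulr_sumr.
  by apply: eq_bigr => i _; rewrite mulrCA.
rewrite Rintegral_sum//; last by move=> i; exact: (integrableZl mO (c i) (i1 i)).
by apply: eq_bigr => i _; rewrite RintegralZl.
Qed.

Lemma maximal_negative_family : exists2 k, has_negative_family k & ~ has_negative_family k.+1.
Proof.
have [B HB] := has_negative_family_bounded.
pose P k := `[< has_negative_family k >].
have P0 : exists k, P k.
  (* The empty family starts the search: K may be 0, and the eigenvalue index [K + 1] is at least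
     1. *)
  exists 0%N; apply/asboolP; exists (fun i : 'I_0 => (0 : E)).
  split => [i|c _ i|c [i _]].
  - exact: H10_0.
  - by case: i.
  - by case: i => m; rewrite ltn0.
have PB k : P k -> (k <= B)%N by move=> /asboolP; exact: HB.
have [k /asboolP Pk kmax] := ex_maxnP P0 PB; exists k => // Pk1.
by have := kmax k.+1; rewrite ltnn => /(_ (introT (asboolP _) Pk1)).
Qed.

(** H^1_0 is infinite-dimensional modulo [Z]: [k + 1] test functions independent on the support of
    [u] cannot all lie in the span of [v] plus [Z]. *)
Lemma outside_negative_family k (v : 'I_k -> E) :
  exists2 f : E, H10 Omega f & forall c, ~ null_on_support (f - lincomb c v).
Proof.
have [g [gt gI]] : exists g : 'I_k.+1 -> 'rV[R]_n -> R,
    (forall i, test_function Omega (g i)) /\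
    forall c : 'I_k.+1 -> R,
      {ae leb, forall x, Omega x -> u x != 0 -> \sum_i c i * g i x = 0} ->
      forall i, c i = 0.
  (* The construction uses a first coordinate, so the dimension has to be exhibited as a
     successor. *)
  clear -n3 oO u_neq0; case: n n3 Omega oO u u_neq0 => // n' _ O oO' u' nz.
  exact: independent_test_functions.
have [|j Hj] := @exists_outside R E null_on_support null_on_support_lin k v g.
  by move=> c; rewrite /null_on_support lincombE; exact: gI.
by exists (g j); [exact: test_function_H10 (gt j)|exact: Hj].
Qed.

Lemma weak_solution_eigenvalue :
  weak_solution Omega lambda (fun x => `|u x| `^ (s - 2) * u x) u ->
  exists2 k, (1 <= k)%N & weighted_eig Omega k lambda w = M%:E.
Proof.
move=> [_ weak].
have form_u (y : E) : H10 Omega y -> form u y = 0.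
  move=> yH; rewrite /form /energy weak// /mass; apply/eqP; rewrite subr_eq0; apply/eqP.
  by apply: eq_Rintegral => x _; rewrite mulrA.
have nZu : ~ null_on_support u.
  move=> Zu; apply: u_neq0; apply: filterS Zu => x Hx Ox.
  by apply/eqP; apply: contrapT => /negP ux; move/negP: (ux); rewrite Hx// eqxx.
have [k [v [vH vI vneg]] nmax] := maximal_negative_family.
have [v' [v'H v'I v'np [cu uE]]] := @nonpositive_extension R E (H10 Omega) null_on_support form
  H10_0 H10_linS null_on_support_lin form_sym form_lin k v u vH vI vneg u_H10 nZu form_u
  (outside_negative_family v).
exists k.+1 => //; apply/eqP; rewrite eq_le; apply/andP; split.
  apply: ereal_inf_lbound; exists M => //; exists [set lincomb c v' | c in setT]; split.
    by apply/wdim_fam; exists v'.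
  split; last exact: nonpositive_quotient.
  (* [M] has to be an attained maximum, not just an upper bound: [form u u = 0] means that energy
     and mass of [u] agree, so its quotient is exactly [M]. *)
  exists u; first by split => //; exists cu.
  have D0 := mass_gt0 u_H10 nZu.
  rewrite rayleighE//; have /eqP := form_u u u_H10; rewrite subr_eq0 => /eqP ->.
  by rewrite invf_div mulrCA divff ?mulr1// gt_eqF.
apply: le_ereal_inf_tmp => _ [m [V [/wdim_fam[v1 [v1H VE v1I]] [_ ub]]] <-].
rewrite lee_fin leNgt; apply/negP => mM; apply: nmax; exists v1; split => //.
by apply: (low_quotient_negative v1H v1I mM); rewrite -VE.
Qed.

End variational_setting.

Theorem proposition2p3 (R : realType) (n : nat) (n_ge3 : (3 <= n)%N)
    (Omega : set 'rV[R]_n) (Omega_domain : smooth_bounded_domain Omega)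
    (lambda : R) (lambda_ge0 : 0 <= lambda)
    (u : 'rV[R]_n -> R) (u_H10 : H10 Omega u) (u_neq0 : nonzero_ae Omega u) :
  let ut := fun x : 'rV[R]_n => u x / crit_norm Omega u in
  let w := fun x => (`|ut x| : R) in
  weak_solution Omega lambda (fun x => `|u x| `^ (crit_exp R n - 2) * u x) u <->
  exists k : nat, [/\ (1 <= k)%N,
    weighted_eig Omega k lambda w = (crit_norm Omega u `^ (crit_exp R n - 2))%:E &
    weighted_eigenspace Omega k lambda w ut].
Proof.
move=> ut w; have [oO _ bO _] := Omega_domain.
have normalized := @weak_solution_normalized R n Omega n_ge3 oO bO lambda u u_H10 u_neq0.
split=> [weak|[k [_ eigE [_]]]]; last by rewrite eigE => /normalized.
have [k k1 eigE] := weak_solution_eigenvalue n_ge3 oO bO lambda_ge0 u_H10 u_neq0 weak.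
exists k; split; [exact: k1|exact: eigE|split; rewrite eigE].
  by [].
exact: (normalized.1 weak).
Qed.
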